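(* Let $c_* := \frac{\pi}{2\sqrt{2}}$. Consider the unique single-lobe solution with the profile $\eta \in C^\infty_{\rm per}(\mathbb{T})$ of the equation $(c^2-2\eta)\eta'' - (\eta')^2 + \eta = 0$, $u \in \mathbb{T}$, for $c \in (1,c_* )$. For every initial data $\hat\eta_0 \in H^1_{\rm per}(\mathbb{T})$ satisfying $$\langle 1, \hat\eta_0\rangle = 0 \quad \text{and} \quad \langle \eta'', \hat\eta_0 \rangle = 0,$$ there exists a unique solution $\hat\eta \in C^0(\mathbb{R},H^1_{\rm per}(\mathbb{T}))$ of the linearized equation $$2c\,\partial_t \hat\eta = -\Pi_0 \partial_u^{-1} \Pi_0 \mathcal{L}\hat\eta, \qquad \mathcal{L} := -\partial_u (c^2 - 2\eta)\partial_u - 1 + 2\eta'',$$ with $\hat\eta|_{t=0} = \hat\eta_0$ and a unique $a \in C^1(\mathbb{R},\mathbb{R})$ such that $$\|\hat\eta(\cdot,t) - a(t)\eta'\|_{H^1_{\rm per}} \le C\|\hat\eta_0\|_{H^1_{\rm per}}, \qquad |a'(t)| \le C\|\hat\eta_0\|_{H^1_{\rm per}}, \qquad t \in \mathbb{R},$$ where $C>0$ is independent of $\hat\eta_0$.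
   Context: $\mathbb{T} = \mathbb{R}/(2\pi\mathbb{Z})$; $\langle\cdot,\cdot\rangle$ is the standard inner product in $L^2(\mathbb{T})$; $H^1_{\rm per}(\mathbb{T})$ is the Sobolev space of $2\pi$-periodic functions, and $C^\infty_{\rm per}(\mathbb{T})$ is the space of smooth $2\pi$-periodic functions. A single-lobe solution is a $2\pi$-periodic solution with an even profile $\eta$ which possesses a single maximum on $\mathbb{T}$, placed at $u=0$; for every $c \in (1,c_* )$ there is a unique single-lobe solution with profile in $C^\infty_{\rm per}(\mathbb{T})$. $\Pi_0$ is the projection operator in $L^2(\mathbb{T})$ onto the periodic functions with zero mean, and $\Pi_0\partial_u^{-1}\Pi_0$ sends $f$ to the zero-mean periodic antiderivative of $\Pi_0 f$. The perturbation $\hat\eta$ in the linearized equation is subject to the orthogonality condition $\langle 1-2\eta'',\hat\eta\rangle=0$.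
   Formalization: The two bounds alone do not determine a (for initial data η' every constant a with |1−a| ≤ C works), so uniqueness of a is stated and proved under the added normalization ⟨η', η̂(·,t) − a(t)η'⟩ = 0; existence of a with both bounds is proved in full. *)

(* Defs.v *)
From HB Require Import structures.
From mathcomp Require Import all_boot all_order all_algebra.
From mathcomp Require Import all_classical all_reals all_analysis.
Set Implicit Arguments.
Unset Strict Implicit.
Unset Printing Implicit Defensive.
Import Order.TTheory GRing.Theory Num.Theory.
Import numFieldNormedType.Exports.
Local Open Scope classical_set_scope.
Local Open Scope ring_scope.

(* Functions on the circle T = R / (2 pi Z) are 2 pi-periodic functions on R;
   integrals over T are taken over the period [0, 2 pi]. *)

Section FunctionsOnCircle.
Variable R : realType.
Implicit Types (f g v : R -> R) (u : R).

Definition per f : Prop := periodic f (2 * pi).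

Definition intT f : R := \int[lebesgue_measure]_(u in `[0, 2 * pi]) f u.

Definition ip f g : R := intT (fun u => f u * g u).

Definition L2per f : Prop :=
  [/\ per f, measurable_fun [set: R] f &
      lebesgue_measure.-integrable `[0, 2 * pi] (EFin \o (fun u => f u ^+ 2))].

Definition L2norm f : R := Num.sqrt (ip f f).

Definition smooth_per f : Prop :=
  per f /\ forall n u, derivable (derive1n n f) u 1.

(* A periodic distribution is represented by its values on the test functions
   in C^oo_per; its values on other functions are irrelevant, see [eqdistr]. *)
Definition distr := (R -> R) -> R.

Definition eqdistr (S T : distr) : Prop :=
  forall phi, smooth_per phi -> S phi = T phi.

Definition regular_distr f : distr := fun phi => ip f phi.

Definition diff_distr (T : distr) : distr := fun phi => - T (derive1 phi).

(* multiplication by a smooth periodic function m *)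
Definition mul_distr (m : R -> R) (T : distr) : distr :=
  fun phi => T (fun u => m u * phi u).

(* T minus the constant function of the same mean as T *)
Definition Pi0 (T : distr) : distr :=
  fun phi => T phi - T (fun=> 1) / (2 * pi) * intT phi.

Definition is_weak_derivative v g : Prop :=
  L2per g /\ eqdistr (diff_distr (regular_distr v)) (regular_distr g).

(* Elements of H^1_per(T) are represented by their continuous representatives,
   so that equality in H^1_per(T) is equality of functions. *)
Definition H1per v : Prop :=
  [/\ per v, continuous v & exists g, is_weak_derivative v g].

(* Chosen among weak derivatives, which all agree almost everywhere. *)
Definition weak_derivative v : R -> R :=
  xget (fun=> 0) [set g | is_weak_derivative v g].

Definition H1norm v : R :=
  Num.sqrt (ip v v + ip (weak_derivative v) (weak_derivative v)).

(* F = Pi0 d_u^{-1} Pi0 T, the zero-mean periodic antiderivative of Pi0 T;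
   F is determined almost everywhere. *)
Definition is_Pi0_antiderivative (T : distr) (F : R -> R) : Prop :=
  [/\ L2per F, intT F = 0 & eqdistr (diff_distr (regular_distr F)) (Pi0 T)].

End FunctionsOnCircle.

Section TravelingWave.
Variables (R : realType) (c : R) (eta : R -> R).

Definition c_star : R := pi / (2 * Num.sqrt 2).

Definition is_profile : Prop :=
  smooth_per eta /\
  forall u, (c ^+ 2 - 2 * eta u) * derive1n 2 eta u
            - derive1 eta u ^+ 2 + eta u = 0.

Definition single_lobe : Prop :=
  [/\ is_profile,
      forall u, eta (- u) = eta u,
      forall u, eta u <= eta 0 &
      forall u, eta u = eta 0 -> exists k : int, u = k%:~R * (2 * pi)].

(* L v = - d_u ((c^2 - 2 eta) d_u v) - v + 2 eta'' v, as a distribution: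
   for v in H^1_per it belongs to H^{-1}_per only. *)
Definition Lop (v : R -> R) : distr R := fun phi =>
  - diff_distr (mul_distr (fun u => c ^+ 2 - 2 * eta u)
                          (diff_distr (regular_distr v))) phi
  - regular_distr v phi
  + mul_distr (fun u => 2 * derive1n 2 eta u) (regular_distr v) phi.

(* h belongs to C^0(R, H^1_per) *)
Definition C0_H1 (h : R -> R -> R) : Prop :=
  (forall t, H1per (h t)) /\
  forall t, H1norm (fun u => h s u - h t u) @[s --> t] --> (0 : R).

(* w is the derivative at t of h : R -> L^2(T) *)
Definition is_time_derivative (h : R -> R -> R) (t : R) (w : R -> R) : Prop :=
  L2per w /\
  L2norm (fun u => s^-1 * (h (t + s) u - h t u) - w u) @[s --> (0 : R)^']
    --> (0 : R).

Definition linearized_equation (h : R -> R -> R) : Prop :=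
  forall t, exists w F,
    [/\ is_time_derivative h t w, is_Pi0_antiderivative (Lop (h t)) F &
        forall u, 2 * c * w u = - F u].

Definition linearized_solution (h0 : R -> R) (h : R -> R -> R) : Prop :=
  [/\ C0_H1 h,
      linearized_equation h,
      forall t, ip (fun u => 1 - 2 * derive1n 2 eta u) (h t) = 0 &
      h 0 = h0].

Definition C1 (a : R -> R) : Prop :=
  (forall t, derivable a t 1) /\ continuous (derive1 a).

(* The bounds on h - a eta' and a' do not determine a by themselves.  The
   function a is normalized by taking a(t) eta' to be the L^2-orthogonal
   projection of h(t) onto the span of eta'. *)
Definition is_modulation (h : R -> R -> R) (a : R -> R) : Prop :=
  C1 a /\
  forall t, ip (derive1 eta) (fun u => h t u - a t * derive1 eta u) = 0.

End TravelingWave.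

(* Main.v *)
Require Import Defs.
From HB Require Import structures.
From mathcomp Require Import all_boot all_order all_algebra.
From mathcomp Require Import all_classical all_reals all_analysis.
From mathcomp Require Import measurable_realfun ring lra.
Import Order.TTheory GRing.Theory Num.Theory.
Import numFieldNormedType.Exports.
Local Open Scope classical_set_scope.
Local Open Scope ring_scope.
Set Implicit Arguments.
Unset Strict Implicit.
Unset Printing Implicit Defensive.

(** Write p = c^2 - 2 eta, T = 2 pi and Q(v) = int p v'^2 + (2 eta'' - 1) v^2,
    the quadratic form of L.  Translating the wave gives L eta' = 0, so that Q
    cannot see the direction eta'.  The theorem holds because Q is conserved by
    the linearized flow and controls the H^1 norm of the part of a constrained
    perturbation that is orthogonal to eta'; only the coefficient of eta' is
    left free to drift, and it drifts at a bounded rate.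

    Coercivity ([coercive]).  The first integral p eta'^2 + eta^2 = eta(0)^2
    shows that p > 0 and that eta' vanishes on a period at the crest 0 and the
    trough pi only.  Between these zeros Jacobi's identity
    Q(v) = int p eta'^2 ((v / eta')')^2 makes Q nonnegative on functions
    vanishing at 0 and pi, and controls the distance of v to a multiple of eta'
    on each half period ([dirichlet_estimate]).  On the other hand the equation
    L n = 2 eta'' has an explicit even periodic solution n, the derivative of
    the wave with respect to the speed up to a factor.  The functions 1 and n
    are Q-orthogonal, Q is negative on both, and the two constraints
    <1, v> = <eta'', v> = 0 say that v is Q-orthogonal to them.  Adding a
    combination of 1 and n to v therefore lowers Q, and can be used to make v
    vanish at 0 and pi ([form_shift], [two_halves]).  The two multiples of eta'
    found on the half periods are then controlled through <1, v> = 0 and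
    <eta', v> = 0.

    The flow.  Carrying out the antiderivative turns the equation into
    2 c h_t = p h_u + 2 c B h, where B is a bounded operator that gains one
    derivative ([flux_antiderivative], [antiderivative_flux]).  In the
    coordinate y = X(u) + om t, where X' = 2 c om / p and X(u + T) = X(u) + T,
    the transport disappears and an ordinary differential equation in the space
    of continuous functions remains, which is solved by iteration ([picard]).
    The solution keeps the form of an initial datum transported by a
    diffeomorphism plus a term that is C^1 in y, and continuity in H^1 and
    differentiability in L^2 follow from the L^2 continuity of translations and
    the L^2 convergence of difference quotients ([per_shift_cvg],
    [per_diffquot_cvg]).  Uniqueness is Gronwall's inequality for the L^2 norm
    of a difference of solutions ([linearized_unique]).

    Conserved quantities.  The equation has zero mean, and pairing it with
    eta'' gives <h, L eta'> = 0, so that both constraints persist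
    ([conserved_mean], [conserved_e2]); with them Q(h) is constant
    ([form_conserved]).  Finally, a = <eta', h> / <eta', eta'> makes h - a eta'
    orthogonal to eta', Q(h - a eta') = Q(h) because L eta' = 0, and coercivity
    bounds h - a eta'.  Pairing the equation with eta' gives
    2 c <eta', eta'> a' = <L eta, h>, and L eta is orthogonal to eta', so that
    a' depends on h - a eta' only ([d_modulation], [dmodulation_bound]). *)

(** * Oriented integrals *)

(** The integral is oriented so that Chasles' relation and the fundamental theorem
    of calculus hold for bounds in any order. *)
HB.lock Definition sint (R : realType) (f : R -> R) (a b : R) : R :=
  \int[lebesgue_measure]_(u in `[a, b]) f u -
  \int[lebesgue_measure]_(u in `[b, a]) f u.

Section OrientedIntegral.
Variable R : realType.
Implicit Types (f g : R -> R) (a b c u x y : R).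
Notation mu := (@lebesgue_measure R).

Definition loc_integrable f : Prop :=
  measurable_fun [set: R] f /\ forall a b, mu.-integrable `[a, b] (EFin \o f).

Lemma sint_sym f a b : sint f b a = - sint f a b.
Proof. by rewrite !sint.unlock opprB. Qed.

Lemma sintxx f a : sint f a a = 0.
Proof. by rewrite !sint.unlock subrr. Qed.

Lemma sint_le_Rintegral f a b : a <= b ->
  sint f a b = \int[mu]_(u in `[a, b]) f u.
Proof.
rewrite le_eqVlt => /predU1P[->|ab].
  by rewrite sintxx set_itv1 Rintegral_set1.
by rewrite !sint.unlock (@set_itv_ge _ _ (BLeft b)) ?Rintegral_set0 ?subr0// bnd_simp -ltNge.
Qed.

Lemma intT_sint f : intT f = sint f 0 (2 * pi).
Proof. by rewrite sint_le_Rintegral// mulr_ge0// pi_ge0. Qed.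

Lemma sint_chasles_le f a b c : loc_integrable f -> a <= b -> b <= c ->
  sint f a b + sint f b c = sint f a c.
Proof.
move=> [_ lf] ab bc; rewrite !sint_le_Rintegral//; last exact: le_trans bc.
have := @Rintegral_itvB _ f (BLeft a) (BRight c) b (lf a c).
rewrite !bnd_simp => /(_ ab bc) => H.
rewrite -(Rintegral_itv_obnd_cbnd (r := b)); last first.
  by apply: integrableS (lf b c) => //; apply: subset_itvr; rewrite bnd_simp.
by rewrite -H addrC subrK.
Qed.

Lemma sint_chasles f a b c : loc_integrable f ->
  sint f a b + sint f b c = sint f a c.
Proof.
move=> lf.
wlog ac : a c / a <= c => [th|].
  have [/th//|/ltW ca] := leP a c.
  by rewrite (sint_sym f b a) (sint_sym f c b) (sint_sym f c a) -opprD addrC th.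
have [ab|/ltW ba] := leP a b.
  have [bc|/ltW cb] := leP b c; first exact: sint_chasles_le.
  by rewrite -(sint_chasles_le lf ac cb) (sint_sym f c b) addrK.
rewrite -(sint_chasles_le lf ba ac) (sint_sym f b a); lra.
Qed.

Lemma sint_diff f a b c : loc_integrable f -> sint f a c - sint f a b = sint f b c.
Proof. by move=> lf; rewrite -(@sint_chasles f a b c)//; lra. Qed.

Lemma eq_sint f g a b : f =1 g -> sint f a b = sint g a b.
Proof. by move=> fg; congr (sint _ _ _); apply/funext. Qed.

Lemma eq_loc_integrable f g : f =1 g -> loc_integrable f -> loc_integrable g.
Proof. by move=> /funext ->. Qed.

Lemma loc_integrableD f g : loc_integrable f -> loc_integrable g ->
  loc_integrable (fun u => f u + g u).
Proof.
move=> [mf f_] [mg g_]; split; first exact: measurable_funD.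
by move=> a b; have /(_ (measurable_itv _)) := @integrableD _ _ _ mu _ _ _ _ (f_ a b) (g_ a b).
Qed.

Lemma loc_integrableZ k f : loc_integrable f ->
  loc_integrable (fun u => k * f u).
Proof.
move=> [mf f_]; split; first exact: measurable_funM.
by move=> a b; have /(_ (measurable_itv _)) := @integrableZl _ _ _ mu _ _ k _ (f_ a b).
Qed.

Lemma loc_integrableN f : loc_integrable f -> loc_integrable (fun u => - f u).
Proof.
by move/(loc_integrableZ (-1)); apply: eq_loc_integrable => u; rewrite mulN1r.
Qed.

Lemma loc_integrableB f g : loc_integrable f -> loc_integrable g ->
  loc_integrable (fun u => f u - g u).
Proof. by move=> lf lg; apply: loc_integrableD => //; exact: loc_integrableN. Qed.

Lemma loc_integrable_norm f : loc_integrable f -> loc_integrable (fun u => `|f u|).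
Proof.
move=> [mf f_]; split; first exact: measurableT_comp.
by move=> a b; exact: integrable_norm (f_ a b).
Qed.

Lemma continuous_loc_integrable f : continuous f -> loc_integrable f.
Proof.
move=> cf; split; first exact: continuous_measurable_fun.
move=> a b; apply: continuous_compact_integrable; first exact: segment_compact.
exact/continuous_subspaceT.
Qed.

Lemma loc_integrable_cst k : loc_integrable (fun=> k).
Proof. by apply: continuous_loc_integrable => x; exact: cvg_cst. Qed.

Lemma le_loc_integrable f g : measurable_fun [set: R] f -> loc_integrable g ->
  (forall u, `|f u| <= g u) -> loc_integrable f.
Proof.
move=> mf [_ g_] fg; split=> // a b.
apply: le_integrable (g_ a b) => //.
  by apply/measurable_EFinP; exact: measurable_funTS.
by move=> x _ /=; rewrite lee_fin (le_trans (fg x))// ler_norm.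
Qed.

Lemma sintD f g a b : loc_integrable f -> loc_integrable g ->
  sint (fun u => f u + g u) a b = sint f a b + sint g a b.
Proof.
move=> [_ f_] [_ g_].
by rewrite !sint.unlock !RintegralD//; lra.
Qed.

Lemma sintZ k f a b : loc_integrable f ->
  sint (fun u => k * f u) a b = k * sint f a b.
Proof. by move=> [_ f_]; rewrite !sint.unlock !RintegralZl// mulrBr. Qed.

Lemma sintN f a b : loc_integrable f ->
  sint (fun u => - f u) a b = - sint f a b.
Proof.
move=> lf; rewrite -mulN1r -sintZ//; apply: eq_sint => u; by rewrite mulN1r.
Qed.

Lemma sintB f g a b : loc_integrable f -> loc_integrable g ->
  sint (fun u => f u - g u) a b = sint f a b - sint g a b.
Proof.
by move=> lf lg; rewrite sintD ?sintN//; exact: loc_integrableN.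
Qed.

Lemma sint_le f g a b : loc_integrable f -> loc_integrable g -> a <= b ->
  (forall u, a <= u <= b -> f u <= g u) -> sint f a b <= sint g a b.
Proof.
move=> [_ f_] [_ g_] ab fg; rewrite !sint_le_Rintegral// le_Rintegral//.
Qed.

Lemma sint_ge0 f a b : a <= b ->
  (forall u, a <= u <= b -> 0 <= f u) -> 0 <= sint f a b.
Proof.
move=> ab f0; rewrite sint_le_Rintegral// Rintegral_ge0//.
Qed.

Lemma sint_abs f a b : loc_integrable f -> a <= b ->
  `|sint f a b| <= sint (fun u => `|f u|) a b.
Proof.
move=> [_ f_] ab; rewrite !sint_le_Rintegral//.
exact: le_normr_Rintegral.
Qed.

Lemma eq_sint_in f g a b : a <= b -> (forall u, a <= u <= b -> f u = g u) ->
  sint f a b = sint g a b.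
Proof.
move=> ab fg; rewrite !sint_le_Rintegral//; apply: eq_Rintegral => u.
by rewrite inE/= in_itv/=; exact: fg.
Qed.

Lemma is_derive_continuous (F : R -> R) f : (forall x, is_derive x 1 F (f x)) ->
  continuous F.
Proof.
move=> dF x; apply: differentiable_continuous; apply/derivable1_diffP.
by case: (dF x).
Qed.

Lemma sint_derive (F : R -> R) f a b : continuous f ->
  (forall x, is_derive x 1 F (f x)) -> sint f a b = F b - F a.
Proof.
move=> cf dF.
wlog ab : a b / a <= b => [th|].
  have [/th//|/ltW /th ba] := leP a b.
  by rewrite sint_sym ba; lra.
move: ab; rewrite le_eqVlt => /predU1P[->|ab]; first by rewrite sintxx subrr.
rewrite sint_le_Rintegral ?(ltW ab)// /Rintegral.
rewrite (@continuous_FTC2 _ f F)//.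
- exact/continuous_subspaceT.
- have cF := is_derive_continuous dF; split.
  + by move=> x _; case: (dF x).
  + apply: cvg_at_right_filter; exact: cF.
  + apply: cvg_at_left_filter; exact: cF.
- by move=> x _; rewrite derive1E; case: (dF x).
Qed.

Lemma sint_cst k a b : sint (fun=> k) a b = k * (b - a).
Proof.
have dk x : is_derive x 1 (fun y => k * y) k.
  by apply: is_derive_eq; rewrite /GRing.scale/= mulr1.
by rewrite (sint_derive a b _ dk) ?mulrBr// => x; exact: cvg_cst.
Qed.

Lemma sint_bound f a b (M : R) : loc_integrable f ->
  (forall u, Num.min a b <= u <= Num.max a b -> `|f u| <= M) ->
  `|sint f a b| <= M * `|b - a|.
Proof.
move=> lf.
have h c d : c <= d -> (forall u, c <= u <= d -> `|f u| <= M) ->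
    `|sint f c d| <= M * (d - c).
  move=> cd fM; rewrite -sint_cst.
  apply: le_trans (sint_abs lf cd) _; apply: sint_le => //.
    exact: loc_integrable_norm.
  exact: loc_integrable_cst.
have [ab fM|/ltW ba fM] := leP a b.
  by rewrite (ger0_norm (x := b - a)) ?subr_ge0//; exact: h.
by rewrite sint_sym normrN (distrC b a) (ger0_norm (x := a - b)) ?subr_ge0//; exact: h.
Qed.

Lemma derive_sint f a x : continuous f -> is_derive x 1 (sint f a) (f x).
Proof.
move=> cf; have lf := continuous_loc_integrable cf.
pose m := Num.min a x - 1.
have -> : sint f a = sint f m + cst (- sint f m a).
  apply/funext => y; rewrite fctE /=.
  by rewrite -(@sint_diff f m a y).
rewrite -[X in is_derive _ _ _ X]addr0; apply: is_deriveD.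
have mx : m < x by rewrite /m ltrBlDr (@le_lt_trans _ _ x)// ?ltrDl// ge_min lexx orbT.
have xx1 : x < x + 1 by rewrite ltrDl.
have [d1 d2] := @continuous_FTC1 R f (BLeft m) x (x + 1) xx1 (lf.2 _ _) mx (cf x).
have dd : is_derive x 1 (fun y => \int[mu]_(t in [set` Interval (BLeft m) (BRight y)]) f t) (f x).
  by apply: DeriveDef; [exact: d1|rewrite -derive1E; exact: d2].
apply: near_eq_is_derive dd.
near=> y; rewrite sint_le_Rintegral//.
by apply/ltW; near: y; exact: (open_gt mx).
Unshelve. all: by end_near. Qed.

End OrientedIntegral.

(** * Epsilon-delta forms of limits and derivatives *)

Section EpsilonDelta.
Variable R : realType.
Implicit Types (f F : R -> R) (x y e d l : R).

Lemma cvg_nbhsP f x l : f s @[s --> x] --> l <->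
  forall e, 0 < e -> exists2 d : R, 0 < d & forall y, `|y - x| < d -> `|f y - l| < e.
Proof.
split.
  move=> /cvgrPdist_lt h e /h [d/= d0 hd]; exists d => // y yx.
  by rewrite distrC; apply: hd; rewrite /= distrC.
move=> h; apply/cvgrPdist_lt => e /h [d d0 hd].
by exists d => //= y; rewrite /= distrC => /hd; rewrite distrC.
Qed.

Lemma cvg_dnbhsP f x l : f s @[s --> x^'] --> l <->
  forall e, 0 < e -> exists2 d : R, 0 < d &
    forall y, y != x -> `|y - x| < d -> `|f y - l| < e.
Proof.
split.
  move=> /cvgrPdist_lt h e /h [d/= d0 hd]; exists d => // y yx0 yx.
  by rewrite distrC; apply: hd => //; rewrite /= distrC.
move=> h; apply/cvgrPdist_lt => e /h [d d0 hd].
by exists d => //= y; rewrite /= distrC => yx yx0; rewrite distrC; exact: hd.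
Qed.

Lemma continuousP_ed f : continuous f <->
  forall x e, 0 < e ->
    exists2 d : R, 0 < d & forall y, `|y - x| < d -> `|f y - f x| < e.
Proof. by split=> h x; apply/cvg_nbhsP/h. Qed.

Lemma is_derive_ed f x l :
  (forall e, 0 < e -> exists2 d : R, 0 < d & forall y, `|y - x| < d ->
     `|f y - f x - l * (y - x)| <= e * `|y - x|) ->
  is_derive x 1 f l.
Proof.
move=> h.
have c : (fun s => s^-1 *: ((f \o shift x) (s *: 1) - f x)) @ 0^' --> l.
  apply/cvg_dnbhsP => e e0.
  have [d d0 hd] := h _ (divr_gt0 e0 (@ltr0n R 2)).
  exists d => // s s0; rewrite subr0 => sd /=.
  have := hd (s + x); rewrite addrK => /(_ sd) hs.
  have -> : s^-1 * (f (s *: 1 + x) - f x) - l = s^-1 * (f (s + x) - f x - l * s).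
    by rewrite /GRing.scale/= mulr1; field.
  have s0' : 0 < `|s| by rewrite normr_gt0.
  rewrite normrM normfV ltr_pdivrMl//.
  apply: le_lt_trans hs _; rewrite mulrC ltr_pM2l//.
  by rewrite ltr_pdivrMr// mulr_natr mulr2n ltrDl.
apply: DeriveDef; first by apply/cvg_ex; exists l.
exact/cvg_lim.
Qed.

Lemma is_derive_edP f x l : is_derive x 1 f l ->
  forall e, 0 < e -> exists2 d : R, 0 < d & forall y, `|y - x| < d ->
     `|f y - f x - l * (y - x)| <= e * `|y - x|.
Proof.
case=> /cvg_ex[l' cl']; move: (cl') => /cvg_lim; rewrite /derive => -> // <-.
move: cl' => /cvg_dnbhsP h e /h [d d0 hd]; exists d => // y yx.
have [->|ynx] := eqVneq y x; first by rewrite !subrr mulr0 subrr normr0 mulr0.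
have yx0 : y - x != 0 by rewrite subr_eq0.
have := hd _ yx0; rewrite subr0 => /(_ yx) /=.
rewrite /GRing.scale/= mulr1 subrK => /ltW hh.
have -> : f y - f x - l' * (y - x) = (y - x) * ((y - x)^-1 * (f y - f x) - l').
  by field.
by rewrite normrM mulrC ler_wpM2r.
Qed.

End EpsilonDelta.

(** * Locally square integrable functions *)

Section LocallySquareIntegrable.
Variable R : realType.
Implicit Types (f g v w c : R -> R) (a b u x y e d k : R).
Notation mu := (@lebesgue_measure R).

Lemma continuous_bounded_itv c a b : continuous c ->
  exists2 M : R, 0 < M & forall x, a <= x <= b -> `|c x| <= M.
Proof.
move=> cc.
have : compact (c @` `[a, b]).
  by apply: continuous_compact; [exact: continuous_subspaceT|exact: segment_compact].
move=> /compact_bounded [M [_ hM]].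
exists (`|M| + 1); first by rewrite ltr_wpDl.
move=> x xab; apply: (hM (`|M| + 1)); first by rewrite (le_lt_trans (ler_norm _))// ltrDl.
by exists x => //=; rewrite in_itv/=.
Qed.

Lemma loc_integrableMc c f : continuous c -> loc_integrable f ->
  loc_integrable (fun u => c u * f u).
Proof.
move=> cc [mf f_]; split.
  by apply: measurable_funM => //; exact: continuous_measurable_fun.
move=> a b; have [M M0 hM] := continuous_bounded_itv a b cc.
have := @integrableMr _ _ _ mu _ (measurable_itv `[a, b]) c _ _ _ (f_ a b).
apply.
  by apply: measurable_funTS; exact: continuous_measurable_fun.
exists M; split; first exact: num_real.
move=> M' MM' x /=; rewrite in_itv/= => /hM h.
by rewrite (le_trans h)// ltW.
Qed.

Lemma sint_continuous f a : loc_integrable f -> continuous (sint f a).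
Proof.
move=> lf x; pose m := Num.min a x - 1; pose n := x + 1.
have ma : m <= a by rewrite /m; case: (leP a x); lra.
have mx : m < x by rewrite /m; case: (leP a x); lra.
have xn : x < n by rewrite /n; lra.
have mn : m <= n by lra.
have cm : {for x, continuous (sint f m)}.
  have := parameterized_integral_continuous mn (lf.2 m n).
  move=> /within_continuous_continuous.
  move=> /(_ x (lt_trans mx xn)); rewrite in_itv/= mx xn => /(_ isT).
  move=> /cvg_nbhsP h; apply/(@cvg_nbhsP _ (sint f m)) => e /h [d d0 hd].
  exists (Num.min d (x - m)); first by rewrite lt_min d0 subr_gt0.
  move=> y; rewrite lt_min => /andP[yd]; rewrite ltr_norml => /andP[ym _].
  have my : m <= y by lra.
  rewrite (sint_le_Rintegral f my) (sint_le_Rintegral f (ltW mx)); exact: hd.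
have /(@cvg_nbhsP _ (sint f m)) hm := cm.
apply/(@cvg_nbhsP _ (sint f a)) => e /hm [d d0 hd].
by exists d => // y /hd; rewrite !(sint_diff _ _ _ lf).
Qed.

Lemma sint_small f u : loc_integrable f -> forall e, 0 < e ->
  exists2 d : R, 0 < d & forall y, `|y - u| < d -> `|sint f u y| < e.
Proof.
move=> lf e e0; have /(@cvg_nbhsP _ (sint f u)) /(_ e e0) [d d0 hd] := @sint_continuous f u lf u.
by exists d => // y /hd; rewrite sintxx subr0.
Qed.

Definition loc_sq_integrable f : Prop :=
  measurable_fun [set: R] f /\ loc_integrable (fun u => f u ^+ 2).

Lemma loc_sqM f g : loc_sq_integrable f -> loc_sq_integrable g ->
  loc_integrable (fun u => f u * g u).
Proof.
move=> [mf f2] [mg g2].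
apply: le_loc_integrable (loc_integrableD f2 g2) _; first exact: measurable_funM.
move=> u; rewrite normrM -(real_normK (num_real (f u))) -(real_normK (num_real (g u))).
have := sqr_ge0 (`|f u| - `|g u|); have := sqr_ge0 (`|f u| + `|g u|); nra.
Qed.

Lemma continuous_loc_sq c : continuous c -> loc_sq_integrable c.
Proof.
move=> cc; split; first exact: continuous_measurable_fun.
by apply: continuous_loc_integrable => x; apply: continuousM; exact: cc.
Qed.

Lemma loc_sq_loc_integrable f : loc_sq_integrable f -> loc_integrable f.
Proof.
move=> lf; have c1 : loc_sq_integrable (fun _ : R => 1).
  by apply: continuous_loc_sq => x; exact: cvg_cst.
by apply: eq_loc_integrable (loc_sqM lf c1) => u; rewrite mulr1.
Qed.

Lemma loc_sqD f g : loc_sq_integrable f -> loc_sq_integrable g ->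
  loc_sq_integrable (fun u => f u + g u).
Proof.
move=> lf lg; split; first by apply: measurable_funD; [exact: lf.1|exact: lg.1].
apply: (eq_loc_integrable (f := fun u => f u ^+ 2 + (2 * (f u * g u) + g u ^+ 2))).
  by move=> u; ring.
apply: loc_integrableD; first exact: lf.2.
by apply: loc_integrableD; [exact/loc_integrableZ/loc_sqM|exact: lg.2].
Qed.

Lemma loc_sqMc c f : continuous c -> loc_sq_integrable f ->
  loc_sq_integrable (fun u => c u * f u).
Proof.
move=> cc [mf lf]; split.
  by apply: measurable_funM => //; exact: continuous_measurable_fun.
apply: (eq_loc_integrable (f := fun u => c u ^+ 2 * f u ^+ 2)).
  by move=> u; rewrite exprMn.
by apply: loc_integrableMc => // x; apply: continuousM; exact: cc.
Qed.

Lemma loc_sqZ k f : loc_sq_integrable f -> loc_sq_integrable (fun u => k * f u).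
Proof. by apply: loc_sqMc => x; exact: cvg_cst. Qed.

Lemma loc_sqB f g : loc_sq_integrable f -> loc_sq_integrable g ->
  loc_sq_integrable (fun u => f u - g u).
Proof.
move=> lf /(loc_sqZ (-1)) /(loc_sqD lf); congr loc_sq_integrable.
by apply/funext => u; rewrite mulN1r.
Qed.

Lemma cauchy_schwarz f g a b : loc_sq_integrable f -> loc_sq_integrable g ->
  a <= b ->
  sint (fun u => f u * g u) a b ^+ 2 <=
  sint (fun u => f u ^+ 2) a b * sint (fun u => g u ^+ 2) a b.
Proof.
move=> lf lg ab; set B := sint _ a b; set A := sint _ a b; set C := sint _ a b.
have A0 : 0 <= A by apply: sint_ge0 => // u _; exact: sqr_ge0.
have q l : 0 <= l ^+ 2 * A - 2 * l * B + C.
  have -> : l ^+ 2 * A - 2 * l * B + C = sint (fun u => (l * f u - g u) ^+ 2) a b.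
    rewrite /A /B /C -(sintZ _ _ _ lf.2) -(sintZ _ _ _ (loc_sqM lf lg)).
    rewrite -sintB; [|exact/loc_integrableZ/lf.2|exact/loc_integrableZ/loc_sqM].
    rewrite -sintD; [|apply: loc_integrableB|exact: lg.2]; last 2 first.
    - exact/loc_integrableZ/lf.2.
    - exact/loc_integrableZ/loc_sqM.
    by apply: eq_sint => u; ring.
  by apply: sint_ge0 => // u _; exact: sqr_ge0.
have [A_0|A_n0] := eqVneq A 0; last first.
  have := q (B / A); have -> : (B / A) ^+ 2 * A - 2 * (B / A) * B + C = C - B ^+ 2 / A.
    by field.
  have A_gt0 : 0 < A by rewrite lt_neqAle eq_sym A_n0.
  by rewrite subr_ge0 ler_pdivrMr// mulrC.
rewrite A_0 mul0r.
have [->|B0] := eqVneq B 0; first by rewrite expr0n.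
have := q ((C + 1) / (2 * B)); rewrite A_0 mulr0 add0r.
have -> : - (2 * ((C + 1) / (2 * B)) * B) + C = - 1 by field.
by rewrite ler0N1.
Qed.

End LocallySquareIntegrable.

(** * Absolutely continuous functions with square integrable derivative *)

Section SobolevPairs.
Variable R : realType.
Implicit Types (f g v w k h : R -> R) (a b u x y e d : R).

(** The derivative g is carried along: it is determined almost everywhere only,
    and an explicit representative lets computations go on pointwise. *)
Definition H1loc v g : Prop :=
  loc_sq_integrable g /\ forall a b, v b - v a = sint g a b.

Lemma H1loc_continuous v g : H1loc v g -> continuous v.
Proof.
move=> [lg vg]; have lg' := loc_sq_loc_integrable lg; apply/continuousP_ed => x e e0.
have [d d0 hd] := sint_small x lg' e0.
by exists d => // y /hd; rewrite vg.
Qed.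

Lemma C1_H1loc F f : continuous f -> (forall x, is_derive x 1 F (f x)) -> H1loc F f.
Proof.
move=> cf dF; split; first exact: continuous_loc_sq.
by move=> a b; rewrite (sint_derive a b cf dF).
Qed.

Lemma H1locD v g w k : H1loc v g -> H1loc w k ->
  H1loc (fun u => v u + w u) (fun u => g u + k u).
Proof.
move=> [lg vg] [lk wk]; split; first exact: loc_sqD.
move=> a b; rewrite sintD; [|exact: loc_sq_loc_integrable..].
by rewrite -vg -wk; ring.
Qed.

Lemma H1locZ c v g : H1loc v g -> H1loc (fun u => c * v u) (fun u => c * g u).
Proof.
move=> [lg vg]; split; first exact: loc_sqZ.
move=> a b; rewrite sintZ; last exact: loc_sq_loc_integrable.
by rewrite -vg; ring.
Qed.

Lemma H1locB v g w k : H1loc v g -> H1loc w k ->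
  H1loc (fun u => v u - w u) (fun u => g u - k u).
Proof.
move=> hv /(H1locZ (-1)) /(H1locD hv); congr H1loc; apply/funext => u;
by rewrite mulN1r.
Qed.

Lemma H1loc_sq_incr v g a b : H1loc v g -> a <= b ->
  (v b - v a) ^+ 2 <= (b - a) * sint (fun u => g u ^+ 2) a b.
Proof.
move=> [lg vg] ab; rewrite vg.
have c1 : loc_sq_integrable (fun _ : R => 1).
  by apply: continuous_loc_sq => x; exact: cvg_cst.
have := cauchy_schwarz c1 lg ab.
have -> : sint (fun u => 1 * g u) a b = sint g a b.
  by apply: eq_sint => u; rewrite mul1r.
have -> : sint (fun _ : R => 1 ^+ 2) a b = b - a.
  by rewrite sint_cst expr1n mul1r.
by [].
Qed.

Lemma sqr_le_mul (x c A B : R) : 0 <= c -> 0 <= A -> 0 <= B ->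
  x ^+ 2 <= A * (c ^+ 2 * B) -> `|x| <= c * (A + B).
Proof.
move=> c0 A0 B0 h.
rewrite -(@ler_pXn2r _ 2)// ?nnegrE ?normr_ge0 ?mulr_ge0 ?addr_ge0//.
rewrite real_normK ?num_real//; apply: (le_trans h).
rewrite exprMn mulrCA ler_wpM2l ?sqr_ge0//; nra.
Qed.

(** The product rule up to an error of second order in the length of the interval,
    obtained without differentiating almost everywhere. *)
Lemma H1loc_product_incr v g w k a b : H1loc v g -> H1loc w k -> a <= b ->
  `|v b * w b - v a * w a - sint (fun u => g u * w u + v u * k u) a b| <=
  2 * (b - a) * sint (fun u => g u ^+ 2 + k u ^+ 2) a b.
Proof.
move=> hv hw ab; have [[lg vg] [lk wk]] := (hv, hw).
have cv := H1loc_continuous hv; have cw := H1loc_continuous hw.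
have lv := continuous_loc_sq cv; have lw := continuous_loc_sq cw.
have cst_sq (c : R) : loc_sq_integrable (fun _ => c).
  by apply: continuous_loc_sq => x; exact: cvg_cst.
have A0 : 0 <= sint (fun u => g u ^+ 2) a b by apply: sint_ge0 => // u _; exact: sqr_ge0.
have B0 : 0 <= sint (fun u => k u ^+ 2) a b by apply: sint_ge0 => // u _; exact: sqr_ge0.
(* one half of the estimate: the oscillation of z on [a, b] is at most
   sqrt ((b - a) * int m^2) *)
have half f z m c : loc_sq_integrable f -> H1loc z m -> (c = a \/ c = b) ->
    `|sint (fun u => f u * (z u - z c)) a b| <=
    (b - a) * (sint (fun u => f u ^+ 2) a b + sint (fun u => m u ^+ 2) a b).
  move=> lf hz cab; have [lm zm] := hz.
  have lz : loc_sq_integrable (fun u => z u - z c).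
    by apply: loc_sqB => //; exact: continuous_loc_sq (H1loc_continuous hz).
  apply: sqr_le_mul; rewrite ?subr_ge0//.
  - by apply: sint_ge0 => // u _; exact: sqr_ge0.
  - by apply: sint_ge0 => // u _; exact: sqr_ge0.
  apply: le_trans (cauchy_schwarz lf lz ab) _.
  apply: ler_wpM2l; first by apply: sint_ge0 => // u _; exact: sqr_ge0.
  apply: (@le_trans _ _ (sint (fun=> (b - a) * sint (fun u => m u ^+ 2) a b) a b)).
    apply: sint_le => //; [exact: lz.2|exact: loc_integrable_cst|].
    move=> u /andP[au ub].
    have I0 x y : x <= y -> 0 <= sint (fun u => m u ^+ 2) x y.
      by move=> xy; apply: sint_ge0 => // t _; exact: sqr_ge0.
    have := sint_chasles a u b lm.2; have := I0 _ _ au; have := I0 _ _ ub.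
    case: cab => ->.
      by have := H1loc_sq_incr hz au; nra.
    by rewrite -sqrrN opprB; have := H1loc_sq_incr hz ub; nra.
  by rewrite sint_cst; nra.
have := half _ _ _ b lg hw (or_intror erefl).
have := half _ _ _ a lk hv (or_introl erefl).
rewrite sintD; [|exact: loc_sqM..].
rewrite (sintD _ _ lg.2 lk.2).
have -> : sint (fun u => k u * (v u - v a)) a b =
    sint (fun u => v u * k u) a b - v a * (w b - w a).
  rewrite wk -sintZ; last exact: loc_sq_loc_integrable.
  rewrite -sintB; [|exact: loc_sqM|exact/loc_integrableZ/loc_sq_loc_integrable].
  by apply: eq_sint => u; ring.
have -> : sint (fun u => g u * (w u - w b)) a b =
    sint (fun u => g u * w u) a b - w b * (v b - v a).
  rewrite vg -sintZ; last exact: loc_sq_loc_integrable.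
  rewrite -sintB; [|exact: loc_sqM|exact/loc_integrableZ/loc_sq_loc_integrable].
  by apply: eq_sint => u; ring.
rewrite !ler_norml => /andP[h1 h2] /andP[h3 h4]; apply/andP; split; lra.
Qed.

(** The integral of g^2 + k^2 over a short interval is small, so that by
    [H1loc_product_incr] the difference of v w and the primitive of its formal
    derivative has derivative zero everywhere. *)
Lemma H1locM v g w k : H1loc v g -> H1loc w k ->
  H1loc (fun u => v u * w u) (fun u => g u * w u + v u * k u).
Proof.
move=> hv hw; have [[lg vg] [lk wk]] := (hv, hw).
have cv := H1loc_continuous hv; have cw := H1loc_continuous hw.
have lgw : loc_sq_integrable (fun u => g u * w u + v u * k u).
  apply: loc_sqD; last exact: loc_sqMc.
  have -> : (fun u => g u * w u) = (fun u => w u * g u) by apply/funext => u; rewrite mulrC.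
  exact: loc_sqMc.
have lgw1 := loc_sq_loc_integrable lgw.
split=> // a b; pose P u := v u * w u - sint (fun u => g u * w u + v u * k u) a u.
suff : P a = P b by rewrite /P sintxx; lra.
have lq : loc_integrable (fun u => g u ^+ 2 + k u ^+ 2).
  by apply: loc_integrableD; [exact: lg.2|exact: lk.2].
apply: is_derive_0_is_cst => x; apply: is_derive_ed => e e0.
have [d d0 hd] := sint_small x lq (divr_gt0 e0 (ltr0n R 2)).
exists d => // y /hd; rewrite mul0r subr0.
have -> : P y - P x = v y * w y - v x * w x - sint (fun u => g u * w u + v u * k u) x y.
  by rewrite -(sint_diff a x y lgw1) /P; ring.
have [xy|/ltW yx] := leP x y.
  have := H1loc_product_incr hv hw xy.
  rewrite (ger0_norm (x := y - x)) ?subr_ge0// => h1 h2; apply: le_trans h1 _.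
  move: h2 => /ltr_normlW h2; nra.
have := H1loc_product_incr hv hw yx.
rewrite !(sint_sym _ x y) (ler0_norm (x := y - x)) ?subr_le0//.
rewrite -normrN (_ : - (_ - _ - _) = v y * w y - v x * w x -
  sint (fun u => g u * w u + v u * k u) x y); last by ring.
rewrite ltr_norml => h1 /andP[h2 _]; apply: le_trans h1 _; nra.
Qed.

Lemma H1loc_parts v g w k a b : H1loc v g -> H1loc w k ->
  sint (fun u => g u * w u) a b =
  v b * w b - v a * w a - sint (fun u => v u * k u) a b.
Proof.
move=> hv hw; have [_ ->] := H1locM hv hw.
rewrite sintD ?addrK//; apply: loc_sqM; first exact: hv.1.
- exact/continuous_loc_sq/(H1loc_continuous hw).
- exact/continuous_loc_sq/(H1loc_continuous hv).
- exact: hw.1.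
Qed.

End SobolevPairs.

(** * Change of variables *)

Section Substitution.
Variable R : realType.
Notation mu := (@lebesgue_measure R).
Implicit Types (f g v w X U x : R -> R) (a b t : R).

(** x is the derivative of X and U its inverse. *)
Definition diffeo X x U : Prop :=
  [/\ continuous x, forall t, 0 < x t, forall t, is_derive t 1 X (x t),
      cancel U X & cancel X U].

Lemma diffeo_lt X x U : diffeo X x U -> {homo X : s t / s < t}.
Proof.
move=> [cx x0 dX _ _] s t st; have := sint_derive s t cx dX; rewrite -subr_gt0 => <-.
have [c _ cE] := MVT st (fun z _ => dX z) (continuous_subspaceT (is_derive_continuous dX)).
by rewrite (sint_derive s t cx dX) cE mulr_gt0 ?subr_gt0.
Qed.

Lemma diffeo_le X x U : diffeo X x U -> {mono X : s t / s <= t}.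
Proof. by move/diffeo_lt/le_mono. Qed.

Import HBNNSimple.
Local Open Scope ereal_scope.

(** The set function B |-> int_{X^-1 B} x is a measure agreeing with the Lebesgue
    measure on intervals, hence equal to it; simple functions then approximate a
    general integrand.  Weak derivatives are substituted into, hence a merely
    measurable integrand. *)
Lemma ge0_substitution X x U (G : R -> \bar R) : diffeo X x U ->
  measurable_fun [set: R] G -> (forall t, 0 <= G t) ->
  \int[mu]_t G t = \int[mu]_t (G (X t) * (x t)%:E).
Proof.
move=> dX mG G0; have [cx x0 dXx UX XU] := dX.
have mX : measurable_fun [set: R] X.
  exact: continuous_measurable_fun (is_derive_continuous dXx).
have mx : measurable_fun [set: R] (EFin \o x).
  by apply/measurable_EFinP; exact: continuous_measurable_fun cx.
have mXB (B : set R) : measurable B -> measurable (X @^-1` B).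
  by move=> mB; rewrite -(setTI (_ @^-1` _)); exact: mX.
pose nu (B : set (measurableTypeR R)) : \bar R := \int[mu]_(t in X @^-1` B) (x t)%:E.
have nu0 : nu set0 = 0 by rewrite /nu preimage_set0 integral_set0.
have nu_ge0 B : 0 <= nu B by apply: integral_ge0 => t _; rewrite lee_fin ltW.
have nu_sa : semi_sigma_additive nu.
  move=> F mF tF mUF; rewrite /nu preimage_bigcup ge0_integral_bigcup//.
  - apply: is_cvg_ereal_nneg_natsum_cond => n _ _.
    exact: (nu_ge0 (F n)).
  - by move=> k; exact: (mXB _ (mF k)).
  - exact: measurable_funTS.
  - by move=> t _; rewrite lee_fin ltW.
  - move=> i j _ _ [t [ti tj]]; apply: tF => //; by exists (X t).
pose M := isMeasure.Build _ _ _ nu nu0 nu_ge0 nu_sa.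
pose nu' : {measure set (measurableTypeR R) -> \bar R} := HB.pack nu M.
have nuE (B : set R) : measurable B -> mu B = nu B.
  apply: (@lebesgue_measure_unique R nu').
  move=> _ [[a b] _ <-]/=.
  have [ab|ba] := ltP a b; last first.
    by rewrite set_itv_ge ?measure0//= bnd_simp -leNgt.
  have -> : nu [set` `]a, b]] = \int[mu]_(t in `[U a, U b]) (x t)%:E.
    rewrite /nu (_ : X @^-1` _ = `]U a, U b]%classic); last first.
      apply/funext => t /=; rewrite !in_itv/=.
      have -> : (a < X t)%R = (U a < t)%R by rewrite -{1}(UX a) (leW_mono (diffeo_le dX)).
      by have -> : (X t <= b)%R = (t <= U b)%R by rewrite -{1}(UX b) (diffeo_le dX).
    rewrite integral_itv_obnd_cbnd//.
    exact: measurable_funTS.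
  rewrite lebesgue_measure_itv/= lte_fin ab.
  have UaUb : (U a < U b)%R by rewrite -(leW_mono (diffeo_le dX)) !UX.
  have cX := is_derive_continuous dXx.
  rewrite (continuous_FTC2 UaUb (F := X)) ?UX//.
  - exact/continuous_subspaceT.
  - split; first by move=> t _; case: (dXx t).
      by apply: cvg_at_right_filter; exact: cX.
    by apply: cvg_at_left_filter; exact: cX.
  - by move=> t _; rewrite derive1E; case: (dXx t).
pose f_ := @nnsfun_approx _ (measurableTypeR R) R setT measurableT G mG.
have mf n : measurable_fun [set: measurableTypeR R] (f_ n) by [].
transitivity (limn (fun n => \int[mu]_t (f_ n t)%:E)).
  rewrite -monotone_convergence//.
  - apply: eq_integral => y _; apply/esym/cvg_lim => //.
    by apply: cvg_nnsfun_approx => // *; apply: G0.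
  - by move=> n; apply/measurable_EFinP; exact: mf.
  - by move=> n y _; rewrite lee_fin.
  - by move=> y _ m n mn; rewrite lee_fin; exact/lefP/nd_nnsfun_approx.
have mfX n : measurable_fun [set: R] (fun t => f_ n (X t)).
  exact: (measurableT_comp (mf n) mX).
rewrite [X in limn X](_ : _ = (fun n => \int[mu]_t (f_ n (X t) * x t)%:E)).
  rewrite -monotone_convergence//; last 3 first.
  - move=> n; apply/measurable_EFinP; apply: measurable_funM; [exact: mfX|].
    exact: continuous_measurable_fun cx.
  - by move=> n t _; rewrite lee_fin mulr_ge0// ltW.
  - by move=> t _ m n mn; rewrite lee_fin ler_pM2r//; have /lefP := @nd_nnsfun_approx _ (measurableTypeR R) R setT measurableT G mG _ _ mn; apply.
  apply: eq_integral => t _; apply/cvg_lim => //.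
  under eq_fun do rewrite EFinM.
  apply: cvgeZr => //.
  by apply: cvg_nnsfun_approx => // *; apply: G0.
apply/funext => n.
transitivity (\sum_(k \in range (f_ n))
    \int[mu]_t (k * \1_(f_ n @^-1` [set k]) t)%:E).
  under eq_integral do rewrite fimfunE -fsumEFin//.
  rewrite ge0_integral_fsum//.
  - by move=> y; exact/measurable_EFinP/measurable_funM.
  - by move=> y t _; rewrite nnfun_muleindic_ge0.
transitivity (\sum_(k \in range (f_ n))
    \int[mu]_t (k * \1_(f_ n @^-1` [set k]) (X t) * x t)%:E); last first.
  rewrite -ge0_integral_fsum//.
  - apply: eq_integral => t _; rewrite fsumEFin//; congr EFin.
    by rewrite (fimfunE (f_ n) (X t)) mulr_fsuml.
  - move=> r; apply/measurable_EFinP; apply: measurable_funM.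
      apply: measurable_funM => //.
      have mr : measurable (f_ n @^-1` [set r] : set (measurableTypeR R)).
        exact: measurable_sfunP.
      exact: (measurableT_comp (measurable_indic mr) mX).
    exact: continuous_measurable_fun cx.
  - move=> r t _; rewrite EFinM; apply: mule_ge0; last by rewrite lee_fin ltW.
    by rewrite EFinM; exact: nnfun_muleindic_ge0.
apply: eq_fsbigr => r _.
have mA : measurable (f_ n @^-1` [set r] : set (measurableTypeR R)).
  exact: measurable_sfunP.
rewrite integralZl_indic_nnsfun// integral_indic// setIT.
have [r0|r0] := ltP r 0%R.
  rewrite preimage_nnfun0// measure0 mule0.
  by rewrite integral0_eq// => t _; rewrite indicE in_set0 mulr0 mul0r.
transitivity (r%:E * nu (f_ n @^-1` [set r])); first by congr (_ * _); exact: nuE.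
rewrite /nu integral_mkcond epatch_indic -ge0_integralZl//.
- apply: eq_integral => t _; rewrite /= -!EFinM -mulrA; congr (_ * _)%:E.
  by rewrite mulrC.
- apply: emeasurable_funM => //; apply/measurable_EFinP.
  by apply: measurable_indic; exact: mXB.
- by move=> t _; rewrite mule_ge0// lee_fin// ltW.
Qed.

Lemma ge0_substitution_itv X x U (G : R -> R) a b : diffeo X x U ->
  measurable_fun [set: R] G -> (forall t, (0 <= G t)%R) ->
  \int[mu]_(t in `[X a, X b]) (G t)%:E = \int[mu]_(t in `[a, b]) (G (X t) * x t)%:E.
Proof.
move=> dX mG G0; rewrite integral_mkcond (ge0_substitution dX).
- rewrite [RHS]integral_mkcond; apply: eq_integral => t _.
  rewrite /= !patchE.
  have -> : (X t \in `[X a, X b]%classic) = (t \in `[a, b]%classic).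
    by apply/idP/idP; rewrite !inE/= !in_itv/= !(diffeo_le dX).
  by case: ifP => // _; rewrite mul0e.
- apply/(measurable_restrictT _ _).1 => //; apply/measurable_EFinP.
  exact: measurable_funTS.
- by move=> t; rewrite patchE; case: ifP => //; rewrite lee_fin.
Qed.

Local Close Scope ereal_scope.

Lemma loc_integrable_diffeo X x U g : diffeo X x U -> loc_integrable g ->
  loc_integrable (fun t => g (X t) * x t).
Proof.
move=> dX [mg lg]; have [cx x0 dXx UX XU] := dX.
have mX : measurable_fun [set: R] X.
  exact: continuous_measurable_fun (is_derive_continuous dXx).
split.
  by apply: measurable_funM; [exact: measurableT_comp|exact: continuous_measurable_fun].
move=> a b; apply/integrableP; split.
  apply/measurable_EFinP/measurable_funTS/measurable_funM.
    exact: measurableT_comp.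
  exact: continuous_measurable_fun.
have := ge0_substitution_itv a b dX (measurableT_comp (@normr_measurable R setT) mg).
move=> /(_ (fun t => normr_ge0 _)).
under [in X in _ -> X]eq_integral do rewrite /= normrM (ger0_norm (ltW (x0 _))).
move=> <-.
by have /integrableP[_] := lg (X a) (X b).
Qed.

Lemma sint_substitution X x U g a b : diffeo X x U -> loc_integrable g ->
  sint (fun t => g (X t) * x t) a b = sint g (X a) (X b).
Proof.
move=> dX lg.
wlog ab : a b / a <= b => [th|].
  have [/th//|/ltW /th ba] := leP a b.
  by rewrite sint_sym ba -sint_sym.
have XaXb : X a <= X b by rewrite (diffeo_le dX).
have h f : loc_integrable f -> (forall t, 0 <= f t) ->
    sint (fun t => f (X t) * x t) a b = sint f (X a) (X b).
  move=> [mf lf] f0; rewrite !sint_le_Rintegral//.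
  by rewrite /Rintegral (ge0_substitution_itv a b dX).
have lg' := loc_integrable_norm lg.
have h1 := h _ (loc_integrableD lg lg').
have h2 := h _ lg' (fun t => normr_ge0 _).
have lgX := loc_integrable_diffeo dX lg.
have lgX' := loc_integrable_diffeo dX lg'.
have -> : sint (fun t => g (X t) * x t) a b =
   sint (fun t => (g (X t) + `|g (X t)|) * x t) a b - sint (fun t => `|g (X t)| * x t) a b.
  rewrite -sintB//; first by apply: eq_sint => t; ring.
  by apply: eq_loc_integrable (loc_integrableD lgX lgX') => t; ring.
rewrite h1 ?h2 ?sintD//; last first.
  by move=> t; rewrite -lerBlDl sub0r -normrN ler_norm.
by ring.
Qed.

Lemma loc_sq_diffeo X x U g : diffeo X x U -> loc_sq_integrable g ->
  loc_sq_integrable (fun t => g (X t)).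
Proof.
move=> dX [mg lg]; have [cx x0 dXx UX XU] := dX; split.
  apply: measurableT_comp => //.
  exact: continuous_measurable_fun (is_derive_continuous dXx).
apply: eq_loc_integrable (loc_integrableMc (c := fun t => (x t)^-1) _ (loc_integrable_diffeo dX lg)).
  by move=> t; rewrite mulrCA mulVf ?mulr1// gt_eqF.
by move=> t; apply: continuousV; [rewrite gt_eqF|exact: cx].
Qed.

Lemma H1loc_diffeo X x U v g : diffeo X x U -> H1loc v g ->
  H1loc (fun t => v (X t)) (fun t => g (X t) * x t).
Proof.
move=> dX [lg vg]; have [cx _ _ _ _] := dX; split.
  have -> : (fun t => g (X t) * x t) = (fun t => x t * g (X t)).
    by apply/funext => t; rewrite mulrC.
  exact/loc_sqMc/(loc_sq_diffeo dX).
move=> a b; rewrite (sint_substitution _ _ dX) ?vg//.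
exact: loc_sq_loc_integrable.
Qed.

Lemma diffeo_shift s : diffeo (fun t => t + s) (fun=> 1) (fun t => t - s).
Proof.
split=> [t|t|t|t|t]; [exact: cvg_cst|exact: ltr01| |by rewrite subrK|by rewrite addrK].
by apply: is_derive_eq; rewrite addr0.
Qed.

Lemma loc_integrable_shift g s : loc_integrable g -> loc_integrable (fun t => g (t + s)).
Proof.
by move=> /(loc_integrable_diffeo (diffeo_shift s)); apply: eq_loc_integrable => t; rewrite mulr1.
Qed.

Lemma sint_shift g a b s : loc_integrable g ->
  sint (fun t => g (t + s)) a b = sint g (a + s) (b + s).
Proof.
move=> lg; rewrite -(sint_substitution a b (diffeo_shift s) lg).
by apply: eq_sint => t; rewrite mulr1.
Qed.

End Substitution.

(** * Periodic functions *)

Section PeriodicFunctions.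
Variable R : realType.
Notation mu := (@lebesgue_measure R).
Implicit Types (f g v w : R -> R) (a b t : R).

Lemma per_sint f a b : per f -> loc_integrable f ->
  sint f (a + 2 * pi) (b + 2 * pi) = sint f a b.
Proof. by move=> pf lf; rewrite -sint_shift//; exact: eq_sint. Qed.

Lemma per_sint_period f a : per f -> loc_integrable f ->
  sint f a (a + 2 * pi) = sint f 0 (2 * pi).
Proof.
move=> pf lf.
have h : sint f (2 * pi) (a + 2 * pi) = sint f 0 a.
  by rewrite -(per_sint 0 a pf lf) add0r.
rewrite -(sint_chasles a 0 _ lf) -(sint_chasles 0 (2 * pi) _ lf) h.
by rewrite (sint_sym _ 0 a); ring.
Qed.

Lemma ge0_integrable_itv_cat f a b c : measurable_fun [set: R] f ->
  (forall t, 0 <= f t) -> a <= b -> b <= c ->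
  mu.-integrable `[a, b] (EFin \o f) -> mu.-integrable `[b, c] (EFin \o f) ->
  mu.-integrable `[a, c] (EFin \o f).
Proof.
move=> mf f0 ab bc /integrableP[_ h1] /integrableP[_ h2]; apply/integrableP; split.
  exact/measurable_EFinP/measurable_funTS.
have mn D : measurable_fun D (abse \o (EFin \o f)).
  by apply: measurable_funTS; apply: measurableT_comp => //; exact/measurable_EFinP.
rewrite (@itv_bndbnd_setU _ _ _ (BLeft b)) ?bnd_simp//.
rewrite ge0_integral_setU//.
- rewrite integral_itv_bndo_bndc; first exact: lte_add_pinfty.
  exact: mn.
- exact: mn.
- apply/disj_setPS => x [/=]; rewrite !in_itv/= => /andP[_ xb] /andP[bx _].
  by move: (lt_le_trans xb bx); rewrite ltxx.
Qed.

Lemma per_nat f n t : per f -> f (t + (2 * pi) *+ n) = f t.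
Proof. by move=> pf; exact: periodicn. Qed.

(** Integrability over one period spreads to every interval, by covering it with
    translates of the period. *)
Lemma per_ge0_loc_integrable f : per f -> measurable_fun [set: R] f ->
  (forall t, 0 <= f t) -> mu.-integrable `[0, 2 * pi] (EFin \o f) ->
  loc_integrable f.
Proof.
move=> pf mf f0 If; split=> // a b.
have T0 : 0 < 2 * pi :> R by rewrite mulr_gt0 ?pi_gt0.
have shiftI c d (s : R) : (forall t, f (t + s) = f t) ->
    mu.-integrable `[c, d] (EFin \o f) -> mu.-integrable `[c + s, d + s] (EFin \o f).
  move=> fs /integrableP[_ h]; apply/integrableP; split.
    exact/measurable_EFinP/measurable_funTS.
  have := @ge0_substitution_itv R _ _ _ (fun t => `|f t|) c d (diffeo_shift s).
  rewrite /= => -> //; first by under eq_integral do rewrite fs mulr1.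
  exact: measurableT_comp.
have I n : mu.-integrable `[- ((2 * pi) *+ n), (2 * pi) *+ n] (EFin \o f).
  elim: n => [|n IH]; first by rewrite mulr0n oppr0; apply: integrableS If => //; apply: subset_itvl; rewrite bnd_simp ltW.
  have Tn : 0 <= (2 * pi) *+ n :> R by rewrite mulrn_wge0// ltW.
  have E : (2 * pi) *+ n.+1 = 2 * pi + (2 * pi) *+ n :> R by rewrite mulrS.
  apply: (@ge0_integrable_itv_cat _ _ ((2 * pi) *+ n)) => //; [lra|lra| |].
    apply: (@ge0_integrable_itv_cat _ _ (- ((2 * pi) *+ n))) => //; [lra|lra|].
    have := shiftI _ _ (- ((2 * pi) *+ n.+1)) _ If.
    rewrite add0r (_ : 2 * pi - _ = - ((2 * pi) *+ n)); last by rewrite E; ring.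
    by apply=> t; rewrite -{2}(subrK ((2 * pi) *+ n.+1) t) per_nat.
  have := shiftI _ _ ((2 * pi) *+ n) _ If.
  by rewrite add0r -E; apply=> t; rewrite per_nat.
pose n := (Num.bound ((`|a| + `|b|) / (2 * pi))).
have nab : `|a| + `|b| <= (2 * pi) *+ n.
  rewrite -mulr_natr -ler_pdivrMl// mulrC ltW//.
  by apply: archi_boundP; rewrite divr_ge0 ?addr_ge0// ltW.
apply: integrableS (I n) => //.
move: nab (ler_norm (- a)) (ler_norm b) (normr_ge0 a) (normr_ge0 b); rewrite normrN => *.
by move=> u; rewrite /= !in_itv/= => /andP[? ?]; apply/andP; split; lra.
Qed.

Lemma L2perP f : L2per f <-> per f /\ loc_sq_integrable f.
Proof.
split=> [[pf mf If]|[pf [mf [_ If]]]]; last by split.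
split=> //; split=> //; apply: per_ge0_loc_integrable => //.
- by move=> t; rewrite pf.
- exact: measurable_funX.
- by move=> t; exact: sqr_ge0.
Qed.

End PeriodicFunctions.

(** * Functions with vanishing integrals *)

Section NullFunctions.
Variable R : realType.
Notation mu := (@lebesgue_measure R).
Implicit Types (d f g : R -> R) (a b u x y : R).

Lemma ae_derive_sint d c a b : loc_integrable d ->
  {ae mu, forall x, `[a, b]%classic x -> is_derive x 1 (sint d c) (d x)}.
Proof.
move=> ld.
pose m := a - 1; pose n := b + 1.
pose D := d \_ `[m, n].
have lD := integrable_locally (measurable_itv _) (ld.2 m n).
have iD y : mu.-integrable [set` Interval (BLeft m) (BRight y)] (EFin \o D).
  rewrite /D -restrict_EFin; apply/integrable_restrict => //=.
  by apply: integrableS (ld.2 m n) => //; exact: measurableI.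
have := FTC1 iD lD; apply: filterS; first exact: (ae_filter_ringOfSetsType mu).
move=> x /= h; rewrite in_itv/= => /andP[ax xb].
have mx : m < x by rewrite /m; lra.
have xn : x < n by rewrite /n; lra.
have Dx : D x = d x by rewrite /D patchE mem_set//= in_itv/= (ltW mx) (ltW xn).
have [h1 h2] := h mx; rewrite Dx derive1E in h2.
have dF := DeriveDef h1 h2.
have -> : sint d c = sint d m + cst (- sint d m c).
  by apply/funext => y; rewrite fctE /= -(@sint_diff _ d m c y).
rewrite -[X in is_derive _ _ _ X]addr0; apply: is_deriveD.
apply: near_eq_is_derive dF; near=> y.
have my : m <= y by apply/ltW; near: y; exact: (open_gt mx).
have yn : y <= n by apply/ltW; near: y; exact: (open_lt xn).
rewrite sint_le_Rintegral//; apply: eq_Rintegral => t.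
rewrite inE/= in_itv/= => /andP[mt ty].
by rewrite /D patchE mem_set//= in_itv/= mt (le_trans ty yn).
Unshelve. all: by end_near. Qed.

Lemma zero_sint_ae d a b : loc_integrable d -> (forall x y, sint d x y = 0) ->
  {ae mu, forall x, `[a, b]%classic x -> d x = 0}.
Proof.
move=> ld d0; apply: filterS (ae_derive_sint 0 a b ld).
  exact: (ae_filter_ringOfSetsType mu).
move=> x /= h /h []; rewrite (_ : sint d 0 = cst 0); last by apply/funext => y; rewrite d0.
by move=> _ <-; rewrite derive_cst.
Qed.

(** By Lebesgue's differentiation theorem d vanishes almost everywhere. *)
Lemma zero_sintM d f a b : loc_integrable d -> (forall x y, sint d x y = 0) ->
  measurable_fun [set: R] f -> sint (fun u => d u * f u) a b = 0.
Proof.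
move=> ld d0 mf.
have h u v : \int[mu]_(t in `[u, v]) (d t * f t) = 0.
  rewrite /Rintegral (@ae_eq_integral _ _ _ mu _ (cst 0%E) (EFin \o (fun t => d t * f t)))//.
  - by rewrite integral0.
  - apply/measurable_EFinP/measurable_funTS/measurable_funM => //; exact: ld.1.
  - apply: filterS (zero_sint_ae u v ld d0); first exact: (ae_filter_ringOfSetsType mu).
    by move=> t h /h /= ->; rewrite mul0r.
by rewrite sint.unlock !h subrr.
Qed.

End NullFunctions.

(** * Smooth periodic functions as test functions *)

Section SmoothFunctions.
Variable R : realType.
Implicit Types (f g : R -> R) (a b u x y : R).

(** The recursion differentiates first, so that the Leibniz rule is proved by
    induction with the two factors of the product varying. *)
Fixpoint diffn n f : Prop :=
  (forall u, derivable f u 1) /\ if n is n'.+1 then diffn n' (derive1 f) else True.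

Lemma diffnP f : (forall n u, derivable (derive1n n f) u 1) <-> forall n, diffn n f.
Proof.
split=> [h n|h n].
  elim: n f h => [|n IH] f h /=; first by split=> // u; exact: (h 0%N).
  split; first exact: (h 0%N).
  by apply: IH => m u; have := h m.+1 u; rewrite derive1Sn.
elim: n f h => [|n IH] f h u; first by have [] := h 0%N.
by rewrite derive1Sn; apply: IH => m; have [_] := h m.+1.
Qed.

Lemma diffnW n f : diffn n.+1 f -> diffn n f.
Proof. by elim: n f => [|n IH] f /= [h1 h2]; split=> //; exact: IH. Qed.

Lemma derive1D f g : (forall u, derivable f u 1) -> (forall u, derivable g u 1) ->
  derive1 (fun u => f u + g u) = (fun u => derive1 f u + derive1 g u).
Proof. by move=> df dg; apply/funext => u; rewrite !derive1E deriveD. Qed.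

Lemma derive1M f g : (forall u, derivable f u 1) -> (forall u, derivable g u 1) ->
  derive1 (fun u => f u * g u) = (fun u => derive1 f u * g u + f u * derive1 g u).
Proof.
move=> df dg; apply/funext => u; rewrite !derive1E deriveM//.
by rewrite /GRing.scale/=; ring.
Qed.

Lemma diffnD n f g : diffn n f -> diffn n g -> diffn n (fun u => f u + g u).
Proof.
elim: n f g => [|n IH] f g /= [df hf] [dg hg].
  by split; [move=> u; exact: derivableD|exact: I].
split; first by move=> u; exact: derivableD.
by rewrite (derive1D df dg); exact: IH.
Qed.

Lemma diffnM n f g : diffn n f -> diffn n g -> diffn n (fun u => f u * g u).
Proof.
elim: n f g => [|n IH] f g hf hg; have [df df'] := hf; have [dg dg'] := hg.
  by split; [move=> u; exact: derivableM|exact: I].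
split; first by move=> u; exact: derivableM.
rewrite derive1M//; apply: diffnD; apply: IH => //; exact: diffnW.
Qed.

Lemma diffn_cst n a : diffn n (fun _ : R => a).
Proof.
elim: n a => [|n IH] a /=; split=> //.
rewrite (_ : derive1 _ = fun=> 0); first exact: IH.
by apply/funext => u; exact: derive1_cst.
Qed.

Lemma diffnX m n f : diffn n f -> diffn n (fun u => f u ^+ m).
Proof.
move=> hf; elim: m => [|m IH]; first exact: diffn_cst.
rewrite (_ : (fun _ => _) = fun u => f u * f u ^+ m); first exact: diffnM.
by apply/funext => u; rewrite exprS.
Qed.

Lemma diffn_trig n a b : diffn n (fun u => a * cos u + b * sin u).
Proof.
have dt c d u : is_derive u 1 (fun u => c * cos u + d * sin u) (d * cos u + (- c) * sin u).
  by apply: is_derive_eq; rewrite /GRing.scale/=; ring.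
elim: n a b => [|n IH] a b /=; split=> //; try by move=> u; case: (dt a b u).
rewrite (_ : derive1 _ = fun u => b * cos u + (- a) * sin u); first exact: IH.
by apply/funext => u; rewrite derive1E; case: (dt a b u).
Qed.

Lemma smooth_perP f : smooth_per f <-> per f /\ forall n, diffn n f.
Proof. by rewrite /smooth_per diffnP. Qed.

Lemma smooth_per_derivable f u : smooth_per f -> is_derive u 1 f (derive1 f u).
Proof. by move=> [_ /(_ 0%N u) /= df]; rewrite derive1E; apply: DeriveDef. Qed.

Lemma smooth_per_continuous f : smooth_per f -> continuous f.
Proof.
move=> sf; apply: (is_derive_continuous (f := derive1 f)) => u.
exact: smooth_per_derivable.
Qed.

Lemma per_derive1 f : per f -> per (derive1 f).
Proof.
move=> pf u; rewrite /derive1.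
rewrite (_ : (fun h => _) = fun h : R => h^-1 *: (f (h + u) - f u))//.
by apply/funext => h; rewrite addrA !pf.
Qed.

Lemma smooth_per_derive1 f : smooth_per f -> smooth_per (derive1 f).
Proof.
move=> /smooth_perP[pf df]; apply/smooth_perP; split; first exact: per_derive1.
by move=> n; have [] := df n.+1.
Qed.

Lemma smooth_per_cst a : smooth_per (fun _ : R => a).
Proof. by apply/smooth_perP; split=> // n; exact: diffn_cst. Qed.

Lemma smooth_perD f g : smooth_per f -> smooth_per g ->
  smooth_per (fun u => f u + g u).
Proof.
move=> /smooth_perP[pf df] /smooth_perP[pg dg]; apply/smooth_perP; split.
  by move=> u; rewrite pf pg.
by move=> n; exact: diffnD.
Qed.

Lemma smooth_perM f g : smooth_per f -> smooth_per g ->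
  smooth_per (fun u => f u * g u).
Proof.
move=> /smooth_perP[pf df] /smooth_perP[pg dg]; apply/smooth_perP; split.
  by move=> u; rewrite pf pg.
by move=> n; exact: diffnM.
Qed.

Lemma smooth_per_H1loc f : smooth_per f -> H1loc f (derive1 f).
Proof.
move=> sf; apply: C1_H1loc; first exact/smooth_per_continuous/smooth_per_derive1.
by move=> u; exact: smooth_per_derivable.
Qed.

Lemma smooth_per_primitive f : smooth_per f -> sint f 0 (2 * pi) = 0 ->
  smooth_per (sint f 0) /\ derive1 (sint f 0) = f.
Proof.
move=> sf f0; have cf := smooth_per_continuous sf.
have lf := continuous_loc_integrable cf.
have df u : is_derive u 1 (sint f 0) (f u) by exact: derive_sint.
have dE : derive1 (sint f 0) = f by apply/funext => u; rewrite derive1E; case: (df u).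
split; last exact: dE.
apply/smooth_perP; split.
  move=> u; rewrite -(sint_chasles _ u _ lf) per_sint_period ?f0 ?addr0//.
  exact: sf.1.
have /smooth_perP[_ sf'] := sf.
by case=> [|n] /=; rewrite ?dE; split=> // u; case: (df u).
Qed.

Lemma per_sint_mul_derive1 f g p : per f -> H1loc f g -> smooth_per p ->
  sint (fun u => f u * derive1 p u) 0 (2 * pi) =
  - sint (fun u => g u * p u) 0 (2 * pi).
Proof.
move=> pf hf sp; rewrite (H1loc_parts _ _ hf (smooth_per_H1loc sp)).
have f2 : f (2 * pi) = f 0 by rewrite -(pf 0) add0r.
have p2 : p (2 * pi) = p 0 by rewrite -(sp.1 0) add0r.
by rewrite f2 p2; ring.
Qed.

(** If f x > 0, test against powers of 1 + cos (u - x) - cos d: this trigonometric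
    polynomial exceeds 1 for |u - x| < d only, so that its powers concentrate where
    f is positive, while they stay bounded elsewhere. *)
Lemma per_orthogonal_smooth f : per f -> continuous f ->
  (forall p, smooth_per p -> sint (fun u => f u * p u) 0 (2 * pi) = 0) ->
  forall x, f x = 0.
Proof.
suff pos g x : per g -> continuous g ->
    (forall p, smooth_per p -> sint (fun u => g u * p u) 0 (2 * pi) = 0) ->
    ~ 0 < g x.
  move=> pf cf f0 x; apply/eqP/negPn/negP; rewrite neq_lt => /orP[fx|]; last exact: pos.
  apply: (pos (fun u => - f u) x); rewrite ?oppr_gt0//.
  - by move=> u; rewrite pf.
  - by move=> u; apply: cvgN; exact: cf.
  - move=> p sp; rewrite (eq_sint (g := fun u => - (f u * p u))) => [|u]; last by rewrite mulNr.
    rewrite sintN ?f0 ?oppr0//; apply: continuous_loc_integrable => u.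
    by apply: continuousM; [exact: cf|exact: smooth_per_continuous].
move=> pg cg g0 gx.
have pi0 := pi_gt0 R.
have [M M0 hM] := continuous_bounded_itv (x - pi) (x + pi) cg.
have [d0 d00 hd0] : exists2 d : R, 0 < d & forall y, `|y - x| < d -> g x / 2 < g y.
  have /continuousP_ed /(_ x (g x / 2)) := cg.
  rewrite divr_gt0// => /(_ isT) [d d0 hd]; exists d => // y /hd.
  by rewrite ltr_norml => /andP[+ _]; lra.
pose d := Num.min (d0 / 2) (pi / 2).
have dd0 : 0 < d < d0.
  by rewrite /d lt_min gt_min !divr_gt0//=; apply/orP; left; lra.
have dpi : d < pi by rewrite /d gt_min; apply/orP; right; lra.
have cos_anti y z : 0 <= y -> y <= z -> z <= pi -> cos z <= cos y.
  move=> y0 yz zpi; rewrite leNgt; apply/negP; rewrite ltr_cos ?ltNge ?yz//;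
  by rewrite in_itv/=; apply/andP; split; lra.
have cosd2 y : `|y| <= d / 2 -> cos (d / 2) <= cos y.
  by move=> yd; rewrite -(cos_norm y); apply: cos_anti; rewrite ?normr_ge0//; lra.
have cosd y : `|y| <= d -> cos d <= cos y.
  by move=> yd; rewrite -(cos_norm y); apply: cos_anti; rewrite ?normr_ge0//; lra.
have cosD y : d <= `|y| <= pi -> cos y <= cos d.
  move=> /andP[yd ypi]; rewrite -(cos_norm y); apply: cos_anti => //; lra.
pose q := 1 + cos (d / 2) - cos d.
have q1 : 1 < q.
  rewrite /q ltrBrDr ltrD2l ltr_cos ?in_itv/=; lra.
pose T u := 1 + cos (u - x) - cos d.
have sT n : smooth_per (fun u => T u ^+ n).
  apply/smooth_perP; split.
    move=> u; rewrite /T (_ : u + 2 * pi - x = (u - x) + pi *+ 2); last by ring.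
    by rewrite cosD2pi.
  move=> m; apply: diffnX.
  rewrite (_ : T = fun u => (1 - cos d) + (cos x * cos u + sin x * sin u)).
    by apply: diffnD; [exact: diffn_cst|exact: diffn_trig].
  by apply/funext => u; rewrite /T cosB; ring.
have cgT n : continuous (fun u => g u * T u ^+ n).
  by move=> u; apply: (@continuousM _ _ g (fun u => T u ^+ n)); [exact: cg|exact: smooth_per_continuous (sT n) u].
have lgT n := continuous_loc_integrable (cgT n).
have outer n a b : x - pi <= a -> b <= x + pi -> a <= b ->
    (forall u, a <= u <= b -> d / 2 <= `|u - x|) ->
    - M * (b - a) <= sint (fun u => g u * T u ^+ n) a b.
  move=> xa bx ab ud; rewrite -sint_cst; apply: sint_le => //.
    exact: loc_integrable_cst.
  move=> u uab; have ux : `|u - x| <= pi.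
    by rewrite ler_norml; apply/andP; split; lra.
  have [udx|dux] := leP (`|u - x|) d.
    apply: (@le_trans _ _ 0); first by rewrite oppr_le0 ltW.
    rewrite mulr_ge0//; last by rewrite exprn_ge0// /T; have := cosd _ udx; lra.
    have := hd0 u; move=> /(_ _)/ltW h; apply: le_trans (h _); first by rewrite divr_ge0// ltW.
    by apply: le_lt_trans udx _; case/andP: dd0.
  have gM : `|g u| <= M by apply: hM; lra.
  have T1 : `|T u ^+ n| <= 1.
    rewrite normrX exprn_ile1// ler_norml /T.
    have := cosD (u - x); rewrite (ltW dux) ux => /(_ isT).
    have := cos_geN1 (u - x); have := cos_le1 d; lra.
  have : `|g u * T u ^+ n| <= M.
    by rewrite normrM; apply: (le_trans (ler_pM _ _ gM T1)); rewrite ?mulr1.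
  by rewrite ler_norml => /andP[].
have inner n : (g x / 2) * q ^+ n * d <=
    sint (fun u => g u * T u ^+ n) (x - d / 2) (x + d / 2).
  have -> : g x / 2 * q ^+ n * d = g x / 2 * q ^+ n * (x + d / 2 - (x - d / 2)).
    by field.
  rewrite -sint_cst; apply: sint_le => //; [exact: loc_integrable_cst|lra|].
  move=> u ud; have ux : `|u - x| <= d / 2.
    by rewrite ler_norml; apply/andP; split; lra.
  have gu : g x / 2 < g u by apply: hd0; lra.
  have qT : q <= T u by rewrite /q /T; have := cosd2 _ ux; lra.
  apply: ler_pM; rewrite ?exprn_ge0//; [lra|lra|lra|].
  by rewrite lerXn2r// nnegrE; lra.
have bern n : 1 + n%:R * (q - 1) <= q ^+ n.
  elim: n => [|n IH]; first by rewrite mul0r addr0.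
  rewrite exprS -natr1; apply: (@le_trans _ _ (q * (1 + n%:R * (q - 1)))).
    by have := mulr_ge0 (ler0n R n) (sqr_ge0 (q - 1)); lra.
  by rewrite ler_wpM2l//; lra.
have key n : g x / 2 * q ^+ n * d <= 2 * M * pi.
  have z : sint (fun u => g u * T u ^+ n) (x - pi) (x - pi + 2 * pi) = 0.
    rewrite per_sint_period ?g0// => u.
    by rewrite pg (sT n).1.
  have h1 := inner n; have h2 := outer n (x + d / 2) (x + pi).
  have h3 := outer n (x - pi) (x - d / 2).
  move: z; rewrite (_ : x - pi + 2 * pi = x + pi); last by ring.
  rewrite -(sint_chasles (x - pi) (x - d / 2) _ (lgT n)).
  rewrite -(sint_chasles (x - d / 2) (x + d / 2) _ (lgT n)) => z.
  have {}h2 : - M * (x + pi - (x + d / 2)) <= sint (fun u => g u * T u ^+ n) (x + d / 2) (x + pi).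
    apply: h2; [lra|lra|lra|] => u /andP[u1 u2].
    by rewrite ger0_norm; lra.
  have {}h3 : - M * (x - d / 2 - (x - pi)) <= sint (fun u => g u * T u ^+ n) (x - pi) (x - d / 2).
    apply: h3; [lra|lra|lra|] => u /andP[u1 u2].
    by rewrite ler0_norm; lra.
  nra.
pose c := g x / 2 * d * (q - 1).
have c0 : 0 < c by rewrite /c !mulr_gt0//; lra.
have [n nM] : exists n : nat, 2 * M * pi / c < n%:R.
  exists (Num.bound (2 * M * pi / c)); apply: archi_boundP.
  by rewrite !mulr_ge0 ?invr_ge0// ltW.
move: nM; rewrite ltr_pdivrMr// => nM.
have := key n; rewrite leNgt => /negP; apply; apply: (lt_le_trans nM).
have gd : 0 < g x / 2 * d by rewrite mulr_gt0; lra.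
have := bern n; rewrite /c; nra.
Qed.

End SmoothFunctions.

(** * Weak derivatives and the periodic Sobolev space *)

Section WeakDerivatives.
Variable R : realType.
Implicit Types (d f g k p v w : R -> R) (a b u x y : R).

Lemma ip_sint f g : ip f g = sint (fun u => f u * g u) 0 (2 * pi).
Proof. exact: intT_sint. Qed.

Lemma twopi_gt0 : 0 < 2 * pi :> R.
Proof. by rewrite mulr_gt0// pi_gt0. Qed.

(** Every smooth periodic function with zero mean is the derivative of a smooth
    periodic function. *)
Lemma per_orthogonal_derivatives_cst f : per f -> continuous f ->
  (forall p, smooth_per p -> ip f (derive1 p) = 0) -> forall u, f u = f 0.
Proof.
move=> pf cf f0.
have lf := continuous_loc_integrable cf.
pose m := sint f 0 (2 * pi) / (2 * pi).
have T0 := twopi_gt0.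
suff fm u : f u - m = 0 by move=> u; have := fm u; have := fm 0; lra.
apply: (@per_orthogonal_smooth R (fun u => f u - m)).
- by move=> t; rewrite pf.
- by move=> t; apply: cvgB; [exact: cf|exact: cvg_cst].
move=> p sp; have cp := smooth_per_continuous sp; have lp := continuous_loc_integrable cp.
pose mp := sint p 0 (2 * pi) / (2 * pi).
have cfp : continuous (fun u => f u * p u).
  by move=> t; apply: continuousM; [exact: cf|exact: cp].
have sp' : smooth_per (fun u => p u + (- mp)).
  by apply: smooth_perD; [exact: sp|exact: smooth_per_cst].
have [|sP P'] := smooth_per_primitive sp'.
  rewrite sintD ?sint_cst//; last exact: loc_integrable_cst.
  by rewrite /mp subr0 mulNr divfK ?subrr ?gt_eqF.
have := f0 _ sP; rewrite P' ip_sint.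
rewrite (eq_sint (g := fun u => f u * p u + (- mp) * f u)); last by move=> t; ring.
rewrite sintD ?sintZ//; [|exact: continuous_loc_integrable|exact: loc_integrableZ].
move=> h.
rewrite (eq_sint (g := fun u => f u * p u + (- m) * p u)); last by move=> t; ring.
rewrite sintD ?sintZ//; [|exact: continuous_loc_integrable|exact: loc_integrableZ].
by rewrite -[RHS]h /m /mp; ring.
Qed.

Lemma per_primitive g : per g -> loc_integrable g -> sint g 0 (2 * pi) = 0 ->
  per (sint g 0).
Proof.
move=> pg lg g0 u.
by rewrite -(sint_chasles 0 u _ lg) per_sint_period// g0 addr0.
Qed.

Lemma H1loc_primitive g : loc_sq_integrable g -> H1loc (sint g 0) g.
Proof.
by move=> lg; split=> // a b; rewrite sint_diff//; exact: loc_sq_loc_integrable.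
Qed.

(** The primitive of g is continuous and orthogonal to all derivatives of test
    functions, hence constant. *)
Lemma orthogonal_smooth_null g : per g -> loc_sq_integrable g ->
  (forall p, smooth_per p -> ip g p = 0) -> forall a b, sint g a b = 0.
Proof.
move=> pg lg g0; have lg' := loc_sq_loc_integrable lg.
have g00 : sint g 0 (2 * pi) = 0.
  have := g0 _ (smooth_per_cst 1); rewrite ip_sint => h; rewrite -[RHS]h.
  by apply: eq_sint => u; rewrite mulr1.
have hG := H1loc_primitive lg.
have pG := per_primitive pg lg' g00.
have Gc : forall u, sint g 0 u = sint g 0 0.
  apply: per_orthogonal_derivatives_cst => //; first exact: H1loc_continuous hG.
  move=> p sp; rewrite ip_sint (per_sint_mul_derive1 pG hG sp).
  by rewrite -ip_sint g0 ?oppr0.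
by move=> a b; rewrite -(sint_diff 0 a b lg') !Gc subrr.
Qed.

(** Du Bois-Reymond: v minus the primitive of its weak derivative is orthogonal to
    all derivatives of test functions, hence constant. *)
Lemma is_weak_derivativeP v g : per v -> continuous v ->
  is_weak_derivative v g <-> per g /\ H1loc v g.
Proof.
move=> pv cv; split; last first.
  move=> [pg hv]; split; first by apply/L2perP; split=> //; exact: hv.1.
  move=> p sp; rewrite /diff_distr /regular_distr !ip_sint.
  by rewrite (per_sint_mul_derive1 pv hv sp) opprK.
move=> [/L2perP[pg lg] vg]; split=> //; split=> //.
have lg' := loc_sq_loc_integrable lg.
have g0 : sint g 0 (2 * pi) = 0.
  have := vg _ (smooth_per_cst 1); rewrite /diff_distr /regular_distr.
  rewrite !ip_sint (eq_sint (g := fun=> 0)); last by move=> u; rewrite derive1_cst mulr0.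
  rewrite sint_cst mul0r oppr0 => h; rewrite [RHS]h.
  by apply: eq_sint => u; rewrite mulr1.
have hG := H1loc_primitive lg.
have pG := per_primitive pg lg' g0.
have cG := H1loc_continuous hG.
have vG : forall u, v u - sint g 0 u = v 0 - sint g 0 0.
  apply: (per_orthogonal_derivatives_cst (f := fun u => v u - sint g 0 u)).
  - by move=> u; rewrite pv pG.
  - by move=> u; apply: cvgB; [exact: cv|exact: cG].
  move=> p sp; have cp' := smooth_per_continuous (smooth_per_derive1 sp).
  have := vg _ sp; rewrite /diff_distr /regular_distr !ip_sint.
  have := per_sint_mul_derive1 pG hG sp.
  rewrite (eq_sint (f := fun u => (v u - _) * _)
    (g := fun u => v u * derive1 p u - sint g 0 u * derive1 p u)); last first.
    by move=> u; ring.
  rewrite sintB; last 2 first.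
  - by apply: continuous_loc_integrable => u; apply: continuousM; [exact: cv|exact: cp'].
  - by apply: continuous_loc_integrable => u; apply: continuousM; [exact: cG|exact: cp'].
  lra.
by move=> a b; have := vG a; have := vG b; rewrite -(sint_diff 0 a b lg'); lra.
Qed.

Lemma H1perP v : H1per v <-> per v /\ exists g, per g /\ H1loc v g.
Proof.
split=> [[pv cv [g /(is_weak_derivativeP _ pv cv) hg]]|[pv [g [pg hg]]]].
  by split=> //; exists g.
have cv := H1loc_continuous hg.
by split=> //; exists g; apply/is_weak_derivativeP.
Qed.

Lemma H1loc_unique v g k a b : H1loc v g -> H1loc v k ->
  sint (fun u => g u ^+ 2) a b = sint (fun u => k u ^+ 2) a b.
Proof.
move=> [lg vg] [lk vk].
have lgk := loc_sqB lg lk; have lgk' := loc_sq_loc_integrable lgk.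
have z x y : sint (fun u => g u - k u) x y = 0.
  by rewrite sintB; [rewrite -vg -vk subrr|exact: loc_sq_loc_integrable..].
have ms : measurable_fun [set: R] (fun u => g u + k u).
  by apply: measurable_funD; [exact: lg.1|exact: lk.1].
apply/eqP; rewrite -subr_eq0 -sintB; [|exact: lg.2|exact: lk.2].
rewrite -(zero_sintM a b lgk' z ms); apply/eqP.
by apply: eq_sint => u; ring.
Qed.

(** The weak derivative chosen in the norm may be replaced by any derivative at
    hand, since two of them agree almost everywhere. *)
Lemma H1normE v g : per v -> per g -> H1loc v g ->
  H1norm v = Num.sqrt (ip v v + ip g g).
Proof.
move=> pv pg hv; have cv := H1loc_continuous hv.
rewrite /H1norm; congr (Num.sqrt (_ + _)).
have : is_weak_derivative v (weak_derivative v).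
  rewrite /weak_derivative; case: xgetP => [k _ //|/(_ g)]; case.
  by apply/is_weak_derivativeP.
move=> /(is_weak_derivativeP _ pv cv)[_ hw].
rewrite !ip_sint.
rewrite (eq_sint (g := fun u => (weak_derivative v u) ^+ 2)) => [|u]; last by rewrite expr2.
rewrite [RHS](eq_sint (g := fun u => g u ^+ 2)) => [|u]; last by rewrite expr2.
exact: H1loc_unique hw hv.
Qed.

Lemma ip_ge0 f : 0 <= ip f f.
Proof.
by rewrite ip_sint; apply: sint_ge0 => [|u _]; [exact: ltW twopi_gt0|rewrite -expr2 sqr_ge0].
Qed.

Lemma H1norm_ge0 v : 0 <= H1norm v.
Proof. exact: sqrtr_ge0. Qed.

Lemma H1norm_sqr v g : per v -> per g -> H1loc v g ->
  H1norm v ^+ 2 = ip v v + ip g g.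
Proof.
by move=> pv pg hv; rewrite (H1normE pv pg hv) sqr_sqrtr// addr_ge0// ip_ge0.
Qed.

End WeakDerivatives.

(** * Difference quotients and translations in L^2 *)

Section PeriodicEstimates.
Variable R : realType.
Implicit Types (d f g k p v w F : R -> R) (a b u x y s : R).

Lemma per_int f (z : int) u : per f -> f (u + z%:~R * (2 * pi)) = f u.
Proof.
move=> pf; case: z => n; first by rewrite -[RHS](per_nat n u pf) -[(2 * pi) *+ n]mulr_natl.
rewrite NegzE mulrNz mulNr -[LHS](per_nat n.+1 _ pf) -[(2 * pi) *+ n.+1]mulr_natl.
by rewrite subrK.
Qed.

Lemma per_reduce u : exists2 v, 0 <= v <= 2 * pi & forall f, per f -> f u = f v.
Proof.
have T0 := twopi_gt0 R.
pose z := Num.floor (u / (2 * pi)).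
exists (u + (- z)%:~R * (2 * pi)); last by move=> f pf; rewrite per_int.
have /andP[] := floor_itv (u / (2 * pi)).
rewrite -/z intrD mulr1z ler_pdivlMr// ltr_pdivrMr// mulrNz => h1 h2.
by apply/andP; split; lra.
Qed.

Lemma per_continuous_bounded f : per f -> continuous f ->
  exists2 M : R, 0 < M & forall u, `|f u| <= M.
Proof.
move=> pf cf; have [M M0 hM] := continuous_bounded_itv 0 (2 * pi) cf.
by exists M => // u; have [v vI ->//] := per_reduce u; exact: hM.
Qed.

(** Morrey's embedding of H^1 into the functions of Hoelder exponent 1/2. *)
Lemma per_holder v g a b : per g -> H1loc v g -> `|b - a| <= 2 * pi ->
  (v b - v a) ^+ 2 <= `|b - a| * sint (fun u => g u ^+ 2) 0 (2 * pi).
Proof.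
move=> pg hv.
have pg2 : per (fun u => g u ^+ 2) by move=> u; rewrite pg.
have lg2 := hv.1.2.
wlog ab : a b / a <= b => [th|].
  have [/th//|/ltW /th] := leP a b.
  by rewrite -(sqrrN (v b - v a)) opprB (distrC b a).
rewrite ger0_norm ?subr_ge0// => ba.
apply: le_trans (H1loc_sq_incr hv ab) _; apply: ler_wpM2l; first by rewrite subr_ge0.
rewrite -(per_sint_period a pg2 lg2) -(sint_chasles a b (a + 2 * pi) lg2).
suff : 0 <= sint (fun u => g u ^+ 2) b (a + 2 * pi) by lra.
by apply: sint_ge0 => [|u _]; [lra|exact: sqr_ge0].
Qed.

Definition diffquot F s u : R := s^-1 * (F (u + s) - F u).

(** The Cauchy-Schwarz inequality bounds |F (u + s) - F u|^2 by |s| times the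
    integral of f^2 between u and u + s, and the average of this over u is computed
    with the primitive G of f^2. *)
Lemma per_diffquot_le F f s : per f -> H1loc F f -> s != 0 -> `|s| <= 2 * pi ->
  sint (fun u => diffquot F s u ^+ 2) 0 (2 * pi) <=
  sint (fun u => f u ^+ 2) 0 (2 * pi).
Proof.
move=> pf hF s0 sT.
have cF := H1loc_continuous hF; have lf2 := hF.1.2.
have pf2 : per (fun u => f u ^+ 2) by move=> u; rewrite pf.
set A := sint (fun u => f u ^+ 2) 0 (2 * pi).
pose G := sint (fun u => f u ^+ 2) 0.
have cG : continuous G by exact: sint_continuous.
have lG := continuous_loc_integrable cG.
have s2 : 0 < s ^+ 2 by rewrite exprn_even_gt0.
have cdq : continuous (fun u => F (u + s) - F u).
  move=> u; apply: cvgB; last exact: cF.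
  apply: (@continuous_comp _ _ _ (fun u => u + s) F); last exact: cF.
  by apply: cvgD; [exact: cvg_id|exact: cvg_cst].
have ldq := continuous_loc_sq cdq.
rewrite (eq_sint (g := fun u => s ^- 2 * (F (u + s) - F u) ^+ 2)); last first.
  by move=> u; rewrite /diffquot exprMn exprVn.
rewrite sintZ; last exact: ldq.2.
rewrite ler_pdivrMl//.
have lGs := loc_integrable_shift s lG.
have key : sint (fun u => s * (G (u + s) - G u)) 0 (2 * pi) = s ^+ 2 * A.
  rewrite sintZ; last exact: loc_integrableB.
  rewrite sintB// sint_shift// add0r.
  have -> : sint G s (2 * pi + s) - sint G 0 (2 * pi) =
      sint G (2 * pi) (2 * pi + s) - sint G 0 s.
    rewrite -(sint_chasles s (2 * pi) _ lG) -(sint_chasles 0 s (2 * pi) lG); ring.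
  have -> : sint G (2 * pi) (2 * pi + s) = sint (fun u => G u + A) 0 s.
    rewrite -{1}(add0r (2 * pi)) (addrC _ s) -(sint_shift _ _ _ lG); apply: eq_sint => u.
    by rewrite /G -(sint_chasles 0 u _ lf2) per_sint_period.
  rewrite sintD//; last exact: loc_integrable_cst.
  by rewrite sint_cst; ring.
rewrite -key; apply: sint_le; [exact: ldq.2|exact/loc_integrableZ/loc_integrableB|exact: ltW (twopi_gt0 R)|].
move=> u _; rewrite /G sint_diff//.
have [s_ge0|s_lt0] := leP 0 s.
  have := H1loc_sq_incr hF (_ : u <= u + s); rewrite lerDl => /(_ s_ge0).
  by rewrite (addrC u s) addrK.
have := H1loc_sq_incr hF (_ : u + s <= u); rewrite gerDl (ltW s_lt0) => /(_ isT).
rewrite -sqrrN opprB sint_sym; have -> : u - (u + s) = - s by ring.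
by rewrite mulrNN.
Qed.

Lemma sint_EFin f a b : a <= b -> loc_integrable f ->
  (\int[lebesgue_measure]_(u in `[a, b]) (f u)%:E)%E = (sint f a b)%:E.
Proof.
move=> ab [_ lf]; rewrite sint_le_Rintegral// /Rintegral fineK//.
by apply: integrable_fin_num => //; exact: lf.
Qed.

Lemma loc_sq_shift f s : loc_sq_integrable f -> loc_sq_integrable (fun u => f (u + s)).
Proof. exact: (loc_sq_diffeo (diffeo_shift s)). Qed.

Lemma loc_sq_diffquot F s : continuous F -> loc_sq_integrable (diffquot F s).
Proof.
move=> cF; have lF := continuous_loc_sq cF.
apply: loc_sqZ; apply: loc_sqB => //; exact: loc_sq_shift.
Qed.

(** Difference quotients converge almost everywhere and their norms do not exceed
    that of f.  Fatou's lemma applied to (q + f)^2, combined with the parallelogram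
    identity (q - f)^2 = 2 q^2 + 2 f^2 - (q + f)^2, turns this into convergence in
    L^2. *)
Lemma per_diffquot_cvg F f : per f -> H1loc F f -> forall e, 0 < e ->
  exists2 d : R, 0 < d & forall s, s != 0 -> `|s| < d ->
    sint (fun u => (diffquot F s u - f u) ^+ 2) 0 (2 * pi) < e.
Proof.
move=> pf hF e e0; have T0 := twopi_gt0 R.
have cF := H1loc_continuous hF; have lf := hF.1.
have lq s := loc_sq_diffquot s cF.
pose J s := sint (fun u => (diffquot F s u - f u) ^+ 2) 0 (2 * pi).
have [//|no] := pselect (exists2 d : R, 0 < d & forall s, s != 0 -> `|s| < d -> J s < e).
exfalso.
have /choice[sq hsq] (n : nat) : exists s, [/\ s != 0, `|s| < n.+1%:R^-1, `|s| <= 2 * pi & e <= J s].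
  apply: contrapT => hn; apply: no; exists (Num.min n.+1%:R^-1 (2 * pi)).
    by rewrite lt_min T0 invr_gt0 ltr0Sn.
  move=> s s0; rewrite lt_min => /andP[s1 s2]; rewrite ltNge; apply/negP => es.
  by apply: hn; exists s; split=> //; exact: ltW.
pose h n u := (diffquot F (sq n) u + f u) ^+ 2.
have lh n : loc_integrable (h n) := (loc_sqD (lq (sq n)) lf).2.
set A := sint (fun u => f u ^+ 2) 0 (2 * pi).
have hA n : sint (h n) 0 (2 * pi) <= 4 * A - e.
  have [s0 _ sT es] := hsq n.
  have -> : sint (h n) 0 (2 * pi) =
    2 * sint (fun u => diffquot F (sq n) u ^+ 2) 0 (2 * pi) + 2 * A - J (sq n).
    rewrite /A /J -sintZ; last exact: (lq _).2.
    rewrite -sintZ; last exact: lf.2.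
    rewrite -sintD; [|exact/loc_integrableZ/(lq _).2|exact/loc_integrableZ/lf.2].
    rewrite -sintB; [|apply: loc_integrableD|exact: (loc_sqB (lq _) lf).2].
    - by apply: eq_sint => u; rewrite /h; ring.
    - exact/loc_integrableZ/(lq _).2.
    - exact/loc_integrableZ/lf.2.
  have := per_diffquot_le pf hF s0 sT; rewrite -/A; lra.
have mI : measurable (`[0, 2 * pi]%classic : set (measurableTypeR R)) by [].
have mh n : measurable_fun (`[0, 2 * pi]%classic : set (measurableTypeR R)) (EFin \o h n).
  by apply/measurable_EFinP/measurable_funTS; exact: (lh n).1.
have h0 n x : `[0, 2 * pi]%classic x -> (0 <= (EFin \o h n) x)%E.
  by move=> _; rewrite lee_fin sqr_ge0.
have := @fatou _ _ _ lebesgue_measure _ mI _ mh h0.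
apply/negP; rewrite -ltNge.
apply: (@le_lt_trans _ _ (4 * A - e)%:E).
  rewrite limn_einf_lim; apply: lime_le; first exact: is_cvg_einfs.
  apply: nearW => n; apply: (@le_trans _ _ (sint (h n) 0 (2 * pi))%:E).
    apply: ereal_inf_lbound; exists n; rewrite //=.
    by rewrite sint_EFin// ltW.
  by rewrite lee_fin.
apply: (@lt_le_trans _ _ (4 * A)%:E); first by rewrite lte_fin; lra.
rewrite (@ae_eq_integral _ _ _ lebesgue_measure _ (fun u => (4 * f u ^+ 2)%:E))//.
- rewrite sint_EFin ?(ltW T0)//; last exact/loc_integrableZ/lf.2.
  by rewrite sintZ//; exact: lf.2.
- rewrite (_ : (fun x => _) = -%E \o (fun x => limn_esup (fun n => - (EFin \o h n) x)%E)).
    apply: measurableT_comp => //; apply: measurable_fun_limn_esup => n.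
    by apply: measurableT_comp => //; exact: mh.
  by apply/funext => x /=; rewrite (limn_esupN (fun n => (h n x)%:E)) oppeK.
- by apply/measurable_EFinP/measurable_funTS; exact: (loc_integrableZ _ lf.2).1.
apply: filterS (ae_derive_sint 0 0 (2 * pi) (loc_sq_loc_integrable lf)).
  exact: (ae_filter_ringOfSetsType lebesgue_measure).
move=> x /= hx /hx dF {hx}.
have FE : F = fun u => sint f 0 u + F 0.
  by apply/funext => u; rewrite -hF.2; ring.
have cv : (h n x)%:E @[n --> \oo] --> (4 * f x ^+ 2)%:E.
  have c1 : diffquot F (sq n) x + f x @[n --> \oo] --> f x + f x.
    apply: cvgD; last exact: cvg_cst.
  apply/cvgrPdist_lt => e' e'0.
  have [d d0 hd] := is_derive_edP dF (divr_gt0 e'0 (ltr0n R 2)).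
  near=> n; have [s0 sn _ _] := hsq n.
  have nd : n.+1%:R^-1 < d by near: n; exact: near_infty_natSinv_lt (PosNum d0).
  have := hd (x + sq n); rewrite addrAC subrr add0r => /(_ (lt_trans sn nd)) hh.
  have sq0 : 0 < `|sq n| by rewrite normr_gt0.
  rewrite distrC /diffquot FE.
  have -> : (sq n)^-1 * (sint f 0 (x + sq n) + F 0 - (sint f 0 x + F 0)) - f x =
     (sq n)^-1 * (sint f 0 (x + sq n) - sint f 0 x - f x * sq n) by field.
  rewrite normrM normfV ltr_pdivrMl//.
  by apply: le_lt_trans hh _; rewrite mulrC ltr_pM2l//; lra.
  have c2 : h n x @[n --> \oo] --> 4 * f x ^+ 2.
    rewrite (_ : 4 * f x ^+ 2 = (f x + f x) * (f x + f x)); last by ring.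
    rewrite (_ : h^~ x = fun n => (diffquot F (sq n) x + f x) * (diffquot F (sq n) x + f x)).
      exact: cvgM.
    by apply/funext => n; rewrite /h expr2.
  by apply: cvg_EFin; [exact: nearW|exact: c2].
rewrite is_cvg_limn_einfE; last by apply/cvg_ex; exists (4 * f x ^+ 2)%:E.
exact/cvg_lim.
Unshelve. all: by end_near. Qed.

(** A difference quotient of the primitive of f is close to f in L^2 and, being
    uniformly continuous, moves little under a small translation. *)
Lemma per_shift_cvg f : per f -> loc_sq_integrable f -> forall e, 0 < e ->
  exists2 d : R, 0 < d & forall s, `|s| < d ->
    sint (fun u => (f (u + s) - f u) ^+ 2) 0 (2 * pi) < e.
Proof.
move=> pf lf e e0; have T0 := twopi_gt0 R.
have hF := H1loc_primitive lf; have cF := H1loc_continuous hF.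
set F := sint f 0 in hF cF.
have [d d0 hd] := per_diffquot_cvg pf hF (divr_gt0 e0 (ltr0n R 9)).
pose s0 := d / 2; have s00 : s0 != 0 by rewrite gt_eqF// divr_gt0.
have := hd s0 s00; rewrite gtr0_norm ?divr_gt0// => /(_ _) h.
have {}h : sint (fun u => (diffquot F s0 u - f u) ^+ 2) 0 (2 * pi) < e / 9.
  by apply: h; rewrite /s0; lra.
set A := sint (fun u => f u ^+ 2) 0 (2 * pi).
have A0 : 0 <= A by apply: sint_ge0 => [|u _]; [exact: ltW|exact: sqr_ge0].
have lf1 := loc_sq_loc_integrable lf.
have pq : per (diffquot F s0).
  move=> u; rewrite /diffquot addrAC; congr (_ * _).
  by rewrite /F !sint_diff// per_sint.
have lq := loc_sq_diffquot s0 cF.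
(* the difference quotient is uniformly continuous, being Hoelder continuous *)
have qs u s : `|s| <= 2 * pi -> (diffquot F s0 (u + s) - diffquot F s0 u) ^+ 2 <=
    (4 * A / s0 ^+ 2) * `|s|.
  move=> sT; have := per_holder (a := u) (b := u + s) pf hF.
  have := per_holder (a := u + s0) (b := u + s + s0) pf hF.
  rewrite (_ : u + s + s0 - (u + s0) = s); last by ring.
  rewrite (_ : u + s - u = s); last by ring.
  rewrite -/A => /(_ sT) h2 /(_ sT) h1.
  have -> : (diffquot F s0 (u + s) - diffquot F s0 u) ^+ 2 =
      ((F (u + s + s0) - F (u + s0)) - (F (u + s) - F u)) ^+ 2 / s0 ^+ 2.
    by rewrite /diffquot; field.
  rewrite [leRHS]mulrAC ler_pM2r ?invr_gt0 ?exprn_even_gt0//.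
  have := sqr_ge0 ((F (u + s + s0) - F (u + s0)) + (F (u + s) - F u)); lra.
pose K := 12 * A / s0 ^+ 2 * (2 * pi) + 1.
have K0 : 0 < K.
  by rewrite /K ltr_wpDl// mulr_ge0 ?(ltW T0)// divr_ge0 ?sqr_ge0// mulr_ge0.
exists (Num.min (2 * pi) (e / 3 / K)); first by rewrite lt_min T0 !divr_gt0.
move=> s; rewrite lt_min => /andP[sT]; rewrite ltr_pdivlMr// => sK.
have lqf := loc_sqB lq lf.
have lqfs := loc_sq_shift s lqf.
have lqs := loc_sq_shift s lq.
have pqf2 : per (fun u => (diffquot F s0 u - f u) ^+ 2) by move=> u; rewrite pq pf.
have Is : sint (fun u => (diffquot F s0 (u + s) - f (u + s)) ^+ 2) 0 (2 * pi) < e / 9.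
  rewrite (sint_shift 0 (2 * pi) s (g := fun u => (diffquot F s0 u - f u) ^+ 2)) ?lqf.2//.
    by rewrite add0r addrC per_sint_period//; exact: lqf.2.
  exact: lqf.2.
have Iq : sint (fun u => (diffquot F s0 (u + s) - diffquot F s0 u) ^+ 2) 0 (2 * pi) <=
    4 * A / s0 ^+ 2 * `|s| * (2 * pi).
  have -> : 4 * A / s0 ^+ 2 * `|s| * (2 * pi) = sint (fun=> 4 * A / s0 ^+ 2 * `|s|) 0 (2 * pi).
    by rewrite sint_cst subr0.
  apply: sint_le; [exact: (loc_sqB lqs lq).2|exact: loc_integrable_cst|exact: ltW|].
  by move=> u _; apply: qs; exact: ltW.
apply: (@le_lt_trans _ _ (sint (fun u => 3 * (diffquot F s0 (u + s) - f (u + s)) ^+ 2 +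
  (3 * (diffquot F s0 (u + s) - diffquot F s0 u) ^+ 2 +
   3 * (diffquot F s0 u - f u) ^+ 2)) 0 (2 * pi))).
  apply: sint_le; [exact: (loc_sqB (loc_sq_shift s lf) lf).2| |exact: ltW|].
    apply: loc_integrableD; first exact/loc_integrableZ/lqfs.2.
    by apply: loc_integrableD; apply: loc_integrableZ;
      [exact: (loc_sqB lqs lq).2|exact: lqf.2].
  move=> u _; set x := diffquot F s0 (u + s); set y := diffquot F s0 u.
  have := sqr_ge0 ((x - f (u + s)) + (x - y)).
  have := sqr_ge0 ((x - f (u + s)) + (y - f u)).
  by have := sqr_ge0 ((x - y) - (y - f u)); lra.
have l1 := loc_integrableZ 3 lqfs.2; have l2 := loc_integrableZ 3 (loc_sqB lqs lq).2.
have l3 := loc_integrableZ 3 lqf.2.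
rewrite (sintD _ _ l1 (loc_integrableD l2 l3)) (sintD _ _ l2 l3).
rewrite (sintZ 3 _ _ lqfs.2) (sintZ 3 _ _ lqf.2) (sintZ 3 _ _ (loc_sqB lqs lq).2).
have : 12 * A / s0 ^+ 2 * (2 * pi) * `|s| <= K * `|s| by rewrite ler_wpM2r// /K lerDl.
have : 3 * (4 * A / s0 ^+ 2 * `|s| * (2 * pi)) = 12 * A / s0 ^+ 2 * (2 * pi) * `|s| by ring.
by move: Iq; move: (sint _ 0 (2 * pi)) => I1; lra.
Qed.

End PeriodicEstimates.

(** * The wave profile *)

Section Profile.
Variables (R : realType) (c : R) (eta : R -> R).
Hypotheses (c_gt0 : 0 < c) (wave : single_lobe c eta).
Implicit Types (u x y a b : R).

Definition stiff u : R := c ^+ 2 - 2 * eta u.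
Local Notation p := stiff.
Local Notation e1 := (derive1 eta).
Local Notation e2 := (derive1n 2 eta).
Local Notation k := (eta 0).

Lemma wave_smooth : smooth_per eta.
Proof. by case: wave => -[]. Qed.

Lemma smooth_e1 : smooth_per e1.
Proof. exact: smooth_per_derive1 wave_smooth. Qed.

Lemma smooth_e2 : smooth_per e2.
Proof. exact: smooth_per_derive1 smooth_e1. Qed.

Lemma d_eta u : is_derive u 1 eta (e1 u).
Proof. exact: smooth_per_derivable wave_smooth. Qed.

Lemma d_e1 u : is_derive u 1 e1 (e2 u).
Proof. exact: smooth_per_derivable smooth_e1. Qed.

Lemma wave_eq u : p u * e2 u = e1 u ^+ 2 - eta u.
Proof. by case: wave => -[_ /(_ u)]; rewrite /stiff; lra. Qed.

Lemma eta_even u : eta (- u) = eta u. Proof. by case: wave. Qed.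

Lemma eta_le u : eta u <= k. Proof. by case: wave. Qed.

Lemma eta_lt_max u : 0 < u < 2 * pi -> eta u != k.
Proof.
move=> /andP[u0 uT]; apply/eqP => h; case: wave => _ _ _ /(_ u h) [z zu].
have T0 := twopi_gt0 R; move: u0 uT; rewrite zu.
rewrite pmulr_lgt0// ltr0z => z0; rewrite -[X in _ < X]mul1r ltr_pM2r// ltrz1.
by case: z {zu} z0 => [[|n]|].
Qed.

Lemma e1_odd u : e1 (- u) = - e1 u.
Proof.
have h : is_derive u 1 (fun y => eta (- y)) (- e1 (- u)).
  have dN : is_derive u 1 (fun y : R => - y) (-1) by apply: is_derive_eq.
  have := is_derive1_comp (d_eta (- u)) dN.
  by rewrite mulrN1.
have : is_derive u 1 eta (- e1 (- u)).
  by apply: (near_eq_is_derive _ h); near=> y; rewrite eta_even.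
by case: (d_eta u) => _ <- [_ ->]; rewrite opprK.
Unshelve. all: by end_near. Qed.

Lemma e1_0 : e1 0 = 0.
Proof. by have := e1_odd 0; rewrite oppr0; lra. Qed.

Lemma e1_pi : e1 pi = 0.
Proof.
have := e1_odd pi; have := smooth_e1.1 (- pi).
rewrite (_ : - pi + 2 * pi = pi); last by ring.
by move=> -> ; lra.
Qed.

Lemma is_derive_pos_right (f : R -> R) x l : is_derive x 1 f l -> 0 < l ->
  exists2 d : R, 0 < d & forall y, x < y -> y - x < d -> f x < f y.
Proof.
move=> df l0; have [d d0 hd] := is_derive_edP df (divr_gt0 l0 (ltr0n R 2)).
exists d => // y xy yd.
have := hd y; rewrite ger0_norm ?subr_ge0 ?(ltW xy)// => /(_ yd).
rewrite ler_norml => /andP[h _]; nra.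
Qed.

Lemma e2_0 : e2 0 <= 0.
Proof.
rewrite leNgt; apply/negP => e20.
have [d d0 hd] := is_derive_pos_right (d_e1 0) e20.
have d2 : 0 < d / 2 by rewrite divr_gt0.
have [z] := MVT d2 (fun x _ => d_eta x)
  (continuous_subspaceT (smooth_per_continuous wave_smooth)).
rewrite in_itv/= => /andP[z0 zd] E.
have : 0 < e1 z by rewrite -e1_0; apply: hd => //; lra.
by have := eta_le (d / 2); rewrite subr0 in E; nra.
Qed.

(** At the crest p eta'' = - eta and eta'' <= 0; if p were nonpositive there, eta 0
    would be nonpositive too, contradicting p = c^2 - 2 eta. *)
Lemma stiff0_gt0 : 0 < p 0.
Proof.
have := wave_eq 0; rewrite e1_0 expr0n/= sub0r => h.
rewrite ltNge; apply/negP => p0; have := mulr_le0 p0 e2_0; rewrite h.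
have c2 : 0 < c ^+ 2 by rewrite exprn_gt0.
by move: p0; rewrite /stiff; lra.
Qed.

Lemma stiff_ge u : p 0 <= p u.
Proof. by rewrite /stiff; have := eta_le u; lra. Qed.

Lemma stiff_gt0 u : 0 < p u.
Proof. exact: lt_le_trans stiff0_gt0 (stiff_ge u). Qed.

Lemma d_stiff u : is_derive u 1 p (- 2 * e1 u).
Proof.
have := d_eta u => de; rewrite /stiff; apply: is_derive_eq.
by rewrite /GRing.scale/=; ring.
Qed.

Lemma smooth_stiff : smooth_per p.
Proof.
have -> : p = fun u => c ^+ 2 + (fun=> - 2) u * eta u.
  by apply/funext => u; rewrite /stiff; ring.
apply: smooth_perD; first exact: smooth_per_cst.
by apply: smooth_perM; [exact: smooth_per_cst|exact: wave_smooth].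
Qed.

(** The profile equation multiplied by 2 eta' is an exact derivative. *)
Lemma first_integral u : p u * e1 u ^+ 2 + eta u ^+ 2 = k ^+ 2.
Proof.
have h : forall x, is_derive x 1 (fun u => p u * e1 u ^+ 2 + eta u ^+ 2) 0.
  move=> x; have d1 := d_stiff x; have d2 := d_e1 x; have d3 := d_eta x.
  have := wave_eq x; move: (e2 x) d2 => e d2 h.
  apply: is_derive_eq; rewrite /GRing.scale/=.
  transitivity (2 * e1 x * (p x * e - (e1 x ^+ 2 - eta x))); first by ring.
  by rewrite h subrr mulr0.
by rewrite (is_derive_0_is_cst u 0 h) e1_0 expr0n/= mulr0 add0r.
Qed.

Lemma pi_bounds : 0 < (pi : R) < 2 * pi.
Proof. by rewrite pi_gt0 /= mulr_natl mulr2n ltrDl pi_gt0. Qed.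

Lemma k_gt0 : 0 < k.
Proof.
have k0 : 0 <= k.
  have := wave_eq 0; rewrite e1_0 expr0n/= sub0r => h.
  by have := mulr_ge0_le0 (ltW stiff0_gt0) e2_0; rewrite h; lra.
rewrite lt_neqAle k0 andbT eq_sym; apply/eqP => kE.
have pi0 := pi_gt0 R.
have := first_integral pi; rewrite e1_pi kE !expr0n/= mulr0 add0r => /eqP.
rewrite sqrf_eq0 => /eqP h; by have := eta_lt_max pi_bounds; rewrite h kE eqxx.
Qed.

Lemma e1_zero u : e1 u = 0 -> eta u != k -> eta u = - k.
Proof.
move=> e10 nk; have := first_integral u; rewrite e10 expr0n/= mulr0 add0r => /eqP.
by rewrite eqf_sqr (negbTE nk) => /eqP.
Qed.

Lemma e2_trough u : e1 u = 0 -> eta u = - k -> 0 < e2 u.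
Proof.
move=> e10 uk; have := wave_eq u; rewrite e10 uk expr0n/= sub0r opprK.
by move=> h; rewrite -(pmulr_rgt0 _ (stiff_gt0 u)) h k_gt0.
Qed.

Lemma eta_pi : eta pi = - k.
Proof. exact: e1_zero e1_pi (eta_lt_max pi_bounds). Qed.

(** By the first integral a critical point in (0, 2 pi) is a trough, where eta'' > 0.
    Two troughs in (0, pi] would enclose a local maximum, which is again a critical
    point and hence a trough. *)
Lemma e1_neq0 u : 0 < u < pi -> e1 u != 0.
Proof.
move=> /andP[u0 upi]; apply/eqP => e1u.
have pi0 := pi_gt0 R.
have uT : 0 < u < 2 * pi by apply/andP; split; lra.
have uk := e1_zero e1u (eta_lt_max uT).
have [d d0 hd] := is_derive_pos_right (d_e1 u) (e2_trough e1u uk).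
have ceta := smooth_per_continuous wave_smooth.
have [z zI zmax] := EVT_max (ltW upi) (continuous_subspaceT ceta).
pose y := Num.min (u + d / 2) pi.
have uy : u < y by rewrite lt_min upi andbT; lra.
have yd : y <= u + d / 2 by rewrite ge_min lexx.
have ypi : y <= pi by rewrite ge_min lexx orbT.
have [t] := MVT uy (fun x _ => d_eta x) (continuous_subspaceT ceta).
rewrite in_itv/= => /andP[ut ty] E.
have e1t : 0 < e1 t by rewrite -e1u; apply: hd => //; lra.
have yk : - k < eta y by have : 0 < e1 t * (y - u); [rewrite mulr_gt0// subr_gt0|lra].
have zk : - k < eta z by apply: lt_le_trans yk (zmax _ _); rewrite in_itv/= (ltW uy).
move: zI; rewrite in_itv/= => /andP[uz zpi].
have uz' : u < z by rewrite lt_neqAle uz andbT; apply/eqP => uzE; move: zk; rewrite -uzE uk ltxx.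
have zpi' : z < pi by rewrite lt_neqAle zpi andbT; apply/eqP => uzE; move: zk; rewrite uzE eta_pi ltxx.
have e1z : e1 z = 0.
  have dz x : derivable eta x 1 by case: (d_eta x).
  have := @derive1_at_max R eta u pi z (ltW upi) (fun x _ => dz x).
  rewrite in_itv/= uz' zpi' => /(_ isT); rewrite derive1E; case; last first.
    by move=> _ <-.
  by move=> x; rewrite in_itv/= => /andP[ux xpi]; apply: zmax; rewrite in_itv/= !ltW.
have zT : 0 < z < 2 * pi by apply/andP; split; lra.
by move: zk; rewrite (e1_zero e1z (eta_lt_max zT)) ltxx.
Qed.

Lemma e1_neq0' u : pi < u < 2 * pi -> e1 u != 0.
Proof.
move=> /andP[u1 u2]; rewrite -oppr_eq0 -e1_odd -smooth_e1.1.
by apply: e1_neq0; apply/andP; split; lra.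
Qed.

Lemma e2_0_neq0 : e2 0 != 0.
Proof.
apply/eqP => h; have := wave_eq 0; rewrite h e1_0 expr0n/= mulr0 sub0r.
by have := k_gt0; lra.
Qed.

End Profile.

Section LocalExtension.
Variable R : realType.
Implicit Types (f g F G : R -> R) (a b x y : R).

(** Functions that are singular at the zeros of eta', such as 1 / eta', are cut off
    outside [a, b] by composing their derivative with the projection onto [a, b]. *)
Lemma H1loc_extend f g a b : a <= b ->
  (forall x, a <= x <= b -> is_derive x 1 f (g x)) ->
  (forall x, a <= x <= b -> {for x, continuous g}) ->
  exists F G, [/\ H1loc F G, continuous G &
    forall x, a <= x <= b -> F x = f x /\ G x = g x].
Proof.
move=> ab df cg.
pose cl x := Num.max a (Num.min x b).
have clab x : a <= cl x <= b.
  by rewrite /cl le_max lexx /= ge_max ab ge_min lexx orbT.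
have clE x : a <= x <= b -> cl x = x.
  by move=> /andP[ax xb]; rewrite /cl min_l// max_r.
have ccl : continuous cl.
  move=> x; apply: (@continuous_max _ _ (cst a) (fun x => Num.min x b)).
    exact: cvg_cst.
  by apply: (@continuous_min _ _ id (cst b)); [exact: cvg_id|exact: cvg_cst].
pose G x := g (cl x).
have cG : continuous G.
  by move=> x; apply: (@continuous_comp _ _ _ cl g); [exact: ccl|exact/cg/clab].
pose F x := f a + sint G a x.
have dF x : is_derive x 1 F (G x).
  have := derive_sint a x cG => d; rewrite -[G x]add0r /F.
  by apply: is_deriveD.
exists F, G; split=> //; first exact: C1_H1loc.
move=> x xab; split; last by rewrite /G clE.
have /andP[ax xb] := xab.
have cF := is_derive_continuous dF.
have [] := @MVT_segment R (fun y => F y - f y) (fun=> 0) a x ax.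
- move=> y; rewrite in_itv/= => /andP[ay yx].
  have yab : a <= y <= b by rewrite (ltW ay) (le_trans (ltW yx) xb).
  have d1 := dF y; have d2 := df y yab.
  by apply: is_derive_eq; rewrite /G clE// subrr.
- apply: continuous_in_subspaceT => y; rewrite inE/= in_itv/= => /andP[ay yx].
  have yab : a <= y <= b by rewrite ay (le_trans yx xb).
  apply: cvgB; first exact: cF.
  apply: differentiable_continuous; apply/derivable1_diffP.
  by case: (df y yab).
- by move=> z _; rewrite mul0r /F sintxx addr0 subrr subr0 => /eqP; rewrite subr_eq0 => /eqP.
Qed.

End LocalExtension.

(** * The quadratic form between two zeros of the translation mode *)

Section JacobiEstimate.
Variables (R : realType) (c : R) (eta : R -> R).
Hypotheses (c_gt0 : 0 < c) (wave : single_lobe c eta).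
Implicit Types (u x y a b : R) (v w g : R -> R).
Local Notation p := (stiff c eta).
Local Notation e1 := (derive1 eta).
Local Notation e2 := (derive1n 2 eta).
Local Notation k := (eta 0).

Lemma stiff_neq0 u : p u != 0.
Proof. by rewrite gt_eqF// stiff_gt0. Qed.

Lemma continuous_eta : continuous eta.
Proof. exact: smooth_per_continuous (wave_smooth wave). Qed.
Lemma continuous_e1 : continuous e1.
Proof. exact: smooth_per_continuous (smooth_e1 wave). Qed.
Lemma continuous_e2 : continuous e2.
Proof. exact: smooth_per_continuous (smooth_e2 wave). Qed.
Lemma continuous_stiff : continuous p.
Proof. exact: smooth_per_continuous (smooth_stiff wave). Qed.

(** A primitive of eta / p; the second solution of L v = 0 is expressed with it. *)
Definition slip := sint (fun u => eta u / p u) 0.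

Lemma continuous_eta_p : continuous (fun u => eta u / p u).
Proof.
move=> u; apply: cvgM; first exact: continuous_eta.
by apply: cvgV; [exact: stiff_neq0|exact: continuous_stiff].
Qed.

Lemma d_slip u : is_derive u 1 slip (eta u / p u).
Proof. exact: derive_sint continuous_eta_p. Qed.

(** Reduction of order from L eta' = 0 gives this second solution of L v = 0, even
    and in general not periodic. *)
Definition even_mode u : R := eta u + e1 u * slip u.
Local Notation psi := even_mode.

Lemma continuous_even_mode : continuous psi.
Proof.
move=> u; apply: cvgD; first exact: continuous_eta.
apply: cvgM; first exact: continuous_e1.
exact: (is_derive_continuous d_slip).
Qed.

Lemma d_even_ratio u : e1 u != 0 ->
  is_derive u 1 (fun x => psi x / e1 x) (k ^+ 2 / (p u * e1 u ^+ 2)).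
Proof.
move=> e1u; have d1 := d_eta wave u; have d2 := d_e1 wave u; have d3 := d_slip u.
have h := wave_eq wave u; have I := first_integral wave u.
have pu := stiff_neq0 u.
move: (e2 u) d2 h => e d2 h.
have dV : is_derive u 1 (fun x => (e1 x)^-1) (- e1 u ^- 2 * e).
  by apply: is_derive_eq; rewrite /GRing.scale/=.
rewrite /even_mode; apply: is_derive_eq; rewrite /GRing.scale/=.
have -> : eta u = e1 u ^+ 2 - p u * e by rewrite h; ring.
rewrite -I (_ : eta u = e1 u ^+ 2 - p u * e); last by rewrite h; ring.
by field; rewrite e1u pu.
Qed.

(** The solution p y' / y of the Riccati equation attached to the solution y = eta'
    of L y = 0. *)
Definition riccati u : R := p u * e2 u / e1 u.

Lemma d_riccati u : e1 u != 0 ->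
  is_derive u 1 riccati (2 * e2 u - 1 - p u * e2 u ^+ 2 / e1 u ^+ 2).
Proof.
move=> e1u; have -> : riccati = fun x => (e1 x ^+ 2 - eta x) / e1 x.
  by apply/funext => x; rewrite /riccati (wave_eq wave).
have d1 := d_eta wave u; have d2 := d_e1 wave u.
have h := wave_eq wave u.
move: (e2 u) d2 h => e d2 h.
have dV : is_derive u 1 (fun x => (e1 x)^-1) (- e1 u ^- 2 * e).
  by apply: is_derive_eq; rewrite /GRing.scale/=.
apply: is_derive_eq; rewrite /GRing.scale/=.
have -> : p u * e ^+ 2 = (e1 u ^+ 2 - eta u) * e by rewrite -h; ring.
by field.
Qed.

Definition form_density v g u : R := p u * g u ^+ 2 + (2 * e2 u - 1) * v u ^+ 2.

Lemma continuous_potential : continuous (fun u => 2 * e2 u - 1).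
Proof.
move=> u; apply: cvgB; last exact: cvg_cst.
by apply: cvgM; [exact: cvg_cst|exact: continuous_e2].
Qed.

Lemma loc_form_density v g : H1loc v g -> loc_integrable (form_density v g).
Proof.
move=> hv; apply: loc_integrableD; apply: loc_integrableMc.
- exact: continuous_stiff.
- exact: hv.1.2.
- exact: continuous_potential.
- exact: (continuous_loc_sq (H1loc_continuous hv)).2.
Qed.

(** Subtracting the exact derivative of [riccati] times v^2 turns the form into
    int p (v' - (eta'' / eta') v)^2 = int p eta'^2 ((v / eta')')^2.  The increment of
    v / eta' is then bounded by the Cauchy-Schwarz inequality with weight
    1 / (p eta'^2), whose primitive is the ratio of the two solutions of L v = 0. *)
Lemma jacobi_segment v g a b : H1loc v g -> a <= b ->
  (forall x, a <= x <= b -> e1 x != 0) ->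
  let D := sint (form_density v g) a b -
           (riccati b * v b ^+ 2 - riccati a * v a ^+ 2) in
  0 <= D /\
  k ^+ 2 * (v b / e1 b - v a / e1 a) ^+ 2 <= D * (psi b / e1 b - psi a / e1 a).
Proof.
move=> hv ab e1x D; have [lg vg] := hv.
have ccont f : continuous f -> forall x, {for x, continuous f} by [].
have cv := H1loc_continuous hv.
have lv := continuous_loc_sq cv.
have aI : a <= a <= b by rewrite lexx.
have bI : a <= b <= b by rewrite lexx andbT.
have [F [G [hF cG FG]]] := H1loc_extend ab (fun x xab => d_riccati (e1x x xab))
  (fun x xab => ltac:(
    apply: cvgB; [exact: continuous_potential|
    apply: cvgM; [apply: cvgM; [exact: continuous_stiff|
      apply: cvgM; exact: continuous_e2]|
      apply: cvgV; [by rewrite expf_neq0// e1x|apply: cvgM; exact: continuous_e1]]])).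
have [E [E' [hE cE' EE']]] := @H1loc_extend R (fun x => (e1 x)^-1)
  (fun x => - e1 x ^- 2 * e2 x) a b ab
  (fun x xab => ltac:(have d1 := d_e1 wave x; have e1x' := e1x x xab;
    move: (e2 x) d1 => e d1; by apply: is_derive_eq; rewrite /GRing.scale/=))
  (fun x xab => ltac:(apply: cvgM; [apply: cvgN; apply: cvgV;
     [by rewrite expf_neq0// e1x|apply: cvgM; exact: continuous_e1]|exact: continuous_e2])).
have [K [K' [hK cK' KK']]] := @H1loc_extend R (fun x => psi x / e1 x)
  (fun x => k ^+ 2 / (p x * e1 x ^+ 2)) a b ab
  (fun x xab => d_even_ratio (e1x x xab))
  (fun x xab => ltac:(apply: cvgM; [exact: cvg_cst|apply: cvgV;
     [by rewrite mulf_neq0 ?stiff_neq0 ?expf_neq0// e1x|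
      apply: cvgM; [exact: continuous_stiff|apply: cvgM; exact: continuous_e1]]])).
have cF := H1loc_continuous hF; have cE := H1loc_continuous hE.
pose q u := g u - F u / p u * v u.
have cFp : continuous (fun u => F u / p u).
  move=> u; apply: cvgM; first exact: cF.
  by apply: cvgV; [exact: stiff_neq0|exact: continuous_stiff].
have lq : loc_sq_integrable q by apply: loc_sqB => //; exact: loc_sqMc.
have lpq : loc_integrable (fun u => p u * q u ^+ 2).
  by apply: loc_integrableMc; [exact: continuous_stiff|exact: lq.2].
have DE : D = sint (fun u => p u * q u ^+ 2) a b.
  have hF2 := H1locM hF (H1locM hv hv).
  have [_ /(_ a b)] := hF2.
  rewrite (FG _ aI).1 (FG _ bI).1 => FE.
  rewrite /D !expr2 FE -sintB; last 2 first.
  - exact: loc_form_density.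
  - exact: loc_sq_loc_integrable hF2.1.
  apply: eq_sint_in => // x xab; rewrite /form_density /q (FG x xab).1 (FG x xab).2.
  rewrite /riccati; have := e1x x xab; have := stiff_neq0 x.
  by move: (e2 x) => e pn en; field; rewrite pn en.
split.
  rewrite DE; apply: sint_ge0 => // u _.
  by rewrite mulr_ge0 ?sqr_ge0// ltW// stiff_gt0.
pose sp u := Num.sqrt (p u).
have csp : continuous sp.
  by move=> u; apply: (@continuous_comp _ _ _ p); [exact: continuous_stiff|exact: sqrt_continuous].
have sp2 u : sp u ^+ 2 = p u by rewrite sqr_sqrtr// ltW// stiff_gt0.
have sp0 u : sp u != 0 by rewrite gt_eqF// sqrtr_gt0 stiff_gt0.
have l1 : loc_sq_integrable (fun u => sp u * q u) by exact: loc_sqMc.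
have cEsp : continuous (fun u => E u / sp u).
  by move=> u; apply: cvgM; [exact: cE|apply: cvgV; [exact: sp0|exact: csp]].
have := cauchy_schwarz l1 (continuous_loc_sq cEsp) ab.
have -> : sint (fun u => (sp u * q u) ^+ 2) a b = sint (fun u => p u * q u ^+ 2) a b.
  by apply: eq_sint => u; rewrite exprMn sp2.
have -> : sint (fun u => sp u * q u * (E u / sp u)) a b = v b / e1 b - v a / e1 a.
  have [_ /(_ a b)] := H1locM hv hE.
  rewrite (EE' _ aI).1 (EE' _ bI).1 => ->.
  apply: eq_sint_in => // x xab; rewrite /q (FG x xab).1 (EE' x xab).1 (EE' x xab).2.
  rewrite /riccati; have := e1x x xab; have := stiff_neq0 x; have := sp0 x.
  by move: (e2 x) => e pn en sn; field; rewrite pn en sn.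
have -> : sint (fun u => (E u / sp u) ^+ 2) a b = (psi b / e1 b - psi a / e1 a) / k ^+ 2.
  have [_ /(_ a b)] := hK.
  rewrite (KK' _ aI).1 (KK' _ bI).1 => ->; rewrite mulrC -sintZ; last first.
    exact: continuous_loc_integrable.
  apply: eq_sint_in => // x xab; rewrite (KK' x xab).2 (EE' x xab).1.
  rewrite exprMn !exprVn sp2.
  have := e1x x xab; have := stiff_neq0 x; have := k_gt0 c_gt0 wave => k0 pn en.
  by field; rewrite pn en gt_eqF.
rewrite -DE => h; rewrite mulrC -ler_pdivlMr ?exprn_gt0 ?(k_gt0 c_gt0)//.
by rewrite -mulrA.
Qed.

End JacobiEstimate.

Section DirichletEstimate.
Variables (R : realType) (c : R) (eta : R -> R).
Hypotheses (c_gt0 : 0 < c) (wave : single_lobe c eta).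
Implicit Types (u x y a b : R) (v w g : R -> R).
Local Notation p := (stiff c eta).
Local Notation e1 := (derive1 eta).
Local Notation e2 := (derive1n 2 eta).
Local Notation k := (eta 0).
Local Notation psi := (even_mode c eta).
Local Notation ric := (riccati c eta).
Local Notation fd := (form_density c eta).

(** Near a simple zero q of eta' the factor p eta'' / eta' blows up like
    1 / (t - q), but v t ^+ 2 is o (t - q) when v q = 0. *)
Lemma riccati_boundary v g q : H1loc v g -> v q = 0 -> e1 q = 0 -> e2 q != 0 ->
  forall e, 0 < e -> exists2 d : R, 0 < d &
    forall t, `|t - q| < d -> e1 t != 0 -> `|ric t * v t ^+ 2| <= e.
Proof.
move=> hv vq e1q e2q e e0; have [lg vg] := hv.
have [M M0 hM] := per_continuous_bounded (smooth_perM (smooth_stiff wave) (smooth_e2 wave)).1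
   (smooth_per_continuous (smooth_perM (smooth_stiff wave) (smooth_e2 wave))).
set L := `|e2 q|; have L0 : 0 < L by rewrite normr_gt0.
have [d1 d10 hd1] := is_derive_edP (d_e1 wave q) (divr_gt0 L0 (ltr0n R 2)).
have eL : 0 < e * L / (2 * M) by rewrite !divr_gt0 ?mulr_gt0.
have [d2 d20 hd2] := sint_small q lg.2 eL.
exists (Num.min d1 d2); first by rewrite lt_min d10.
move=> t; rewrite lt_min => /andP[td1 td2] e1t.
have tq : t != q by apply: contraNneq e1t => ->; rewrite e1q.
have tq0 : 0 < `|t - q| by rewrite normr_gt0 subr_eq0.
have e1L : L / 2 * `|t - q| <= `|e1 t|.
  have := hd1 _ td1; rewrite e1q subr0 => h.
  have : L * `|t - q| <= `|e1 t| + `|e1 t - e2 q * (t - q)|.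
    rewrite -normrM -[in leLHS](subKr (e1 t) (e2 q * (t - q))).
    by rewrite (le_trans (ler_normB _ _)).
  lra.
have v2 : v t ^+ 2 <= `|t - q| * `|sint (fun u => g u ^+ 2) q t|.
  have S0 x y : x <= y -> 0 <= sint (fun u => g u ^+ 2) x y.
    by move=> xy; apply: sint_ge0 => // s _; exact: sqr_ge0.
  have [qt|/ltW qt] := leP q t.
    have := H1loc_sq_incr hv qt; rewrite vq subr0.
    by rewrite (ger0_norm (x := t - q)) ?subr_ge0// (ger0_norm (S0 _ _ qt)).
  have := H1loc_sq_incr hv qt; rewrite vq sub0r sqrrN.
  rewrite (ler0_norm (x := t - q)) ?subr_le0// opprB.
  by rewrite (sint_sym _ t q) normrN (ger0_norm (S0 _ _ qt)).
have S_e := ltW (hd2 _ td2).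
rewrite /riccati normrM normrM normfV (ger0_norm (sqr_ge0 _)).
rewrite mulrAC ler_pdivrMr ?normr_gt0//.
apply: (@le_trans _ _ (M * (`|t - q| * (e * L / (2 * M))))).
  apply: ler_pM; rewrite ?normr_ge0 ?sqr_ge0//.
  by apply: le_trans v2 _; rewrite ler_wpM2l.
have -> : M * (`|t - q| * (e * L / (2 * M))) = e * (L / 2 * `|t - q|).
  by field; rewrite gt_eqF.
by rewrite ler_wpM2l// ltW.
Qed.

(** Let the end points of the segment tend to the zeros al and be of eta'; the
    boundary terms disappear in the limit. *)
Lemma jacobi_dirichlet v g al be a b : H1loc v g -> v al = 0 -> v be = 0 ->
  e1 al = 0 -> e1 be = 0 -> e2 al != 0 -> e2 be != 0 ->
  (forall x, al < x < be -> e1 x != 0) -> al < a -> a <= b -> b < be ->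
  sint (fd v g) a b - (ric b * v b ^+ 2 - ric a * v a ^+ 2) <= sint (fd v g) al be.
Proof.
move=> hv va vb e1a e1b e2a e2b e1x ala ab bbe.
have lf := loc_form_density wave hv.
apply/ler_addgt0Pr => e e0; have e4 : 0 < e / 4 by rewrite divr_gt0.
have [d1 d10 h1] := riccati_boundary hv va e1a e2a e4.
have [d2 d20 h2] := riccati_boundary hv vb e1b e2b e4.
have [d3 d30 h3] := sint_small al lf e4.
have [d4 d40 h4] := sint_small be lf e4.
pose m1 := Num.min (a - al) (Num.min d1 d3).
pose m2 := Num.min (be - b) (Num.min d2 d4).
have m10 : 0 < m1 by rewrite !lt_min d10 d30 subr_gt0 ala.
have m20 : 0 < m2 by rewrite !lt_min d20 d40 subr_gt0 bbe.
have [m1a m1d m1e] : [/\ m1 <= a - al, m1 <= d1 & m1 <= d3].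
  by rewrite /m1 !ge_min !lexx /= !orbT.
have [m2a m2d m2e] : [/\ m2 <= be - b, m2 <= d2 & m2 <= d4].
  by rewrite /m2 !ge_min !lexx /= !orbT.
clearbody m1 m2.
pose a' := al + m1 / 2; pose b' := be - m2 / 2.
have [aa1 aa2] : al < a' /\ a' < a by clear -c_gt0 wave m10 m1a; rewrite /a'; split; lra.
have [bb1 bb2] : b < b' /\ b' < be by clear -c_gt0 wave m20 m2a; rewrite /b'; split; lra.
have a'I : `|a' - al| = m1 / 2 by rewrite /a' addrC addKr ger0_norm// ltW// divr_gt0.
have b'I : `|b' - be| = m2 / 2.
  by rewrite /b' addrC addKr normrN ger0_norm// ltW// divr_gt0.
have m1h : m1 / 2 < m1 by clear -c_gt0 wave m10; lra.
have m2h : m2 / 2 < m2 by clear -c_gt0 wave m20; lra.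
have e1a' : e1 a' != 0.
  by apply: e1x; rewrite aa1 (lt_trans aa2)// (le_lt_trans ab).
have e1b' : e1 b' != 0.
  by apply: e1x; rewrite bb2 andbT (lt_trans _ bb1)// (lt_le_trans ala).
have H1 : `|ric a' * v a' ^+ 2| <= e / 4.
  by apply: h1 => //; rewrite a'I (lt_le_trans m1h).
have H2 : `|ric b' * v b' ^+ 2| <= e / 4.
  by apply: h2 => //; rewrite b'I (lt_le_trans m2h).
have H3 : `|sint (fd v g) al a'| < e / 4 by apply: h3; rewrite a'I (lt_le_trans m1h).
have H4 : `|sint (fd v g) be b'| < e / 4 by apply: h4; rewrite b'I (lt_le_trans m2h).
have e1x1 x : a' <= x <= a -> e1 x != 0.
  move=> /andP[x1 x2]; apply: e1x; rewrite (lt_le_trans aa1)//=.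
  by rewrite (le_lt_trans x2)// (le_lt_trans ab).
have e1x2 x : b <= x <= b' -> e1 x != 0.
  move=> /andP[x1 x2]; apply: e1x; rewrite (le_lt_trans x2)// andbT.
  by rewrite (lt_le_trans ala)// (le_trans ab).
have [D1 _] := jacobi_segment c_gt0 wave hv (ltW aa2) e1x1.
have [D2 _] := jacobi_segment c_gt0 wave hv (ltW bb1) e1x2.
have E1 := sint_chasles al a' be lf; have E2 := sint_chasles a' a be lf.
have E3 := sint_chasles a b be lf; have E4 := sint_chasles b b' be lf.
rewrite (sint_sym _ b' be) normrN in H4.
clear -c_gt0 wave E1 E2 E3 E4 H1 H2 H3 H4 D1 D2.
move: E1 E2 E3 E4 H1 H2 H3 H4 D1 D2; rewrite !ler_norml !ltr_norml.
move: (ric a' * _) (ric b' * _) (ric a * _) (ric b * _).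
move: (sint _ al a') (sint _ a' a) (sint _ a b) (sint _ b b') (sint _ b' be).
move: (sint _ al be) (sint _ a' be) (sint _ a be) (sint _ b be).
move=> q1 q2 q3 q4 q5 q6 q7 q8 q9 r1 r2 r3 r4 E1 E2 E3 E4.
move=> /andP[? ?] /andP[? ?] /andP[? ?] /andP[? ?] ? ?.
lra.
Qed.

(** The multiple of eta' is chosen so that v - B eta' vanishes at the midpoint m.
    At u the bound of [jacobi_segment] is multiplied by eta' (u)^2, which compensates
    the growth of the ratio of the two solutions near the zeros of eta'. *)
Lemma dirichlet_estimate al be : al < be ->
  e1 al = 0 -> e1 be = 0 -> e2 al != 0 -> e2 be != 0 ->
  (forall x, al < x < be -> e1 x != 0) ->
  exists2 M : R, 0 < M & forall v g, H1loc v g -> v al = 0 -> v be = 0 ->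
    exists B : R, forall u, al <= u <= be ->
      (v u - B * e1 u) ^+ 2 <= M * sint (fd v g) al be.
Proof.
move=> albe e1a e1b e2a e2b e1x.
pose m := (al + be) / 2.
have [alm mbe] : al < m /\ m < be by clear -c_gt0 wave albe; rewrite /m; split; lra.
have e1m : e1 m != 0 by apply: e1x; rewrite alm.
have k0 := k_gt0 c_gt0 wave.
have k2 : 0 < k ^+ 2 by rewrite exprn_gt0.
pose z u := psi u * e1 u - e1 u ^+ 2 * (psi m / e1 m).
have cz : continuous z.
  move=> u; apply: cvgB.
    by apply: cvgM; [exact: (continuous_even_mode c_gt0 wave)|exact: (continuous_e1 wave)].
  apply: cvgM; last exact: cvg_cst.
  by apply: cvgM; exact: (continuous_e1 wave).
have [M M0 hM] := continuous_bounded_itv al be cz.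
exists (M / k ^+ 2); first by rewrite divr_gt0.
move=> v g hv va vb; exists (v m / e1 m) => u /andP[alu ube].
have Q0 : 0 <= sint (fd v g) al be.
  apply: le_trans (jacobi_dirichlet hv va vb e1a e1b e2a e2b e1x alm (lexx m) mbe).
  by rewrite sintxx !subrr.
have [ua|/eqP ua] := eqVneq al u.
  by rewrite -ua va e1a mulr0 subr0 expr0n/= mulr_ge0// ltW// divr_gt0.
have [ub|/eqP ub] := eqVneq u be.
  by rewrite ub vb e1b mulr0 subr0 expr0n/= mulr_ge0// ltW// divr_gt0.
have alu' : al < u by rewrite lt_neqAle alu andbT; apply/eqP.
have ube' : u < be by rewrite lt_neqAle ube andbT; apply/eqP.
have e1u : e1 u != 0 by apply: e1x; rewrite alu'.
have uM : `|z u| <= M by apply: hM; rewrite alu ube.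
rewrite [leRHS]mulrAC ler_pdivlMr// [leLHS]mulrC.
have -> : k ^+ 2 * (v u - v m / e1 m * e1 u) ^+ 2 =
    e1 u ^+ 2 * (k ^+ 2 * (v u / e1 u - v m / e1 m) ^+ 2).
  by field; rewrite e1u e1m.
have zE : z u = e1 u ^+ 2 * (psi u / e1 u - psi m / e1 m) by rewrite /z; field; rewrite e1u e1m.
have e1u2 : 0 <= e1 u ^+ 2 by exact: sqr_ge0.
move: uM; rewrite zE ler_norml => /andP[uM1 uM2].
have [um|/ltW mu] := leP u m.
  have e1x1 x : u <= x <= m -> e1 x != 0.
    by move=> /andP[x1 x2]; apply: e1x; rewrite (lt_le_trans alu' x1) (le_lt_trans x2 mbe).
  have [D0 h] := jacobi_segment c_gt0 wave hv um
    e1x1.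
  have DQ := jacobi_dirichlet hv va vb e1a e1b e2a e2b e1x alu' um mbe.
  move: D0 h DQ; set D := (X in 0 <= X) => D0 h DQ.
  rewrite -(sqrrN (v u / e1 u - v m / e1 m)) opprB; apply: le_trans (ler_wpM2l e1u2 h) _.
  rewrite mulrCA; have hh : e1 u ^+ 2 * (psi m / e1 m - psi u / e1 u) <= M.
    by rewrite -lerN2 -mulrN opprB.
  apply: (le_trans (ler_wpM2l D0 hh)); rewrite mulrC; apply: ler_wpM2l => //.
  exact: ltW.
have e1x2 x : m <= x <= u -> e1 x != 0.
  by move=> /andP[x1 x2]; apply: e1x; rewrite (lt_le_trans alm x1) (le_lt_trans x2 ube').
have [D0 h] := jacobi_segment c_gt0 wave hv mu
  e1x2.
have DQ := jacobi_dirichlet hv va vb e1a e1b e2a e2b e1x alm mu ube'.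
move: D0 h DQ; set D := (X in 0 <= X) => D0 h DQ.
apply: le_trans (ler_wpM2l e1u2 h) _.
rewrite mulrCA; apply: (le_trans (ler_wpM2l D0 uM2)); rewrite mulrC; apply: ler_wpM2l => //.
exact: ltW.
Qed.

End DirichletEstimate.

(** * The speed derivative of the wave *)

Section Coercivity.
Variables (R : realType) (c : R) (eta : R -> R).
Hypotheses (c_gt0 : 0 < c) (wave : single_lobe c eta).
Implicit Types (u x y a b : R) (f v w g n m l : R -> R).
Local Notation p := (stiff c eta).
Local Notation e1 := (derive1 eta).
Local Notation e2 := (derive1n 2 eta).
Local Notation k := (eta 0).
Local Notation fd := (form_density c eta).
Local Notation T := (2 * pi).

Let ceta := continuous_eta wave.
Let ce1 := continuous_e1 wave.
Let ce2 := continuous_e2 wave.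
Let cp := continuous_stiff wave.
Let cint f : continuous f -> loc_integrable f := @continuous_loc_integrable R f.

Lemma sint_gt0 f a b x : continuous f -> (forall u, 0 <= f u) ->
  a < x -> x < b -> 0 < f x -> 0 < sint f a b.
Proof.
move=> cf f0 ax xb fx; have lf := cint cf.
have /continuousP_ed /(_ x (f x / 2)) := cf.
rewrite divr_gt0// => /(_ isT) [d d0 hd].
pose y := Num.min (x + d / 2) b.
have xy : x < y by rewrite lt_min xb andbT ltrDl divr_gt0.
have yb : y <= b by rewrite ge_min lexx orbT.
have yd : y <= x + d / 2 by rewrite ge_min lexx.
rewrite -(sint_chasles a x b lf) -(sint_chasles x y b lf).
have h1 : 0 <= sint f a x by apply: sint_ge0 => // ; exact: ltW.
have h2 : 0 <= sint f y b by apply: sint_ge0.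
suff : f x / 2 * (y - x) <= sint f x y.
  have : 0 < f x / 2 * (y - x) by rewrite mulr_gt0 ?divr_gt0 ?subr_gt0.
  lra.
rewrite -sint_cst; apply: sint_le => //; [exact: loc_integrable_cst|exact: ltW|].
move=> u /andP[xu uy]; have := hd u.
rewrite ger0_norm ?subr_ge0// ltr_norml => /(_ _) h.
have : u - x < d by lra.
by move=> /h /andP[]; lra.
Qed.

Lemma per_sint_derive f g : per f -> continuous g ->
  (forall u, is_derive u 1 f (g u)) -> sint g 0 T = 0.
Proof.
move=> pf cg df; rewrite (sint_derive 0 T cg df).
by rewrite -(pf 0) add0r subrr.
Qed.

Lemma sint_e2 : sint e2 0 T = 0.
Proof. exact: per_sint_derive (smooth_e1 wave).1 ce2 (d_e1 wave). Qed.

Lemma continuous_e1sq : continuous (fun u => e1 u ^+ 2).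
Proof. by move=> u; apply: cvgM; exact: ce1. Qed.

Lemma pihalf_bounds : 0 < (pi / 2 : R) /\ pi / 2 < (T : R).
Proof. by have := pi_gt0 R; split; lra. Qed.

Lemma e1_pihalf : e1 (pi / 2) != 0.
Proof.
apply: (e1_neq0 c_gt0 wave); have := pi_gt0 R => pi0.
by apply/andP; split; lra.
Qed.

Lemma sint_e1sq_gt0 : 0 < sint (fun u => e1 u ^+ 2) 0 T.
Proof.
have [h1 h2] := pihalf_bounds.
apply: (sint_gt0 continuous_e1sq _ h1 h2) => [u|]; first exact: sqr_ge0.
by rewrite exprn_even_gt0//= e1_pihalf.
Qed.

Lemma sint_eta : sint eta 0 T = - sint (fun u => e1 u ^+ 2) 0 T.
Proof.
have cpe1 : continuous (fun u => p u * e2 u + - 2 * e1 u * e1 u).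
  move=> u; apply: cvgD; first by apply: cvgM; [exact: cp|exact: ce2].
  by apply: cvgM; [apply: cvgM; [exact: cvg_cst|exact: ce1]|exact: ce1].
have h := @per_sint_derive (fun u => p u * e1 u) _ _ cpe1.
have E : sint (fun u => p u * e2 u + -2 * e1 u * e1 u) 0 T = 0.
  apply: h => u; first by rewrite (smooth_stiff wave).1 (smooth_e1 wave).1.
  have d1 := d_e1 wave u; have d2 := d_stiff wave u.
  move: (e2 u) d1 => e d1.
  by apply: is_derive_eq; rewrite /GRing.scale/=; ring.
move: E; rewrite (eq_sint (g := fun u => - (e1 u ^+ 2) - eta u)); last first.
  by move=> u; rewrite (wave_eq wave); ring.
rewrite sintB ?sintN; try exact: cint ceta; try exact: cint continuous_e1sq.
  lra.
exact/loc_integrableN/cint/continuous_e1sq.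
Qed.

Let ceta_p := continuous_eta_p c_gt0 wave.
Local Notation slp := (slip c eta).

(** eta / p and eta'^2 / p differ by eta'', whose integral over a period vanishes. *)
Lemma slip_T_gt0 : 0 < slp T.
Proof.
have ce1p : continuous (fun u => e1 u ^+ 2 / p u).
  move=> u; apply: cvgM; first exact: continuous_e1sq.
  by apply: cvgV; [exact: (stiff_neq0 c_gt0 wave)|exact: cp].
have -> : slp T = sint (fun u => e1 u ^+ 2 / p u) 0 T.
  have := sintB 0 T (cint ce1p) (cint ce2); rewrite sint_e2 subr0 => <-.
  apply: eq_sint => u.
  have -> : e2 u = (e1 u ^+ 2 - eta u) / p u.
    by rewrite -(wave_eq wave) [p u * _]mulrC mulfK// (stiff_neq0 c_gt0 wave).
  by ring.
have [h1 h2] := pihalf_bounds.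
apply: (sint_gt0 ce1p _ h1 h2) => [u|].
  by rewrite mulr_ge0 ?sqr_ge0// invr_ge0 ltW// (stiff_gt0 c_gt0 wave).
by rewrite divr_gt0 ?(stiff_gt0 c_gt0 wave)// exprn_even_gt0//= e1_pihalf.
Qed.

(** The solution of L n = 2 eta'' is sought as a combination of eta, u eta' and
    eta' times [slip]; this coefficient makes the sum of the last two periodic. *)
Definition slope : R := 2 * pi / c ^+ 2 / slp T.
Definition phase u : R := - u / c ^+ 2 + slope * slp u.
Definition dphase u : R := - (c ^+ 2)^-1 + slope * (eta u / p u).
Definition ampl : R := 2 / c ^+ 2 + slope.
(** Differentiating the profile equation with respect to c shows that, up to the
    factor c, this is the derivative of the wave along the family of waves of period
    2 pi. *)
Definition cmode u : R := ampl * eta u + e1 u * phase u.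
Definition dcmode u : R := ampl * e1 u + (e2 u * phase u + e1 u * dphase u).

Let c2 : 0 < c ^+ 2. Proof. by rewrite exprn_gt0. Qed.

Lemma slope_gt0 : 0 < slope.
Proof. by rewrite /slope !divr_gt0 ?slip_T_gt0 ?twopi_gt0. Qed.

Lemma ampl_gt0 : 0 < ampl.
Proof. by rewrite /ampl addr_gt0 ?slope_gt0// divr_gt0. Qed.

Lemma per_phase : per phase.
Proof.
move=> u; rewrite /phase.
have -> : slp (u + T) = slp u + slp T.
  rewrite /slip -(sint_chasles 0 u (u + T)) ?per_sint_period//; try exact: cint.
  by move=> t; rewrite (wave_smooth wave).1 (smooth_stiff wave).1.
have s0 : slp T != 0 by rewrite gt_eqF// slip_T_gt0.
have cc : c ^+ 2 != 0 by rewrite gt_eqF.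
have sT : slope * slp T = 2 * pi / c ^+ 2 by rewrite /slope mulfVK.
by rewrite [slope * _]mulrDr sT; ring.
Qed.

Lemma d_phase u : is_derive u 1 phase (dphase u).
Proof.
have ds := d_slip c_gt0 wave u; rewrite /phase /dphase.
by apply: is_derive_eq; rewrite /GRing.scale/=; ring.
Qed.

Lemma continuous_phase : continuous phase.
Proof. exact: is_derive_continuous d_phase. Qed.

Lemma continuous_dphase : continuous dphase.
Proof.
move=> u; apply: cvgD; first exact: cvg_cst.
by apply: cvgM; [exact: cvg_cst|exact: ceta_p].
Qed.

Lemma per_cmode : per cmode.
Proof.
by move=> u; rewrite /cmode per_phase (wave_smooth wave).1 (smooth_e1 wave).1.
Qed.

Lemma d_cmode u : is_derive u 1 cmode (dcmode u).
Proof.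
have d0 := d_eta wave u; have d1 := d_e1 wave u; have d2 := d_phase u.
rewrite /cmode /dcmode; move: (e2 u) d1 => e d1.
by apply: is_derive_eq; rewrite /GRing.scale/=; ring.
Qed.

Lemma continuous_dcmode : continuous dcmode.
Proof.
move=> u; apply: cvgD; first by apply: cvgM; [exact: cvg_cst|exact: ce1].
apply: cvgD; first by apply: cvgM; [exact: ce2|exact: continuous_phase].
by apply: cvgM; [exact: ce1|exact: continuous_dphase].
Qed.

Lemma continuous_cmode : continuous cmode.
Proof. exact: is_derive_continuous d_cmode. Qed.

(** In the form L n = 2 eta''. *)
Lemma d_p_dcmode u :
  is_derive u 1 (fun u => p u * dcmode u) ((2 * e2 u - 1) * cmode u - 2 * e2 u).
Proof.
have pn x : p x != 0 := stiff_neq0 c_gt0 wave x.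
have cn : c ^+ 2 != 0 by rewrite gt_eqF.
have -> : (fun u => p u * dcmode u) = fun u => ampl * (p u * e1 u) +
    ((e1 u ^+ 2 - eta u) * phase u + e1 u * (- p u / c ^+ 2 + slope * eta u)).
  apply/funext => x; rewrite /dcmode /dphase -(wave_eq wave).
  by field; rewrite pn gt_eqF.
have d0 := d_eta wave u; have d1 := d_e1 wave u; have d2 := d_phase u.
have d3 := d_stiff wave u; have h := wave_eq wave u.
have pu := pn u; move: (e2 u) h d1 => e h d1.
apply: is_derive_eq; rewrite /GRing.scale/=.
rewrite /cmode /dphase /ampl; apply/eqP; rewrite -subr_eq0.
(* the difference of the two sides is a multiple of the profile equation, with
   the multiplier -ampl - c^-2 + slope eta / p *)
have r0 : (e1 u ^+ 2 - eta u - p u * e) *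
    (- ampl - (c ^+ 2)^-1 + slope * (eta u / p u)) = 0.
  by rewrite h subrr mul0r.
rewrite -[X in _ == X]r0; apply/eqP; rewrite /ampl; move: pu; rewrite /stiff => pu.
by field; rewrite pu gt_eqF.
Qed.

End Coercivity.

(** * The quadratic form under the constraints *)

Section ConstrainedForm.
Variables (R : realType) (c : R) (eta : R -> R).
Hypotheses (c_gt0 : 0 < c) (wave : single_lobe c eta).
Implicit Types (u x y a b : R) (f v w g n m l : R -> R).
Local Notation p := (stiff c eta).
Local Notation e1 := (derive1 eta).
Local Notation e2 := (derive1n 2 eta).
Local Notation k := (eta 0).
Local Notation fd := (form_density c eta).
Local Notation T := (2 * pi).
Local Notation cmode := (cmode c eta).
Local Notation dcmode := (dcmode c eta).
Local Notation ampl := (ampl c eta).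
Local Notation slope := (slope c eta).
Local Notation phase := (phase c eta).

Let ceta := continuous_eta wave.
Let ce1 := continuous_e1 wave.
Let ce2 := continuous_e2 wave.
Let cp := continuous_stiff wave.
Let cpot := continuous_potential wave.
Let ccm := continuous_cmode c_gt0 wave.
Let cint f : continuous f -> loc_integrable f := @continuous_loc_integrable R f.

Lemma cint_e2M f : continuous f -> loc_integrable (fun u => e2 u * f u).
Proof. by move=> cf; apply: cint => u; apply: cvgM; [exact: ce2|exact: cf]. Qed.

(** The polar form Q(v, n) is int v (L n) as soon as p n' is absolutely continuous. *)
Lemma form_cross v g n m l : per v -> H1loc v g -> per m -> H1loc n m ->
  H1loc (fun u => p u * m u) l ->
  sint (fun u => p u * g u * m u + (2 * e2 u - 1) * v u * n u) 0 T =
  sint (fun u => v u * ((2 * e2 u - 1) * n u - l u)) 0 T.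
Proof.
move=> pv hv pm hn hl.
have cv := H1loc_continuous hv; have cn := H1loc_continuous hn.
have lvn : loc_integrable (fun u => (2 * e2 u - 1) * v u * n u).
  by apply: cint => u; apply: cvgM; [apply: cvgM; [exact: cpot|exact: cv]|exact: cn].
have lvl : loc_integrable (fun u => v u * l u).
  by apply: loc_sqM; [exact: continuous_loc_sq|exact: hl.1].
have cpm := H1loc_continuous hl.
have := H1loc_parts 0 T hv hl.
have pT f : per f -> f T = f 0 by move=> pf; rewrite -(pf 0) add0r.
rewrite (pT v pv) (pT m pm) (pT p (smooth_stiff wave).1) subrr sub0r => E.
rewrite sintD//; last first.
  apply: (eq_loc_integrable (f := fun u => g u * (p u * m u))); first by move=> u; ring.
  by apply: loc_sqM; [exact: hv.1|exact: continuous_loc_sq].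
rewrite (eq_sint (g := fun u => g u * (p u * m u))); last by move=> u; ring.
rewrite E addrC -sintN// -sintD//; last exact: loc_integrableN.
by apply: eq_sint => u; ring.
Qed.

Lemma H1loc_cmode : H1loc cmode dcmode.
Proof.
apply: C1_H1loc; first exact: continuous_dcmode.
exact: d_cmode.
Qed.

Lemma H1loc_p_dcmode :
  H1loc (fun u => p u * dcmode u) (fun u => (2 * e2 u - 1) * cmode u - 2 * e2 u).
Proof.
apply: C1_H1loc; last exact: d_p_dcmode.
move=> u; apply: cvgB; first by apply: cvgM; [exact: cpot|exact: ccm].
by apply: cvgM; [exact: cvg_cst|exact: ce2].
Qed.

Lemma per_dcmode : per dcmode.
Proof.
have -> : dcmode = derive1 cmode.
  by apply/funext => u; rewrite derive1E; case: (d_cmode c_gt0 wave u).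
exact/per_derive1/per_cmode.
Qed.

(** As L n = 2 eta'' and Q(1, n) = int L n, this says that 1 and n are
    Q-orthogonal. *)
Lemma sint_cmode : sint cmode 0 T = sint (fun u => 2 * (e2 u * cmode u)) 0 T.
Proof.
have h1 : H1loc (fun _ : R => 1) (fun=> 0).
  by apply: C1_H1loc => x; exact: cvg_cst.
have p1 : per (fun _ : R => 1) by [].
have := form_cross p1 h1 per_dcmode H1loc_cmode H1loc_p_dcmode.
rewrite (eq_sint (g := fun u => 2 * (e2 u * cmode u) - cmode u)); last first.
  by move=> u; ring.
rewrite sintB; [|exact/loc_integrableZ/cint_e2M|exact: cint].
rewrite (eq_sint (f := fun u => 1 * _) (g := fun u => 2 * e2 u)); last by move=> u; ring.
rewrite (sintZ 2 _ _ (cint ce2)) (sint_e2 wave) mulr0 => /eqP.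
by rewrite subr_eq0 => /eqP.
Qed.

(** This integral is Q(n, n), as Q(n, n) = int n (2 eta'').  Integration by parts
    writes it as a positive multiple of int eta = - int eta'^2 minus a positive
    multiple of int eta^2 / p. *)
Lemma sint_cmode_lt0 : sint cmode 0 T < 0.
Proof.
have cph := continuous_phase c_gt0 wave.
have cdph := continuous_dphase c_gt0 wave.
have hphase : H1loc phase (dphase c eta).
  by apply: C1_H1loc; [exact: cdph|move=> u; exact: d_phase].
have heta := smooth_per_H1loc (wave_smooth wave).
have pT f : per f -> f T = f 0 by move=> pf; rewrite -(pf 0) add0r.
have le1p : loc_integrable (fun u => e1 u * phase u).
  by apply: cint => u; apply: cvgM; [exact: ce1|exact: cph].
have cq : continuous (fun u => eta u ^+ 2 / p u).
  move=> u; apply: cvgM; first by apply: cvgM; exact: ceta.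
  by apply: cvgV; [exact: (stiff_neq0 c_gt0 wave)|exact: cp].
rewrite sintD ?sintZ//; try exact: cint; last exact/loc_integrableZ/cint.
rewrite (H1loc_parts 0 T heta hphase) (pT eta (wave_smooth wave).1) (pT phase (per_phase c_gt0 wave)).
rewrite subrr sub0r.
rewrite (eq_sint (f := fun u => eta u * _)
  (g := fun u => - (c ^+ 2)^-1 * eta u + slope * (eta u ^+ 2 / p u))); last first.
  by move=> u; rewrite /dphase; ring.
rewrite sintD ?sintZ//; try exact: cint; try exact/loc_integrableZ/cint.
have I0 : 0 <= sint (fun u => eta u ^+ 2 / p u) 0 T.
  apply: sint_ge0 => [|u _]; first exact: ltW (twopi_gt0 R).
  by rewrite mulr_ge0 ?sqr_ge0// invr_ge0 ltW// (stiff_gt0 c_gt0 wave).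
have m0 : sint eta 0 T < 0 by rewrite (sint_eta wave) oppr_lt0 (sint_e1sq_gt0 c_gt0 wave).
have a0 := ampl_gt0 c_gt0 wave; have s0 := slope_gt0 c_gt0 wave.
have c20 : 0 < (c ^+ 2)^-1 by rewrite invr_gt0 exprn_gt0.
move: m0 I0 a0 s0 c20; move: (sint _ _ _) (sint _ _ _) ampl slope (c ^+ 2)^-1 => x y a s d.
move=> x0 y0 a0 s0 d0; have := mulr_ge0 (ltW s0) y0.
by nra.
Qed.

Lemma form_expand v g n m a b : H1loc v g -> H1loc n m ->
  sint (fd (fun u => v u + n u) (fun u => g u + m u)) a b =
  sint (fd v g) a b + sint (fd n m) a b +
  2 * sint (fun u => p u * g u * m u + (2 * e2 u - 1) * v u * n u) a b.
Proof.
move=> hv hn; have cv := H1loc_continuous hv; have cn := H1loc_continuous hn.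
have lc : loc_integrable (fun u => p u * g u * m u + (2 * e2 u - 1) * v u * n u).
  apply: loc_integrableD; last first.
    by apply: cint => u; apply: cvgM; [apply: cvgM; [exact: cpot|exact: cv]|exact: cn].
  apply: (eq_loc_integrable (f := fun u => p u * (g u * m u))); first by move=> u; ring.
  by apply: loc_integrableMc => //; apply: loc_sqM; [exact: hv.1|exact: hn.1].
have l1 := loc_form_density wave hv; have l2 := loc_form_density wave hn.
rewrite -(sintZ 2 _ _ lc) -sintD// -sintD; [|exact: loc_integrableD|exact: loc_integrableZ].
by apply: eq_sint => u; rewrite /form_density; ring.
Qed.

(** As L 1 = 2 eta'' - 1 and L n = 2 eta'', the constraints make v Q-orthogonal to
    1 and n, which are Q-orthogonal to each other with Q(1, 1) = - 2 pi and
    Q(n, n) = int n < 0: the two span a negative plane. *)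
Lemma form_shift v g a b : per v -> H1loc v g ->
  sint v 0 T = 0 -> sint (fun u => e2 u * v u) 0 T = 0 ->
  sint (fd (fun u => v u + (a + b * cmode u)) (fun u => g u + b * dcmode u)) 0 T =
  sint (fd v g) 0 T - 2 * pi * a ^+ 2 + b ^+ 2 * sint cmode 0 T.
Proof.
move=> pv hv v0 e2v.
have cv := H1loc_continuous hv.
pose n u := a + b * cmode u; pose m u := b * dcmode u.
have hn : H1loc n m.
  have h1 : H1loc (fun _ : R => a) (fun=> 0).
    by apply: C1_H1loc => x; exact: cvg_cst.
  have := H1locD h1 (H1locZ b H1loc_cmode); congr H1loc.
  by apply/funext => u; rewrite add0r.
have pm : per m by move=> u; rewrite /m per_dcmode.
have pn : per n by move=> u; rewrite /n (per_cmode c_gt0 wave).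
have hl : H1loc (fun u => p u * m u) (fun u => b * ((2 * e2 u - 1) * cmode u - 2 * e2 u)).
  have := H1locZ b H1loc_p_dcmode; congr H1loc.
  by apply/funext => u; rewrite /m; ring.
have Ln f : (fun u => f u * ((2 * e2 u - 1) * n u - b * ((2 * e2 u - 1) * cmode u - 2 * e2 u)))
   = fun u => 2 * (a + b) * (e2 u * f u) - a * f u.
  by apply/funext => u; rewrite /n; ring.
rewrite (form_expand _ _ hv hn) (form_cross pv hv pm hn hl) Ln.
rewrite sintB; [|exact/loc_integrableZ/cint_e2M|exact/loc_integrableZ/cint].
rewrite (sintZ _ _ _ (cint_e2M cv)) (sintZ _ _ _ (cint cv)) v0 e2v !mulr0 subrr mulr0 addr0.
rewrite -addrA; congr (_ + _).
have := form_cross pn hn pm hn hl; rewrite Ln.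
rewrite (eq_sint (g := fd n m)); last by move=> u; rewrite /form_density; ring.
move=> ->; rewrite (eq_sint (g := fun u =>
  2 * (a + b) * a * e2 u + ((a + b) * b * (2 * (e2 u * cmode u)) -
  (a ^+ 2 + a * b * cmode u)))); last by move=> u; rewrite /n; ring.
have l1 := cint_e2M ccm; have l2 := cint ccm; have l3 := cint ce2.
have lc : loc_integrable (fun _ : R => a ^+ 2) := loc_integrable_cst _.
rewrite sintD; [|exact: loc_integrableZ|apply: loc_integrableB]; last 2 first.
- exact/loc_integrableZ/loc_integrableZ.
- by apply: loc_integrableD => //; exact: loc_integrableZ.
rewrite sintB; [|exact/loc_integrableZ/loc_integrableZ|]; last first.
  by apply: loc_integrableD => //; exact: loc_integrableZ.
rewrite (sintD _ _ lc (loc_integrableZ _ l2)) sint_cst subr0.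
rewrite (sintZ _ _ _ l3) (sintZ _ _ _ (loc_integrableZ 2 l1)) (sintZ _ _ _ l2).
by rewrite -sint_cmode (sint_e2 wave); ring.
Qed.

End ConstrainedForm.

(** * Coercivity *)

Section Coercive.
Variables (R : realType) (c : R) (eta : R -> R).
Hypotheses (c_gt0 : 0 < c) (wave : single_lobe c eta).
Implicit Types (u x y a b : R) (f v w g n m l : R -> R).
Local Notation p := (stiff c eta).
Local Notation e1 := (derive1 eta).
Local Notation e2 := (derive1n 2 eta).
Local Notation k := (eta 0).
Local Notation fd := (form_density c eta).
Local Notation T := (2 * pi).

Let ceta := continuous_eta wave.
Let ce1 := continuous_e1 wave.
Let ce2 := continuous_e2 wave.
Let cp := continuous_stiff wave.
Let cint f : continuous f -> loc_integrable f := @continuous_loc_integrable R f.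

Lemma sqr_sum2 (x y : R) : (x + y) ^+ 2 <= 2 * (x ^+ 2 + y ^+ 2).
Proof. have := sqr_ge0 (x - y); lra. Qed.

Lemma sqr_sum3 (x y z : R) : (x + y + z) ^+ 2 <= 3 * (x ^+ 2 + y ^+ 2 + z ^+ 2).
Proof.
by have := sqr_ge0 (x - y); have := sqr_ge0 (y - z); have := sqr_ge0 (x - z); lra.
Qed.

Lemma four_parts_le (Q Q1 Q2 x y : R) : Q1 + Q2 = Q - x + y ->
  0 <= Q1 -> 0 <= Q2 -> 0 <= x -> 0 <= - y ->
  [/\ Q1 <= Q, Q2 <= Q, x <= Q & - y <= Q].
Proof. by move=> *; split; lra. Qed.

Lemma potential_lower (m e : R) : - m <= e -> 0 <= 2 * e - 1 + (2 * m + 1).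
Proof. lra. Qed.

Lemma sint_sqr_le f a b (S : R) : continuous f -> a <= b ->
  (forall u, a <= u <= b -> f u ^+ 2 <= S) -> sint f a b ^+ 2 <= (b - a) ^+ 2 * S.
Proof.
move=> cf ab fS.
have c1 : loc_sq_integrable (fun _ : R => 1).
  by apply: continuous_loc_sq => x; exact: cvg_cst.
have lf := continuous_loc_sq cf.
have := cauchy_schwarz c1 lf ab.
rewrite (eq_sint (g := f)) => [|u]; last by rewrite mul1r.
rewrite sint_cst expr1n mul1r => h; apply: (le_trans h).
rewrite expr2 -mulrA ler_wpM2l ?subr_ge0//.
rewrite mulrC -sint_cst; apply: sint_le => //; [exact: lf.2|exact: loc_integrable_cst].
Qed.

Lemma e2_neq0_ends : [/\ e1 T = 0, e2 pi != 0 & e2 T != 0].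
Proof.
split; first by rewrite -(add0r T) (smooth_e1 wave).1 (e1_0 wave).
  by rewrite gt_eqF// (e2_trough c_gt0 wave) ?(e1_pi wave)// (eta_pi wave).
by rewrite -(add0r T) (smooth_e2 wave).1 (e2_0_neq0 c_gt0 wave).
Qed.

(** Correcting v by the negative plane so that it vanishes at crest and trough only
    lowers the form, and [dirichlet_estimate] applies to each half period.  The
    correction is possible because n takes opposite values at 0 and pi. *)
Lemma two_halves : exists2 K : R, 0 < K & forall v g, per v -> H1loc v g ->
  sint v 0 T = 0 -> sint (fun u => e2 u * v u) 0 T = 0 ->
  0 <= sint (fd v g) 0 T /\ exists B1 B2 : R,
    (forall u, 0 <= u <= pi -> (v u - B1 * e1 u) ^+ 2 <= K * sint (fd v g) 0 T) /\
    (forall u, pi <= u <= T -> (v u - B2 * e1 u) ^+ 2 <= K * sint (fd v g) 0 T).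
Proof.
have pi0 := pi_gt0 R; have T0 := twopi_gt0 R.
have piT : pi < T :> R by have /andP[] := pi_bounds R.
have [e1T e2pi e2T] := e2_neq0_ends.
have e20 := e2_0_neq0 c_gt0 wave.
have [M1 M10 hM1] := dirichlet_estimate c_gt0 wave pi0 (e1_0 wave) (e1_pi wave)
  e20 e2pi (e1_neq0 c_gt0 wave).
have [M2 M20 hM2] := dirichlet_estimate c_gt0 wave piT (e1_pi wave) e1T
  e2pi e2T (e1_neq0' c_gt0 wave).
have ccm := continuous_cmode c_gt0 wave.
have pcm := per_cmode c_gt0 wave.
have [Mc Mc0 hMc] := per_continuous_bounded pcm ccm.
have I0 := sint_cmode_lt0 c_gt0 wave.
set I := sint (cmode c eta) 0 T in I0.
pose K := 3 * (M1 + M2 + (T^-1 + Mc ^+ 2 / - I)).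
have K0 : 0 < K.
  rewrite /K mulr_gt0// !addr_gt0 ?invr_gt0//.
  by rewrite divr_gt0 ?exprn_gt0// oppr_gt0.
exists K => // v g pv hv v0 e2v.
have k0 := k_gt0 c_gt0 wave; have am0 := ampl_gt0 c_gt0 wave.
pose a := - (v 0 + v pi) / 2.
pose b := - (v 0 - v pi) / (2 * (ampl c eta * k)).
have bk : b * (ampl c eta * k) = - (v 0 - v pi) / 2.
  by rewrite /b; field; rewrite !gt_eqF.
pose w u := v u + (a + b * cmode c eta u).
pose g' u := g u + b * dcmode c eta u.
have hw : H1loc w g'.
  have h1 : H1loc (fun _ : R => a) (fun=> 0).
    by apply: C1_H1loc => x; exact: cvg_cst.
  have := H1locD hv (H1locD h1 (H1locZ b (H1loc_cmode c_gt0 wave))); congr H1loc.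
  by apply/funext => u; rewrite add0r.
have cm0 : cmode c eta 0 = ampl c eta * k by rewrite /cmode (e1_0 wave) mul0r addr0.
have cmpi : cmode c eta pi = - (ampl c eta * k).
  by rewrite /cmode (e1_pi wave) mul0r addr0 (eta_pi wave) mulrN.
have w0 : w 0 = 0 by rewrite /w cm0 bk /a; field.
have wpi : w pi = 0 by rewrite /w cmpi mulrN bk /a; field.
have wT : w T = 0 by rewrite -(add0r T) /w pv pcm -/(w 0).
have lw := loc_form_density wave hw.
have QE := form_shift c_gt0 wave a b pv hv v0 e2v.
rewrite -/w -/g' -(sint_chasles 0 pi T lw) -/I in QE.
have [B1 hB1] := hM1 w g' hw w0 wpi; have [B2 hB2] := hM2 w g' hw wpi wT.
move: QE hB1 hB2.
move: (sint (fd w g') 0 pi) (sint (fd w g') pi T) (sint (fd v g) 0 T) => Q1 Q2 Q QE hB1 hB2.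
have Q10 : 0 <= Q1.
  rewrite -(pmulr_rge0 _ M10); apply: le_trans (hB1 0 _); first exact: sqr_ge0.
  by rewrite lexx ltW.
have Q20 : 0 <= Q2.
  rewrite -(pmulr_rge0 _ M20); apply: le_trans (hB2 pi _); first exact: sqr_ge0.
  by rewrite lexx ltW.
have a2 : 0 <= 2 * pi * a ^+ 2 by rewrite mulr_ge0 ?sqr_ge0// ltW.
have b2 : 0 <= b ^+ 2 * - I by rewrite mulr_ge0 ?sqr_ge0// oppr_ge0 ltW.
have [Q1Q Q2Q aQ bQ] : [/\ Q1 <= Q, Q2 <= Q, 2 * pi * a ^+ 2 <= Q & b ^+ 2 * - I <= Q].
  by move: b2; rewrite mulrN; exact: four_parts_le.
have Q0 : 0 <= Q := le_trans Q10 Q1Q.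
have {}aQ : a ^+ 2 <= T^-1 * Q by rewrite mulrC ler_pdivlMr// mulrC.
have {}bQ : b ^+ 2 <= Q / - I by rewrite ler_pdivlMr// oppr_gt0.
have step (M Qi B : R) u : 0 < M -> M <= M1 + M2 -> 0 <= Qi -> Qi <= Q ->
    (w u - B * e1 u) ^+ 2 <= M * Qi -> (v u - B * e1 u) ^+ 2 <= K * Q.
  move=> M0 MM Qi0 QiQ h.
  have -> : v u - B * e1 u = (w u - B * e1 u) + - a + - (b * cmode c eta u).
    by rewrite /w; ring.
  apply: le_trans (sqr_sum3 _ _ _) _.
  have -> : K * Q = 3 * ((M1 + M2) * Q + T^-1 * Q + Q / - I * Mc ^+ 2) by rewrite /K; ring.
  rewrite ler_wpM2l// !sqrrN lerD//.
    rewrite lerD//; apply: (le_trans h); apply: ler_pM => //; exact: ltW.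
  rewrite exprMn; apply: ler_pM; rewrite ?sqr_ge0//.
  rewrite -(real_normK (num_real (cmode c eta u))).
  by rewrite lerXn2r ?nnegrE ?normr_ge0// ltW.
split=> //; exists B1, B2; split=> u hu.
  by apply: (step M1 Q1) => //; [rewrite lerDl ltW|exact: hB1].
by apply: (step M2 Q2) => //; [rewrite lerDr ltW|exact: hB2].
Qed.

(** With v close to B1 eta' on [0, pi] and to B2 eta' on [pi, 2 pi], the condition
    <1, v> = 0 controls B1 - B2, since int eta' has opposite signs on the two halves,
    and <eta', v> = 0 then controls B1.  This bounds v in L^2, and Q bounds v' up to
    a multiple of the L^2 norm of v. *)
Lemma coercive : exists2 C : R, 0 < C & forall v g, per v -> H1loc v g ->
  sint v 0 T = 0 -> sint (fun u => e2 u * v u) 0 T = 0 ->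
  sint (fun u => e1 u * v u) 0 T = 0 ->
  sint (fun u => v u ^+ 2) 0 T + sint (fun u => g u ^+ 2) 0 T <= C * sint (fd v g) 0 T.
Proof.
have [K K0 hK] := two_halves.
have pi0 := pi_gt0 R; have T0 := twopi_gt0 R.
have piT : pi <= T :> R by have /andP[_] := pi_bounds R => /ltW.
have k0 := k_gt0 c_gt0 wave.
have [M M0 hM] := per_continuous_bounded (smooth_e1 wave).1 ce1.
have [M' M'0 hM'] := per_continuous_bounded (smooth_e2 wave).1 ce2.
have ce1sq := continuous_e1sq wave.
pose N1 := sint (fun u => e1 u ^+ 2) 0 pi.
pose N2 := sint (fun u => e1 u ^+ 2) pi T.
pose N := sint (fun u => e1 u ^+ 2) 0 T.
have N0 : 0 < N := sint_e1sq_gt0 c_gt0 wave.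
have NE : N1 + N2 = N by exact: sint_chasles (cint ce1sq).
have N20 : 0 <= N2 by apply: sint_ge0 => // u _; exact: sqr_ge0.
(* successive bounds: for (B1 - B2)^2, B1^2 and v^2, in units of Q *)
pose Kd := pi ^+ 2 * K / k ^+ 2.
pose K1 := 3 * (2 * (pi ^+ 2 * (M ^+ 2 * K)) + Kd * N2 ^+ 2) / N ^+ 2.
pose Kv := 2 * (K + M ^+ 2 * (2 * (K1 + Kd))).
have Kd0 : 0 <= Kd by rewrite /Kd divr_ge0 ?mulr_ge0 ?sqr_ge0// ltW.
have MK0 : 0 <= M ^+ 2 * K by rewrite mulr_ge0 ?sqr_ge0// ltW.
have K10 : 0 <= K1.
  apply: divr_ge0; last exact: sqr_ge0.
  apply: mulr_ge0 => //; apply: addr_ge0; last by rewrite mulr_ge0 ?sqr_ge0.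
  by rewrite mulr_ge0// mulr_ge0 ?sqr_ge0.
have Kv0 : 0 <= Kv.
  rewrite /Kv mulr_ge0//; apply: addr_ge0; first exact: ltW.
  by rewrite mulr_ge0 ?sqr_ge0// mulr_ge0// addr_ge0.
pose W := 2 * M' + 1.
have W0 : 0 < W by rewrite /W ltr_wpDl// mulr_ge0// ltW.
have p00 := stiff0_gt0 c_gt0 wave.
exists (T * Kv + (1 + W * (T * Kv)) / p 0).
  have TK : 0 <= T * Kv by rewrite mulr_ge0// ltW.
  apply: ltr_wpDl => //; apply: divr_gt0 => //.
  by rewrite ltr_pwDl// mulr_ge0// ltW.
move=> v g pv hv v0 e2v e1v.
have [Q0 [B1 [B2 [hB1 hB2]]]] := hK v g pv hv v0 e2v.
set Q := sint (fd v g) 0 T in Q0 hB1 hB2 *.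
have cv := H1loc_continuous hv.
have cr B : continuous (fun u => v u - B * e1 u).
  by move=> u; apply: cvgB; [exact: cv|apply: cvgM; [exact: cvg_cst|exact: ce1]].
have ce1r B : continuous (fun u => e1 u * (v u - B * e1 u)).
  by move=> u; apply: cvgM; [exact: ce1|exact: cr].
have ce1v : continuous (fun u => e1 u * v u).
  by move=> u; apply: cvgM; [exact: ce1|exact: cv].
have M2 u : e1 u ^+ 2 <= M ^+ 2.
  rewrite -(real_normK (num_real (e1 u))) lerXn2r ?nnegrE ?normr_ge0//; exact: ltW.
have e1r B u : (v u - B * e1 u) ^+ 2 <= K * Q ->
    (e1 u * (v u - B * e1 u)) ^+ 2 <= M ^+ 2 * K * Q.
  by move=> h; rewrite exprMn -mulrA; apply: ler_pM; rewrite ?sqr_ge0.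
have R1 := sint_sqr_le (cr B1) (ltW pi0) hB1.
have R2 := sint_sqr_le (cr B2) piT hB2.
have T1 := sint_sqr_le (ce1r B1) (ltW pi0) (fun u hu => e1r _ u (hB1 u hu)).
have T2 := sint_sqr_le (ce1r B2) piT (fun u hu => e1r _ u (hB2 u hu)).
rewrite subr0 in R1 T1.
have Tpi : T - pi = pi :> R by ring.
rewrite Tpi in R2 T2.
set r1 := sint _ 0 pi in R1; set r2 := sint _ pi T in R2.
set t1 := sint _ 0 pi in T1; set t2 := sint _ pi T in T2.
have r1E : r1 = sint v 0 pi + 2 * k * B1.
  rewrite /r1 sintB ?sintZ//; try exact: cint; last exact/loc_integrableZ/cint.
  by rewrite (sint_derive 0 pi ce1 (d_eta wave)) (eta_pi wave); ring.
have r2E : r2 = sint v pi T - 2 * k * B2.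
  rewrite /r2 sintB ?sintZ//; try exact: cint; last exact/loc_integrableZ/cint.
  rewrite (sint_derive pi T ce1 (d_eta wave)) (eta_pi wave).
  by rewrite -(add0r T) (wave_smooth wave).1; ring.
have tE B x y : sint (fun u => e1 u * (v u - B * e1 u)) x y =
    sint (fun u => e1 u * v u) x y - B * sint (fun u => e1 u ^+ 2) x y.
  rewrite -sintZ; last exact: cint.
  rewrite -sintB; [|exact: cint|exact/loc_integrableZ/cint].
  by apply: eq_sint => u; ring.
have vE := sint_chasles 0 pi T (cint cv).
have e1vE := sint_chasles 0 pi T (cint ce1v).
pose d := B1 - B2.
have dE : d = (r1 + r2) / (2 * k).
  rewrite v0 in vE; rewrite r1E r2E /d.
  have -> : sint v pi T = - sint v 0 pi by apply/eqP; rewrite -addr_eq0 addrC; apply/eqP.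
  by field; rewrite gt_eqF.
have B1E : B1 = (- t1 + - t2 + d * N2) / N.
  have tt : t1 + t2 = - B1 * N1 - B2 * N2.
    by rewrite /t1 /t2 !tE -/N1 -/N2 addrACA e1vE e1v; ring.
  have -> : - t1 + - t2 = - (t1 + t2) by ring.
  by rewrite tt /d -NE; field; rewrite NE gt_eqF.
have d2 : d ^+ 2 <= Kd * Q.
  rewrite dE expr_div_n ler_pdivrMr ?exprn_gt0 ?mulr_gt0//.
  apply: le_trans (sqr_sum2 _ _) _.
  have -> : Kd * Q * (2 * k) ^+ 2 = 2 * (pi ^+ 2 * (K * Q) + pi ^+ 2 * (K * Q)).
    by rewrite /Kd; field; rewrite gt_eqF.
  by rewrite ler_wpM2l// lerD.
have B12 : B1 ^+ 2 <= K1 * Q.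
  rewrite B1E expr_div_n ler_pdivrMr ?exprn_gt0//.
  apply: le_trans (sqr_sum3 _ _ _) _.
  have -> : K1 * Q * N ^+ 2 = 3 * (pi ^+ 2 * (M ^+ 2 * K * Q) + pi ^+ 2 * (M ^+ 2 * K * Q)
     + Kd * Q * N2 ^+ 2).
    by rewrite /K1; field; rewrite gt_eqF.
  rewrite ler_wpM2l// !sqrrN lerD//; first exact: lerD.
  by rewrite exprMn ler_wpM2r ?sqr_ge0.
have B22 : B2 ^+ 2 <= 2 * (K1 + Kd) * Q.
  have -> : B2 = B1 + - d by rewrite /d; ring.
  apply: le_trans (sqr_sum2 _ _) _; rewrite sqrrN -mulrA ler_wpM2l// mulrDl.
  exact: lerD.
have B12' : B1 ^+ 2 <= 2 * (K1 + Kd) * Q.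
  apply: (le_trans B12); rewrite ler_wpM2r//.
  by rewrite mulrDr mulr_natl mulr2n -addrA lerDl addr_ge0// mulr_ge0.
have step B u : (v u - B * e1 u) ^+ 2 <= K * Q -> B ^+ 2 <= 2 * (K1 + Kd) * Q ->
    v u ^+ 2 <= Kv * Q.
  move=> h1 h2; have -> : v u = (v u - B * e1 u) + B * e1 u by ring.
  apply: le_trans (sqr_sum2 _ _) _; rewrite /Kv -mulrA ler_wpM2l// mulrDl lerD//.
  by rewrite exprMn mulrC -mulrA; apply: ler_pM; rewrite ?sqr_ge0.
have vQ u : 0 <= u <= T -> v u ^+ 2 <= Kv * Q.
  move=> /andP[u0 uT]; have [upi|/ltW piu] := leP u pi.
    by apply: (step B1) => //; apply: hB1; rewrite u0.
  by apply: (step B2) => //; apply: hB2; rewrite piu.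
have lv2 := (continuous_loc_sq cv).2.
have V : sint (fun u => v u ^+ 2) 0 T <= T * Kv * Q.
  have -> : T * Kv * Q = sint (fun=> Kv * Q) 0 T by rewrite sint_cst; ring.
  by apply: sint_le => //; [exact: loc_integrable_cst|exact: ltW].
have lg2 := hv.1.2.
have G : p 0 * sint (fun u => g u ^+ 2) 0 T <= Q + W * sint (fun u => v u ^+ 2) 0 T.
  rewrite -!sintZ// -sintD; [|exact: loc_form_density|exact: loc_integrableZ].
  apply: sint_le; [exact: loc_integrableZ| |exact: ltW|].
    by apply: loc_integrableD; [exact: loc_form_density|exact: loc_integrableZ].
  move=> u _; rewrite /form_density.
  have h1 : p 0 * g u ^+ 2 <= p u * g u ^+ 2.
    by rewrite ler_wpM2r ?sqr_ge0// (stiff_ge wave).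
  have h2 : 0 <= (2 * e2 u - 1 + W) * v u ^+ 2.
    rewrite mulr_ge0 ?sqr_ge0// /W.
    have := hM' u; rewrite ler_norml => /andP[+ _].
    exact: potential_lower.
  by move: h2; rewrite mulrDl -(lerD2l (p 0 * g u ^+ 2)) addr0 => /le_trans; apply;
    rewrite addrA lerD2r lerD2r.
have {}G : sint (fun u => g u ^+ 2) 0 T <= (1 + W * (T * Kv)) / p 0 * Q.
  rewrite mulrAC ler_pdivlMr// mulrC; apply: (le_trans G).
  have -> : (1 + W * (T * Kv)) * Q = Q + W * (T * Kv * Q) by ring.
  by rewrite lerD2l; apply: ler_wpM2l => //; exact: ltW.
by rewrite [leRHS]mulrDl; exact: lerD.
Qed.

End Coercive.

(** * The nonlocal operator *)

Section NonlocalTerm.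
Variables (R : realType) (c : R) (eta : R -> R).
Hypotheses (c_gt0 : 0 < c) (wave : single_lobe c eta).
Implicit Types (u x y a b : R) (f v w g n m l : R -> R).
Local Notation p := (stiff c eta).
Local Notation e1 := (derive1 eta).
Local Notation e2 := (derive1n 2 eta).
Local Notation T := (2 * pi).
Let ce1 := continuous_e1 wave.
Let ce2 := continuous_e2 wave.
Let T0 : 0 < T :> R := twopi_gt0 R.
Let cint f : continuous f -> loc_integrable f := @continuous_loc_integrable R f.

Definition weight u : R := 1 - 2 * e2 u.

Lemma continuous_weight : continuous weight.
Proof.
move=> u; apply: cvgB; first exact: cvg_cst.
by apply: cvgM; [exact: cvg_cst|exact: ce2].
Qed.

Lemma per_weight : per weight.
Proof. by move=> u; rewrite /weight (smooth_e2 wave).1. Qed.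

Definition wmean v : R := sint (fun u => weight u * v u) 0 T / T.

Definition dnonloc v u : R := (2 * c)^-1 * (weight u * v u - wmean v).

Definition nonloc_prim v : R -> R := sint (dnonloc v) 0.

(** The constants give B v the mean that makes the flux p v' + 2 c B v of zero mean;
    the linearized equation becomes 2 c h_t = p h_u + 2 c B h. *)
Definition nonloc v u : R :=
  nonloc_prim v u - sint (nonloc_prim v) 0 T / T -
  (2 * c)^-1 * (sint (fun u => 2 * e1 u * v u) 0 T / T).

Section ContinuousArgument.
Variable v : R -> R.
Hypothesis cv : continuous v.

Lemma continuous_weightM : continuous (fun u => weight u * v u).
Proof. by move=> u; apply: cvgM; [exact: continuous_weight|exact: cv]. Qed.

Lemma continuous_dnonloc : continuous (dnonloc v).
Proof.
move=> u; apply: cvgM; first exact: cvg_cst.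
by apply: cvgB; [exact: continuous_weightM|exact: cvg_cst].
Qed.

Lemma d_nonloc_prim u : is_derive u 1 (nonloc_prim v) (dnonloc v u).
Proof. exact: derive_sint continuous_dnonloc. Qed.

Lemma d_nonloc u : is_derive u 1 (nonloc v) (dnonloc v u).
Proof.
have := d_nonloc_prim u => d; rewrite /nonloc -[dnonloc v u]subr0 -[X in X - 0]subr0.
by apply: is_deriveB.
Qed.

Lemma continuous_nonloc : continuous (nonloc v).
Proof. exact: is_derive_continuous d_nonloc. Qed.

Lemma continuous_nonloc_prim : continuous (nonloc_prim v).
Proof. exact: is_derive_continuous d_nonloc_prim. Qed.

Lemma H1loc_nonloc : H1loc (nonloc v) (dnonloc v).
Proof. exact: C1_H1loc continuous_dnonloc d_nonloc. Qed.

Lemma sint_nonloc :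
  sint (nonloc v) 0 T = - (2 * c)^-1 * sint (fun u => 2 * e1 u * v u) 0 T.
Proof.
have cT (d : R) : loc_integrable (fun _ => d) := loc_integrable_cst d.
have lp := cint continuous_nonloc_prim.
rewrite sintB; [|exact: loc_integrableB|exact: cT].
rewrite sintB// !sint_cst subr0.
have TN : T != 0 :> R by rewrite gt_eqF.
by rewrite divfK// -mulrA divfK// subrr sub0r mulNr.
Qed.

Hypothesis pv : per v.

Lemma per_dnonloc : per (dnonloc v).
Proof. by move=> u; rewrite /dnonloc per_weight pv. Qed.

Lemma sint_dnonloc : sint (dnonloc v) 0 T = 0.
Proof.
rewrite sintZ; last by apply: loc_integrableB; [exact: cint continuous_weightM|exact: loc_integrable_cst].
rewrite sintB; [|exact: cint continuous_weightM|exact: loc_integrable_cst].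
by rewrite sint_cst subr0 /wmean divfK ?subrr ?mulr0// gt_eqF.
Qed.

Lemma per_nonloc : per (nonloc v).
Proof.
move=> u; rewrite /nonloc; congr (_ - _ - _).
exact: per_primitive per_dnonloc (cint continuous_dnonloc) sint_dnonloc u.
Qed.

End ContinuousArgument.

Lemma nonlocD v w : continuous v -> continuous w ->
  nonloc (fun u => v u + w u) = (fun u => nonloc v u + nonloc w u).
Proof.
move=> cv cw.
have wm : wmean (fun u => v u + w u) = wmean v + wmean w.
  rewrite /wmean -mulrDl -sintD; [|exact: cint (continuous_weightM _)..].
  by congr (_ / _); apply: eq_sint => u; ring.
have dn : dnonloc (fun u => v u + w u) =1 (fun u => dnonloc v u + dnonloc w u).
  by move=> u; rewrite /dnonloc wm; ring.
have pn : nonloc_prim (fun u => v u + w u) =1 (fun u => nonloc_prim v u + nonloc_prim w u).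
  move=> u; rewrite /nonloc_prim -sintD; [|exact: cint (continuous_dnonloc _)..].
  exact: eq_sint.
apply/funext => u; rewrite /nonloc pn (eq_sint _ _ pn).
rewrite sintD; [|exact: cint (continuous_nonloc_prim _)..].
rewrite (eq_sint (f := fun u => 2 * e1 u * (v u + w u))
  (g := fun u => 2 * e1 u * v u + 2 * e1 u * w u)); last by move=> x; ring.
rewrite sintD; first by ring.
  by apply: cint => x; apply: cvgM; [apply: cvgM; [exact: cvg_cst|exact: ce1]|exact: cv].
by apply: cint => x; apply: cvgM; [apply: cvgM; [exact: cvg_cst|exact: ce1]|exact: cw].
Qed.

(** The bound by the L^1 norm serves both the iteration, in the uniform norm, and
    the energy estimate, in L^2. *)
Lemma nonloc_bound : exists2 M : R, 0 < M & forall v, per v -> continuous v ->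
  forall u, `|dnonloc v u| <= M * (`|v u| + sint (fun x => `|v x|) 0 T) /\
            `|nonloc v u| <= M * sint (fun x => `|v x|) 0 T.
Proof.
have [E E0 hE] := per_continuous_bounded per_weight continuous_weight.
have [F F0 hF] := per_continuous_bounded (smooth_e1 wave).1 ce1.
pose M1 := (2 * c)^-1 * (E + E / T).
have c0 : 0 < (2 * c)^-1 by rewrite invr_gt0 mulr_gt0.
have M10 : 0 < M1 by rewrite /M1 mulr_gt0// addr_gt0// divr_gt0.
pose M2 := M1 * (1 + T); pose M := M1 + 2 * M2 + (2 * c)^-1 * (2 * F / T).
have M20 : 0 < M2 by rewrite mulr_gt0// addr_gt0.
have P3 : 0 < (2 * c)^-1 * (2 * F / T) by rewrite mulr_gt0// divr_gt0// mulr_gt0.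
have M0 : 0 < M by rewrite /M !addr_gt0// mulr_gt0.
exists M => // v pv cv.
have lv := loc_integrable_norm (cint cv).
set S := sint (fun x => `|v x|) 0 T.
have S0 : 0 <= S by apply: sint_ge0 => //; exact: ltW.
have absint f (K : R) : continuous f -> (forall u, `|f u| <= K * `|v u|) -> `|sint f 0 T| <= K * S.
  move=> cf fK; apply: le_trans (sint_abs (cint cf) (ltW T0)) _.
  rewrite /S -sintZ//; apply: sint_le => //; [exact/loc_integrable_norm/cint|exact: loc_integrableZ|exact: ltW].
have wm : `|wmean v| <= E / T * S.
  rewrite /wmean normrM (gtr0_norm (x := T^-1)) ?invr_gt0// mulrAC ler_pM2r ?invr_gt0//.
  by apply: absint => [|u]; [exact: continuous_weightM|rewrite normrM ler_wpM2r].
have dn u : `|dnonloc v u| <= M1 * (`|v u| + S).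
  rewrite /dnonloc normrM gtr0_norm// /M1 -mulrA ler_pM2l//.
  apply: (le_trans (ler_normB _ _)).
  have h1 : `|weight u * v u| <= E * `|v u| by rewrite normrM ler_wpM2r.
  have h2 : 0 <= E * S by rewrite mulr_ge0// ltW.
  have h3 : 0 <= E / T * `|v u| by apply: mulr_ge0 => //; apply: divr_ge0; exact: ltW.
  have -> : (E + E / T) * (`|v u| + S) = E * `|v u| + E / T * S + (E * S + E / T * `|v u|) by ring.
  by rewrite ler_wpDr ?addr_ge0// lerD.
have cdn := continuous_dnonloc cv.
have pn u : `|nonloc_prim v u| <= M2 * S.
  have pp : per (nonloc_prim v).
    exact: per_primitive (per_dnonloc pv) (cint cdn) (sint_dnonloc cv).
  have [x /andP[x0 xT] ->//] := per_reduce u.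
  apply: le_trans (sint_abs (cint cdn) x0) _.
  have ld := loc_integrable_norm (cint cdn).
  apply: (@le_trans _ _ (sint (fun u => `|dnonloc v u|) 0 T)).
    rewrite -(sint_chasles 0 x T ld) lerDl; exact: sint_ge0.
  have -> : M2 * S = sint (fun u => M1 * (`|v u| + S)) 0 T.
    rewrite sintZ; last by apply: loc_integrableD => //; exact: loc_integrable_cst.
    rewrite sintD//; last exact: loc_integrable_cst.
    by rewrite sint_cst /M2 -/S; ring.
  apply: sint_le => //; last exact: ltW.
  by apply: loc_integrableZ; apply: loc_integrableD => //; exact: loc_integrable_cst.
move=> u; split.
  apply: (le_trans (dn u)); rewrite ler_wpM2r ?addr_ge0//.
  rewrite /M -addrA lerDl; apply: addr_ge0; last exact: ltW.
  by apply: mulr_ge0 => //; exact: ltW.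
have cpn := continuous_nonloc_prim cv.
have h1 : `|sint (nonloc_prim v) 0 T / T| <= M2 * S.
  rewrite normrM (gtr0_norm (x := T^-1)) ?invr_gt0// ler_pdivrMr//.
  have := @sint_bound R (nonloc_prim v) 0 T (M2 * S) (cint cpn) (fun u _ => pn u).
  by rewrite subr0 (gtr0_norm T0).
have h2 : `|sint (fun u => 2 * e1 u * v u) 0 T / T| <= 2 * F / T * S.
  rewrite normrM (gtr0_norm (x := T^-1)) ?invr_gt0// mulrAC ler_pM2r ?invr_gt0//.
  apply: absint => [x|x].
    by apply: cvgM; [apply: cvgM; [exact: cvg_cst|exact: ce1]|exact: cv].
  by rewrite normrM ler_wpM2r// normrM ger0_norm// ler_wpM2l.
rewrite /nonloc; apply: (le_trans (ler_normB _ _)).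
have h3 : `|(2 * c)^-1 * (sint (fun u => 2 * e1 u * v u) 0 T / T)| <=
    (2 * c)^-1 * (2 * F / T) * S.
  by rewrite normrM gtr0_norm// -mulrA ler_pM2l.
have -> : M * S = M2 * S + M2 * S + (2 * c)^-1 * (2 * F / T) * S + M1 * S by rewrite /M; ring.
apply: ler_wpDr; first by apply: mulr_ge0 => //; exact: ltW.
apply: lerD => //.
by apply: (le_trans (ler_normB _ _)); rewrite lerD.
Qed.

End NonlocalTerm.

(** * Functions uniformly continuous on strips *)

Section StripUniformContinuity.
Variable R : realType.
Implicit Types (t s u x y a b e d L S tau : R) (f v : R -> R) (K H : R -> R -> R).

(** Stability under sums, products, time integrals, Lipschitz changes of variables
    and locally uniform limits makes this class suited to an iteration in which the
    point of evaluation moves with t. *)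
Definition strip_uc K : Prop :=
  (forall tau, exists S : R, forall t y, `|t| <= tau -> `|K t y| <= S) /\
  forall tau e, 0 < e -> exists2 d : R, 0 < d & forall t s x y,
    `|t| <= tau -> `|s| <= tau -> `|t - s| < d -> `|x - y| < d ->
    `|K t x - K s y| < e.

Lemma strip_uc_continuous K t : strip_uc K -> continuous (K t).
Proof.
move=> [_ uc]; apply/continuousP_ed => x e e0.
have [d d0 hd] := uc `|t| e e0; exists d => // y yx.
by apply: hd => //; rewrite subrr normr0.
Qed.

Lemma strip_uc_continuous_time K y : strip_uc K -> continuous (fun t => K t y).
Proof.
move=> [_ uc]; apply/continuousP_ed => t e e0.
have [d d0 hd] := uc (`|t| + 1) e e0; exists (Num.min d 1); first by rewrite lt_min d0 /=.
move=> s; rewrite lt_min => /andP[sd s1].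
apply: hd => //; last by rewrite subrr normr0.
  by rewrite -(subrK t s) (le_trans (ler_normD _ _))// addrC lerD2l ltW.
by rewrite lerDl.
Qed.

Lemma strip_ucD K H : strip_uc K -> strip_uc H -> strip_uc (fun t y => K t y + H t y).
Proof.
move=> [bK uK] [bH uH]; split=> [tau|tau e e0].
  have [S1 h1] := bK tau; have [S2 h2] := bH tau; exists (S1 + S2) => t y tt.
  by rewrite (le_trans (ler_normD _ _))// lerD ?h1 ?h2.
have e2 : 0 < e / 2 by rewrite divr_gt0.
have [d1 d10 h1] := uK tau _ e2; have [d2 d20 h2] := uH tau _ e2.
exists (Num.min d1 d2); first by rewrite lt_min d10.
move=> t s x y tt ss; rewrite !lt_min => /andP[t1 t2] /andP[x1 x2].
have -> : K t x + H t x - (K s y + H s y) = (K t x - K s y) + (H t x - H s y) by ring.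
have := h1 _ _ _ _ tt ss t1 x1; have := h2 _ _ _ _ tt ss t2 x2.
by have := ler_normD (K t x - K s y) (H t x - H s y); lra.
Qed.

Lemma strip_ucM K H : strip_uc K -> strip_uc H -> strip_uc (fun t y => K t y * H t y).
Proof.
move=> [bK uK] [bH uH]; split=> [tau|tau e e0].
  have [S1 h1] := bK tau; have [S2 h2] := bH tau; exists (S1 * S2) => t y tt.
  by rewrite normrM ler_pM ?h1 ?h2.
have [S1 h1] := bK tau; have [S2 h2] := bH tau.
pose S := `|S1| + `|S2| + 1.
have S0 : 0 < S by rewrite /S ltr_wpDl// addr_ge0.
have eS : 0 < e / (2 * S) by rewrite divr_gt0// mulr_gt0.
have [d1 d10 k1] := uK tau _ eS; have [d2 d20 k2] := uH tau _ eS.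
exists (Num.min d1 d2); first by rewrite lt_min d10.
move=> t s x y tt ss; rewrite !lt_min => /andP[t1 t2] /andP[x1 x2].
have -> : K t x * H t x - K s y * H s y = (K t x - K s y) * H t x + K s y * (H t x - H s y) by ring.
have {}k1 := k1 _ _ _ _ tt ss t1 x1; have {}k2 := k2 _ _ _ _ tt ss t2 x2.
have b1 : `|K s y| <= `|S1| by rewrite (le_trans (h1 _ _ ss))// ler_norm.
have b2 : `|H t x| <= `|S2| by rewrite (le_trans (h2 _ _ tt))// ler_norm.
apply: (le_lt_trans (ler_normD _ _)); rewrite !normrM.
apply: (@le_lt_trans _ _ (e / (2 * S) * `|S2| + `|S1| * (e / (2 * S)))).
  by apply: lerD; apply: ler_pM => //; exact: ltW.
rewrite mulrC -mulrDl -ltr_pdivlMr ?divr_gt0// ?mulr_gt0//.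
rewrite invf_div mulrA mulrAC divff ?mul1r ?gt_eqF//.
by rewrite mulr_natl mulr2n /S; have := normr_ge0 S1; have := normr_ge0 S2; lra.
Qed.

Lemma strip_uc_cst_time f : (exists S, forall y, `|f y| <= S) ->
  (forall e, 0 < e -> exists2 d : R, 0 < d & forall x y, `|x - y| < d -> `|f x - f y| < e) ->
  strip_uc (fun _ y => f y).
Proof.
move=> [S bf] uf; split=> [tau|tau e e0]; first by exists S.
by have [d d0 h] := uf e e0; exists d => // t s x y _ _ _; exact: h.
Qed.

Lemma per_H1_uc v g : per v -> per g -> H1loc v g -> strip_uc (fun _ y => v y).
Proof.
move=> pv pg hv; apply: strip_uc_cst_time.
  by have [S _ hS] := per_continuous_bounded pv (H1loc_continuous hv); exists S.
move=> e e0; have T0 := twopi_gt0 R.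
set A := sint (fun u => g u ^+ 2) 0 (2 * pi).
have A0 : 0 <= A by apply: sint_ge0 => [|u _]; [exact: ltW|exact: sqr_ge0].
exists (Num.min (2 * pi) (e ^+ 2 / (A + 1))).
  by rewrite lt_min T0 divr_gt0 ?exprn_gt0// ltr_wpDl.
move=> x y; rewrite lt_min => /andP[xT xe].
have := per_holder (a := y) (b := x) pg hv (ltW xT); rewrite -/A => h.
rewrite -(@ltr_pXn2r _ 2)// ?nnegrE ?normr_ge0 ?(ltW e0)//.
rewrite real_normK ?num_real//; apply: (le_lt_trans h).
move: xe; rewrite ltr_pdivlMr ?ltr_wpDl// => xe; apply: le_lt_trans xe.
by rewrite ler_wpM2l// lerDl.
Qed.

Lemma strip_uc_comp K (phi : R -> R -> R) L : strip_uc K -> 0 < L ->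
  (forall t s x y, `|phi t x - phi s y| <= L * (`|t - s| + `|x - y|)) ->
  strip_uc (fun t y => K t (phi t y)).
Proof.
move=> [bK uK] L0 hphi; split=> [tau|tau e e0].
  by have [S h] := bK tau; exists S => t y; exact: h.
have [d d0 h] := uK tau e e0; exists (Num.min d (d / (2 * L))).
  by rewrite lt_min d0 divr_gt0// mulr_gt0.
move=> t s x y tt ss; rewrite !lt_min => /andP[t1 t2] /andP[x1 x2].
apply: h => //; apply: le_lt_trans (hphi _ _ _ _) _.
move: t2 x2; rewrite !ltr_pdivlMr ?mulr_gt0// => t2 x2; lra.
Qed.

Lemma sint_le_bound f a b S : continuous f -> `|a| <= `|b| ->
  (forall s, `|s| <= `|b| -> `|f s| <= S) -> `|sint f a b| <= S * `|b - a|.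
Proof.
move=> cf ab h; apply: sint_bound; first exact: continuous_loc_integrable.
move=> u /andP[u1 u2]; apply: h; move: ab; rewrite !ler_norml => /andP[h1 h2].
have : - `|b| <= Num.min a b by rewrite le_min h1 lerNl -normrN ler_norm.
have : Num.max a b <= `|b| by rewrite ge_max h2 ler_norm.
by move=> *; apply/andP; split; lra.
Qed.

Lemma strip_uc_int K : strip_uc K ->
  strip_uc (fun t y => sint (fun s => K s y) 0 t).
Proof.
move=> uK; have [bK uc] := uK.
have cK y : continuous (fun t => K t y) := @strip_uc_continuous_time K y uK.
have lK y := continuous_loc_integrable (cK y).
split=> [tau|tau e e0].
  have [S hS] := bK tau; exists (`|S| * `|tau|) => t y tt.
  have := @sint_le_bound (fun s => K s y) 0 t `|S| (cK y).
  rewrite normr0 normr_ge0 subr0 => /(_ isT) h.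
  apply: (@le_trans _ _ (`|S| * `|t|)).
    apply: h => s st; apply: (le_trans (hS _ _ _)); last exact: ler_norm.
    exact: le_trans tt.
  by rewrite ler_wpM2l// (le_trans tt)// ler_norm.
have [S hS] := bK tau.
pose D := `|S| + `|tau| + 1.
have D0 : 0 < D by rewrite /D ltr_wpDl// addr_ge0.
have eD : 0 < e / (2 * D) by rewrite divr_gt0// mulr_gt0.
have [d d0 hd] := uc tau _ eD.
exists (Num.min d (e / (2 * D))); first by rewrite lt_min d0.
move=> t s x y tt ss; rewrite !lt_min => /andP[t1 t2] /andP[x1 x2].
have tau0 : 0 <= tau := le_trans (normr_ge0 _) tt.
have -> : sint (fun s => K s x) 0 t - sint (fun s => K s y) 0 s =
    sint (fun s => K s x - K s y) 0 t + sint (fun s => K s y) s t.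
  by rewrite sintB// -(sint_diff 0 s t (lK y)); ring.
have A1 : `|sint (fun s => K s x - K s y) 0 t| <= e / (2 * D) * `|t|.
  rewrite -{2}(subr0 t); apply: sint_le_bound; last 1 first.
  - move=> r rt; apply: ltW; apply: hd; rewrite ?subrr ?normr0//; exact: le_trans tt.
  - by move=> r; apply: cvgB; exact: cK.
  - by rewrite normr0.
have A2 : `|sint (fun s => K s y) s t| <= `|S| * `|t - s|.
  apply: sint_bound => // u /andP[u1 u2].
  apply: (le_trans (hS _ _ _)); last exact: ler_norm.
  move: tt ss; rewrite !ler_norml => /andP[a1 a2] /andP[b1 b2].
  have : - tau <= Num.min s t by rewrite le_min b1.
  have : Num.max s t <= tau by rewrite ge_max b2.
  by move=> *; apply/andP; split; lra.
apply: (le_lt_trans (ler_normD _ _)).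
have q0 := ltW eD.
apply: (@le_lt_trans _ _ (e / (2 * D) * (`|tau| + `|S|))).
  rewrite mulrDr; apply: lerD.
    by apply: (le_trans A1); rewrite ler_wpM2l// (le_trans tt)// ler_norm.
  by apply: (le_trans A2); rewrite mulrC ler_wpM2r// ltW.
have De : e / (2 * D) * (2 * D) = e by rewrite divfK// gt_eqF// mulr_gt0.
rewrite -[ltRHS]De ltr_pM2l// /D.
have := normr_ge0 S; have := normr_ge0 tau; lra.
Qed.

Lemma strip_uc_lim (P : nat -> R -> R -> R) H : (forall n, strip_uc (P n)) ->
  (forall tau e, 0 < e -> exists n, forall t y, `|t| <= tau -> `|H t y - P n t y| <= e) ->
  strip_uc H.
Proof.
move=> uP hP; split=> [tau|tau e e0].
  have [n hn] := hP tau 1 ltr01; have [S hS] := (uP n).1 tau; exists (1 + S) => t y tt.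
  rewrite -(subrK (P n t y) (H t y)) (le_trans (ler_normD _ _))// lerD ?hn ?hS//.
have e3 : 0 < e / 3 by rewrite divr_gt0.
have [n hn] := hP tau _ e3; have [d d0 hd] := (uP n).2 tau _ e3; exists d => //.
move=> t s x y tt ss ts xy.
have -> : H t x - H s y = (H t x - P n t x) + (P n t x - P n s y) + - (H s y - P n s y) by ring.
have h1 := hn t x tt; have h2 := hn s y ss; have h3 := hd _ _ _ _ tt ss ts xy.
apply: (le_lt_trans (ler_normD _ _)); rewrite normrN.
have := ler_normD (H t x - P n t x) (P n t x - P n s y); lra.
Qed.

End StripUniformContinuity.

(** * Picard iteration *)

Section Picard.
Variable R : realType.
Implicit Types (t s x y a b e d S tau : R) (f v w : R -> R) (K H : R -> R -> R).
Variables (N : R -> (R -> R) -> R -> R) (M : R).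
Hypothesis M0 : 0 < M.
Hypothesis ND : forall t v w, continuous v -> continuous w ->
  N t (fun x => v x + w x) = fun y => N t v y + N t w y.
Hypothesis Nbound : forall t v S, per v -> continuous v ->
  (forall x, `|v x| <= S) -> forall y, `|N t v y| <= M * S.
Hypothesis Nuc : forall H, strip_uc H -> (forall t, per (H t)) ->
  strip_uc (fun t => N t (H t)) /\ forall t, per (N t (H t)).
Variables (h0 : R -> R) (S0 : R).
Hypothesis h0_uc : strip_uc (fun _ => h0).
Hypothesis h0_per : per h0.
Hypothesis h0_bound : forall y, `|h0 y| <= S0.

Fixpoint picard_term n : R -> R -> R :=
  if n is n'.+1 then fun t y => sint (fun s => N s (picard_term n' s) y) 0 t
  else fun _ => h0.

Lemma picard_term_uc n : strip_uc (picard_term n) /\ forall t, per (picard_term n t).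
Proof.
elim: n => [|n [uH pH]]; first by split.
have [uN pN] := Nuc uH pH; split; first exact: strip_uc_int.
by move=> t y /=; apply: eq_sint => s; rewrite pN.
Qed.

(** A smooth majorant of exp (2 M |t|), whose primitive is explicit.  With it each
    integration in time of the iteration gains the factor 1/2 on the whole line, so
    that no step by step continuation of the solution is required. *)
Definition growth t : R := expR (2 * M * t) + expR (- (2 * M * t)).

Lemma growth_ge1 t : 1 <= growth t.
Proof.
rewrite /growth; have [t0|/ltW t0] := leP 0 t.
  rewrite ler_wpDr ?expR_ge0// -expR0 ler_expR !mulr_ge0// ltW//.
rewrite ler_wpDl ?expR_ge0// -expR0 ler_expR oppr_ge0 mulr_ge0_le0// mulr_ge0// ltW//.
Qed.

Lemma growth_ge0 t : 0 <= growth t.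
Proof. by rewrite addr_ge0// expR_ge0. Qed.

Definition dgrowth t : R := (2 * M)^-1 * (expR (2 * M * t) - expR (- (2 * M * t))).

Lemma d_dgrowth t : is_derive t 1 dgrowth (growth t).
Proof.
rewrite /dgrowth /growth; apply: is_derive_eq; rewrite /GRing.scale/=.
by field; rewrite gt_eqF.
Qed.

Lemma continuous_growth : continuous growth.
Proof.
have dg t : is_derive t 1 growth (2 * M * (expR (2 * M * t) - expR (- (2 * M * t)))).
  rewrite /growth; apply: is_derive_eq; rewrite /GRing.scale/=; by ring.
exact: is_derive_continuous dg.
Qed.

Lemma dgrowth_le t : `|dgrowth t| <= (2 * M)^-1 * growth t.
Proof.
have M2 : 0 < (2 * M)^-1 by rewrite invr_gt0 mulr_gt0.
rewrite /dgrowth normrM gtr0_norm// ler_pM2l// (le_trans (ler_normB _ _))//.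
by rewrite !ger0_norm ?expR_ge0.
Qed.

Lemma growth_mono t tau : `|t| <= tau -> growth t <= growth tau + growth tau.
Proof.
move=> tt; have M2 : 0 < 2 * M by rewrite mulr_gt0.
have h s : `|s| <= tau -> expR (2 * M * s) <= growth tau.
  move=> st; rewrite /growth ler_wpDr ?expR_ge0// ler_expR ler_pM2l//.
  exact: le_trans (ler_norm _) st.
rewrite {1}/growth; apply: lerD; first exact: h.
by rewrite -mulrN; apply: h; rewrite normrN.
Qed.

(** The integral of [growth] over [0, t] is at most 1 / (2 M) times [growth], which
    absorbs the norm M of the operator. *)
Lemma picard_term_le n t y : `|picard_term n t y| <= S0 * 2^-1 ^+ n * growth t.
Proof.
have S00 : 0 <= S0 := le_trans (normr_ge0 _) (h0_bound 0).
elim: n t y => [|n IH] t y /=.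
  rewrite expr0 mulr1; apply: (le_trans (h0_bound y)).
  by rewrite ler_peMr// growth_ge1.
have [uH pH] := picard_term_uc n; have [uN pN] := Nuc uH pH.
have cN := @strip_uc_continuous_time _ _ y uN.
have lN := continuous_loc_integrable cN.
set C := S0 * 2^-1 ^+ n; have C0 : 0 <= C by rewrite mulr_ge0// exprn_ge0.
have Nle s : `|N s (picard_term n s) y| <= M * C * growth s.
  rewrite -mulrA; apply: Nbound => //; exact: strip_uc_continuous.
have lg : loc_integrable (fun s => M * C * growth s).
  by apply/loc_integrableZ/continuous_loc_integrable/continuous_growth.
have d0 : dgrowth 0 = 0 by rewrite /dgrowth !mulr0 oppr0 subrr mulr0.
have IE a b : sint (fun s => M * C * growth s) a b = M * C * (dgrowth b - dgrowth a).
  rewrite sintZ; last exact/continuous_loc_integrable/continuous_growth.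
  by rewrite (sint_derive _ _ continuous_growth d_dgrowth).
apply: (@le_trans _ _ (M * C * `|dgrowth t|)); last first.
  have -> : S0 * 2^-1 ^+ n.+1 * growth t = M * C * ((2 * M)^-1 * growth t).
    by rewrite exprS /C; field; rewrite gt_eqF.
  by rewrite ler_wpM2l ?dgrowth_le// mulr_ge0// ltW.
have MC : 0 <= M * C by rewrite mulr_ge0// ltW.
have ls := loc_integrable_norm lN.
have [t0|/ltW t0] := leP 0 t.
  apply: (le_trans (sint_abs lN t0)); apply: (@le_trans _ _ (M * C * (dgrowth t - dgrowth 0))).
    by rewrite -IE; exact: sint_le.
  by rewrite d0 subr0 ler_wpM2l// ler_norm.
rewrite sint_sym normrN; apply: (le_trans (sint_abs lN t0)).
apply: (@le_trans _ _ (M * C * (dgrowth 0 - dgrowth t))); first by rewrite -IE; exact: sint_le.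
by rewrite d0 sub0r ler_wpM2l// -normrN ler_norm.
Qed.

Definition picard_sum n t y : R := \sum_(i < n) picard_term i t y.

Lemma picard_sumS n t y : picard_sum n.+1 t y = picard_sum n t y + picard_term n t y.
Proof. by rewrite /picard_sum big_ord_recr. Qed.

Lemma picard_sum_uc n : strip_uc (picard_sum n) /\ forall t, per (picard_sum n t).
Proof.
elim: n => [|n [uP pP]].
  split=> [|t y]; last by rewrite /picard_sum !big_ord0.
  split=> [tau|tau e e0]; first by exists 0 => t y _; rewrite /picard_sum big_ord0 normr0.
  by exists 1 => // t s x y _ _ _ _; rewrite /picard_sum !big_ord0 subrr normr0.
have [uH pH] := picard_term_uc n; split.
  by have := strip_ucD uP uH; congr strip_uc; apply/funext => t; apply/funext => y;
    rewrite picard_sumS.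
by move=> t y; rewrite !picard_sumS pP pH.
Qed.

Lemma picard_sum_rec n t y :
  picard_sum n.+1 t y = h0 y + sint (fun s => N s (picard_sum n s) y) 0 t.
Proof.
elim: n t y => [|n IH] t y.
  rewrite picard_sumS /picard_sum big_ord0 add0r /= -[LHS]addr0; congr (_ + _).
  apply/esym; rewrite (eq_sint (g := fun=> 0)) ?sint_cst ?mul0r// => s.
  have Z : (fun x => \sum_(i < 0) picard_term i s x) = fun=> 0.
    by apply/funext => x; rewrite big_ord0.
  have p0 : per (fun _ : R => 0 : R) by [].
  have c0 : continuous (fun _ : R => 0 : R) by move=> x; exact: cvg_cst.
  apply/eqP; rewrite -normr_le0 -[leRHS](mulr0 M) Z.
  by apply: Nbound => // x; rewrite normr0.
have [uP pP] := picard_sum_uc n; have [uH pH] := picard_term_uc n.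
have [uNP _] := Nuc uP pP; have [uNH _] := Nuc uH pH.
rewrite picard_sumS IH -addrA; congr (_ + _) => /=.
rewrite -sintD; last 2 first.
- exact/continuous_loc_integrable/(strip_uc_continuous_time (y := y) uNP).
- exact/continuous_loc_integrable/(strip_uc_continuous_time (y := y) uNH).
apply: eq_sint => s.
have -> : picard_sum n.+1 s = fun x => picard_sum n s x + picard_term n s x.
  by apply/funext => x; rewrite picard_sumS.
by rewrite ND//; exact: strip_uc_continuous.
Qed.

Lemma picard_cauchy n m t y :
  `|picard_sum (n + m) t y - picard_sum n t y| <= 2 * S0 * 2^-1 ^+ n * growth t.
Proof.
have S00 : 0 <= S0 := le_trans (normr_ge0 _) (h0_bound 0).
suff h : `|picard_sum (n + m) t y - picard_sum n t y| <=
    2 * S0 * 2^-1 ^+ n * growth t - 2 * S0 * 2^-1 ^+ (n + m) * growth t.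
  apply: (le_trans h); rewrite gerBl !mulr_ge0 ?growth_ge0 ?exprn_ge0//.
elim: m => [|m IH]; first by rewrite addn0 !subrr normr0.
rewrite addnS picard_sumS.
have -> : picard_sum (n + m) t y + picard_term (n + m) t y - picard_sum n t y =
  (picard_sum (n + m) t y - picard_sum n t y) + picard_term (n + m) t y by ring.
apply: (le_trans (ler_normD _ _)).
apply: (le_trans (lerD IH (picard_term_le _ _ _))).
rewrite exprS; move: (2^-1 ^+ n) (2^-1 ^+ (n + m)) (growth t) => p q r.
by rewrite le_eqVlt; apply/orP; left; apply/eqP; field.
Qed.

Theorem picard : exists H, [/\ strip_uc H, forall t, per (H t) &
  forall t y, H t y = h0 y + sint (fun s => N s (H s) y) 0 t].
Proof.
have S00 : 0 <= S0 := le_trans (normr_ge0 _) (h0_bound 0).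
have cvgP t y : cvgn (fun n => picard_sum n t y).
  rewrite (_ : (fun n => _) = series (fun i => picard_term i t y)); last first.
    by apply/funext => n; rewrite /picard_sum /series/= big_mkord.
  apply: normed_cvg.
  apply: (@series_le_cvg _ _ (geometric (S0 * growth t) 2^-1)) => [n|n|n|].
  - exact: normr_ge0.
  - by rewrite /= !mulr_ge0 ?growth_ge0 ?exprn_ge0.
  - by apply: (le_trans (picard_term_le n t y)); rewrite /= mulrAC.
  - by apply: is_cvg_geometric_series; rewrite ger0_norm// invf_lt1 ?ltr1n.
pose H t y := limn (fun n => picard_sum n t y).
have HP n t y : `|H t y - picard_sum n t y| <= 2 * S0 * 2^-1 ^+ n * growth t.
  apply/ler_addgt0Pr => e e0.
  have /cvgrPdist_lt /(_ e e0) [m _ hm] := cvgP t y.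
  have := hm (n + m)%N (leq_addl _ _); rewrite -/(H t y) => h1.
  have h2 := picard_cauchy n m t y.
  rewrite -(subrK (picard_sum (n + m) t y) (H t y)) -addrA.
  apply: (le_trans (ler_normD _ _)); rewrite [leRHS]addrC; apply: lerD; [exact: ltW|exact: h2].
have small tau e : 0 < e -> exists n, forall t m, `|t| <= tau -> (n <= m)%N ->
    2 * S0 * 2^-1 ^+ m * growth t <= e.
  move=> e0; pose G := 2 * S0 * (growth tau + growth tau).
  have G0 : 0 <= G by rewrite !mulr_ge0// addr_ge0// growth_ge0.
  have c0 : (2^-1 : R) ^+ n @[n --> \oo] --> 0.
    by apply: cvg_expr; rewrite ger0_norm// invf_lt1 ?ltr1n.
  have eG : 0 < e / (G + 1) by rewrite divr_gt0// ltr_wpDl.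
  move/cvgrPdist_lt: c0 => /(_ _ eG) [n _ hn]; exists n => t m tt nm.
  have := hn m nm; rewrite sub0r normrN ger0_norm ?exprn_ge0// ltr_pdivlMr ?ltr_wpDl// => h.
  apply: (@le_trans _ _ (2^-1 ^+ m * G)).
    rewrite mulrAC [leRHS]mulrC; apply: ler_wpM2r; first by rewrite exprn_ge0.
    by rewrite ler_wpM2l ?mulr_ge0// growth_mono.
  by apply: le_trans (ltW h); rewrite ler_wpM2l ?exprn_ge0// lerDl.
have uH : strip_uc H.
  apply: (@strip_uc_lim _ picard_sum) => [n|tau e e0]; first exact: (picard_sum_uc n).1.
  have [n hn] := small tau e e0; exists n => t y tt.
  exact: le_trans (HP n t y) (hn t n tt (leqnn n)).
have pH t : per (H t).
  by move=> y; rewrite /H; congr (limn _); apply/funext => n; exact: (picard_sum_uc n).2.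
exists H; split=> // t y.
have [uNH _] := Nuc uH pH; have cNH := strip_uc_continuous_time (y := y) uNH.
apply/eqP; rewrite -subr_eq0 -normr_le0; apply/ler_addgt0Pr => e e0; rewrite add0r.
pose D := 1 + M * (`|t| + 1).
have D0 : 0 < D by rewrite ltr_pwDl// mulr_ge0 ?addr_ge0// ltW.
have [n hn] := small `|t| (e / D) (divr_gt0 e0 D0).
have [uP pP] := picard_sum_uc n; have [uNP _] := Nuc uP pP.
have cNP := strip_uc_continuous_time (y := y) uNP.
have -> : H t y - (h0 y + sint (fun s => N s (H s) y) 0 t) =
    (H t y - picard_sum n.+1 t y) + - sint (fun s => N s (H s) y - N s (picard_sum n s) y) 0 t.
  rewrite sintB; [|exact: continuous_loc_integrable..].
  by rewrite picard_sum_rec; ring.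
have I : `|sint (fun s => N s (H s) y - N s (picard_sum n s) y) 0 t| <= M * (e / D) * `|t - 0|.
  apply: sint_le_bound; last 1 first.
  - move=> s st.
    have -> : N s (H s) y - N s (picard_sum n s) y = N s (fun x => H s x - picard_sum n s x) y.
      have cHs := @strip_uc_continuous _ _ s uH; have cPs := @strip_uc_continuous _ _ s uP.
      have cD : continuous (fun x => H s x - picard_sum n s x).
        by move=> x; apply: cvgB; [exact: cHs|exact: cPs].
      have := ND s cD cPs; rewrite (_ : (fun x => _ + _) = H s); last first.
        by apply/funext => x; rewrite subrK.
      by move=> ->; rewrite addrK.
    apply: Nbound.
    + by move=> x; rewrite pH pP.
    + by move=> x; apply: cvgB; [exact: strip_uc_continuous|exact: strip_uc_continuous].
    + by move=> x; apply: le_trans (HP n s x) (hn s n st (leqnn n)).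
  - by move=> s; apply: cvgB; [exact: cNH|exact: cNP].
  - by rewrite normr0.
rewrite subr0 in I.
apply: (le_trans (ler_normD _ _)); rewrite normrN.
have h1 : `|H t y - picard_sum n.+1 t y| <= e / D.
  exact: le_trans (HP n.+1 t y) (hn t n.+1 (lexx _) (leqnSn n)).
apply: (le_trans (lerD h1 I)).
have De : e = e / D * D by rewrite divfK// gt_eqF.
have eD : 0 <= e / D by rewrite divr_ge0 ?ltW.
rewrite [leRHS]De {3}/D -subr_ge0.
have -> : e / D * (1 + M * (`|t| + 1)) - (e / D + M * (e / D) * `|t|) = M * (e / D) by ring.
by rewrite mulr_ge0// ltW.
Qed.

End Picard.

(** * The coordinate that straightens the transport *)

Section Coordinate.
Variables (R : realType) (c : R) (eta : R -> R).
Hypotheses (c_gt0 : 0 < c) (wave : single_lobe c eta).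
Implicit Types (u x y a b : R).
Local Notation p := (stiff c eta).
Local Notation T := (2 * pi).
Let T0 : 0 < T :> R := twopi_gt0 R.
Let cint f : continuous f -> loc_integrable f := @continuous_loc_integrable R f.

(** The speed of rotation that makes [coord] commute with the translation by the
    period. *)
Definition crate : R := T / sint (fun u => 2 * c / p u) 0 T.

Definition dcoord u : R := crate * (2 * c / p u).

Definition coord : R -> R := sint dcoord 0.

Definition icoord y : R := xget 0 [set u | coord u = y].

Let continuous_slowness : continuous (fun u => 2 * c / p u).
Proof.
move=> u; apply: cvgM; first exact: cvg_cst.
by apply: cvgV; [exact: stiff_neq0|exact: continuous_stiff].
Qed.

Lemma crate_gt0 : 0 < crate.
Proof.
have pos u : 0 < 2 * c / p u by rewrite divr_gt0 ?stiff_gt0// mulr_gt0.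
have /andP[pi0 piT] := pi_bounds R.
by rewrite divr_gt0//; apply: (sint_gt0 (x := pi)) => // u; exact: ltW.
Qed.

Lemma dcoord_gt0 u : 0 < dcoord u.
Proof. by rewrite mulr_gt0 ?crate_gt0// divr_gt0 ?stiff_gt0// mulr_gt0. Qed.

Lemma dcoord_stiff u : p u * dcoord u = crate * (2 * c).
Proof. have pu := stiff_neq0 c_gt0 wave u; rewrite /dcoord; field; exact: pu. Qed.

Lemma continuous_dcoord : continuous dcoord.
Proof. by move=> u; apply: cvgM; [exact: cvg_cst|exact: continuous_slowness]. Qed.

Lemma per_dcoord : per dcoord.
Proof. by move=> u; rewrite /dcoord (smooth_stiff wave).1. Qed.

Lemma d_coord u : is_derive u 1 coord (dcoord u).
Proof. exact: derive_sint continuous_dcoord. Qed.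

Lemma coord_incr a b : coord b - coord a = sint dcoord a b.
Proof. exact: (sint_diff 0 a b (cint continuous_dcoord)). Qed.

Lemma coord0 : coord 0 = 0. Proof. exact: sintxx. Qed.

Lemma coord_per u : coord (u + T) = coord u + T.
Proof.
rewrite -[LHS](subrK (coord u)) addrC coord_incr; congr (_ + _).
rewrite (per_sint_period _ per_dcoord (cint continuous_dcoord)) sintZ; last exact: cint.
rewrite /crate divfK// gt_eqF//.
by have := crate_gt0; rewrite /crate pmulr_rgt0// invr_gt0.
Qed.

Lemma dcoord_bounds : exists2 lo : R, 0 < lo & exists2 hi : R, 0 < hi &
  forall u, lo <= dcoord u <= hi.
Proof.
have [P P0 hP] := per_continuous_bounded (smooth_stiff wave).1 (continuous_stiff wave).
have [D D0 hD] := per_continuous_bounded per_dcoord continuous_dcoord.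
have cc : 0 < crate * (2 * c) by rewrite mulr_gt0 ?crate_gt0// mulr_gt0.
exists (crate * (2 * c) / P); first by rewrite divr_gt0.
exists D => // u; rewrite (le_trans (ler_norm _) (hD u)) andbT.
rewrite ler_pdivrMr// -(dcoord_stiff u) mulrC ler_pM2l ?dcoord_gt0//.
exact: le_trans (ler_norm _) (hP u).
Qed.

Lemma coordK_icoord : cancel icoord coord.
Proof.
move=> y; suff [u uy] : exists u, coord u = y by exact: (@xgetPex _ 0 [set u | coord u = y] (ex_intro _ u uy)).
have [lo lo0 [hi hi0 hlo]] := dcoord_bounds.
pose b := `|y| / lo; have b0 : 0 <= b by rewrite divr_ge0// ltW.
have lob : lo * b = `|y| by rewrite mulrC divfK// gt_eqF.
have up a d : a <= d -> lo * (d - a) <= coord d - coord a.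
  move=> ad; rewrite coord_incr -sint_cst; apply: sint_le => //.
  - exact: loc_integrable_cst.
  - exact: cint continuous_dcoord.
  - by move=> u _; case/andP: (hlo u).
have h1 := up 0 b b0; have h2 : lo * (0 - - b) <= coord 0 - coord (- b) by apply: up; rewrite oppr_le0.
rewrite !coord0 in h1 h2; move: h1 h2; rewrite !(subr0, sub0r, opprK) lob => h1 h2.
have y1 := ler_norm y; have y2 : - `|y| <= y by rewrite lerNl -normrN ler_norm.
have [|||u _ uy] := @IVT R coord (- b) b y; last by exists u.
- by rewrite (le_trans _ b0)// oppr_le0.
- exact/continuous_subspaceT/is_derive_continuous/d_coord.
- by rewrite ge_min le_max; apply/andP; split; apply/orP; [left|right]; lra.
Qed.

Lemma coord_diffeo : diffeo coord dcoord icoord.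
Proof.
have lt : {homo coord : s t / s < t}.
  move=> s t st; rewrite -subr_gt0 coord_incr; have [m1 m2] := midf_lt st.
  apply: (sint_gt0 (x := (s + t) / 2)) => //; first exact: continuous_dcoord.
    by move=> u; rewrite ltW// dcoord_gt0.
  exact: dcoord_gt0.
split; [exact: continuous_dcoord|exact: dcoord_gt0|exact: d_coord|exact: coordK_icoord|].
move=> u; have := coordK_icoord (coord u).
by case: (ltgtP (icoord (coord u)) u) => // /lt h; move: h => /[swap] ->; rewrite ltxx.
Qed.

Lemma icoordK : cancel coord icoord.
Proof. by case: coord_diffeo. Qed.

Lemma icoord_per y : icoord (y + T) = icoord y + T.
Proof. by apply: (can_inj icoordK); rewrite coord_per !coordK_icoord. Qed.

Lemma icoord_incr_le lo a b : 0 < lo -> (forall u, lo <= dcoord u) ->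
  `|icoord a - icoord b| <= lo^-1 * `|a - b|.
Proof.
move=> lo0 hlo; rewrite ler_pdivlMl//.
wlog ba : a b / b <= a => [th|].
  by have [|/ltW] := leP b a => h; [exact: th|rewrite distrC [leRHS]distrC; exact: th].
have ib : icoord b <= icoord a by rewrite -(diffeo_le coord_diffeo) !coordK_icoord.
rewrite !ger0_norm ?subr_ge0// -{2}(coordK_icoord a) -{2}(coordK_icoord b) coord_incr -sint_cst.
by apply: sint_le => //; [exact: loc_integrable_cst|exact: cint continuous_dcoord].
Qed.

Lemma coord_lipschitz : exists2 L : R, 0 < L & forall a b,
  `|coord a - coord b| <= L * `|a - b| /\ `|icoord a - icoord b| <= L * `|a - b|.
Proof.
have [lo lo0 [hi hi0 hlo]] := dcoord_bounds.
have lV : 0 < lo^-1 by rewrite invr_gt0.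
exists (hi + lo^-1) => [|a b]; first by rewrite addr_gt0.
split.
  rewrite coord_incr (@le_trans _ _ (hi * `|a - b|))//.
    apply: sint_bound => [|u _]; first exact: cint continuous_dcoord.
    by rewrite gtr0_norm ?dcoord_gt0//; case/andP: (hlo u).
  by rewrite ler_wpM2r// lerDl ltW.
rewrite (@le_trans _ _ (lo^-1 * `|a - b|))//.
  by apply: icoord_incr_le => // u; case/andP: (hlo u).
by rewrite ler_wpM2r// lerDr ltW.
Qed.

Lemma continuous_icoord : continuous icoord.
Proof.
have [L L0 hL] := coord_lipschitz; apply/continuousP_ed => y e e0.
exists (e / L); first by rewrite divr_gt0.
move=> z; rewrite ltr_pdivlMr// mulrC; apply: le_lt_trans.
by case: (hL z y).
Qed.

Definition dicoord y : R := (dcoord (icoord y))^-1.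

Lemma d_icoord y : is_derive y 1 icoord (dicoord y).
Proof.
have := @is_derive_inverse R coord icoord (dcoord (icoord y)) (icoord y).
rewrite coordK_icoord; apply.
- by near=> z; exact: icoordK.
- near=> z; exact: (is_derive_continuous d_coord).
- exact: d_coord.
- by rewrite gt_eqF// dcoord_gt0.
Unshelve. all: by end_near. Qed.

Lemma dicoordE y : dicoord y = p (icoord y) / (crate * (2 * c)).
Proof.
have h := dcoord_stiff (icoord y); rewrite /dicoord.
have z := dcoord_gt0 (icoord y); have s := stiff_gt0 c_gt0 wave (icoord y).
rewrite -h; field; by rewrite !gt_eqF.
Qed.

Lemma continuous_dicoord : continuous dicoord.
Proof.
move=> y; apply: cvgV; first by rewrite gt_eqF// dcoord_gt0.
exact: (@continuous_comp _ _ _ icoord dcoord _ (@continuous_icoord y) (@continuous_dcoord _)).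
Qed.

Lemma icoord_diffeo : diffeo icoord dicoord coord.
Proof.
split; [exact: continuous_dicoord| |exact: d_icoord|exact: icoordK|exact: coordK_icoord].
by move=> y; rewrite invr_gt0 dcoord_gt0.
Qed.

Lemma per_comp_coord f b : per f -> per (fun u => f (coord u + b)).
Proof. by move=> pf u; rewrite coord_per addrAC pf. Qed.

Lemma per_comp_icoord f b : per f -> per (fun y => f (icoord (y - b))).
Proof. by move=> pf u; rewrite addrAC icoord_per pf. Qed.

End Coordinate.

(** * The equation along characteristics *)

Section StripMore.
Variable R : realType.
Implicit Types (t s u x y a b e d S tau : R) (f v q : R -> R) (K H J L : R -> R -> R).

Lemma strip_uc_cst k : strip_uc (fun _ _ : R => k).
Proof.
split=> [tau|tau e e0]; first by exists `|k| => t y _.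
by exists 1 => // t s x y *; rewrite subrr normr0.
Qed.

Lemma strip_ucZ k K : strip_uc K -> strip_uc (fun t y => k * K t y).
Proof. exact/strip_ucM/strip_uc_cst. Qed.

Lemma strip_uc_sint q H : continuous q -> strip_uc H ->
  strip_uc (fun t _ => sint (fun u => q u * H t u) 0 (2 * pi)).
Proof.
move=> cq uH; have [bH uc] := uH; have T0 := twopi_gt0 R.
have [Q Q0 hQ] := continuous_bounded_itv 0 (2 * pi) cq.
have cqH t : continuous (fun u => q u * H t u).
  by move=> u; apply: cvgM; [exact: cq|exact: (@strip_uc_continuous _ _ t uH)].
have bnd f S : continuous f -> (forall u, `|f u| <= S) ->
    `|sint (fun u => q u * f u) 0 (2 * pi)| <= Q * S * (2 * pi).
  move=> cf fS; have := @sint_bound _ (fun u => q u * f u) 0 (2 * pi) (Q * S).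
  rewrite subr0 (gtr0_norm T0); apply.
    by apply: continuous_loc_integrable => u; apply: cvgM; [exact: cq|exact: cf].
  move=> u; rewrite (min_l (ltW T0)) (max_r (ltW T0)) => /hQ h.
  by rewrite normrM; apply: ler_pM.
split=> [tau|tau e e0].
  have [S hS] := bH tau; exists (Q * S * (2 * pi)) => t _ tt.
  by apply: bnd => [|u]; [exact: strip_uc_continuous|exact: hS].
have E0 : 0 < e / (2 * (Q * (2 * pi))) by rewrite divr_gt0// !mulr_gt0// pi_gt0.
have [d d0 hd] := uc tau _ E0; exists d => // t s _ _ tt ss ts _.
rewrite -sintB; [|exact/continuous_loc_integrable..].
rewrite (eq_sint (g := fun u => q u * (H t u - H s u))); last by move=> u; ring.
apply: (@le_lt_trans _ _ (Q * (e / (2 * (Q * (2 * pi)))) * (2 * pi))).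
  apply: bnd => [u|u].
    by apply: cvgB; exact: (@strip_uc_continuous _ _ _ uH).
  by apply/ltW/hd; rewrite ?subrr ?normr0.
have QT : 0 < Q * (2 * pi) by rewrite mulr_gt0.
rewrite mulrAC; move: (Q * (2 * pi)) QT => q' q0'.
have -> : q' * (e / (2 * q')) = e / 2 by field; rewrite gt_eqF.
lra.
Qed.

(** Differentiation under the integral: the increment in y is again an integral of L,
    and L is uniformly continuous on strips. *)
Lemma strip_uc_int_derive J L t y : strip_uc J -> strip_uc L ->
  (forall s y, is_derive y 1 (J s) (L s y)) ->
  is_derive y 1 (fun y => sint (fun s => J s y) 0 t) (sint (fun s => L s y) 0 t).
Proof.
move=> uJ uL dJ; apply: is_derive_ed => e e0.
have e1 : 0 < e / (`|t| + 1) by rewrite divr_gt0// ltr_wpDl.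
have [d d0 hd] := uL.2 `|t| _ e1; exists d => // z zy.
have lJ x : loc_integrable (fun s => J s x).
  exact/continuous_loc_integrable/(@strip_uc_continuous_time _ _ x uJ).
have lL x : loc_integrable (fun s => L s x).
  exact/continuous_loc_integrable/(@strip_uc_continuous_time _ _ x uL).
have cL s : continuous (L s) := @strip_uc_continuous _ _ s uL.
rewrite mulrC -sintZ// -!sintB//; try (exact: loc_integrableB); try exact: loc_integrableZ.
have h s : `|s| <= `|t| -> `|J s z - J s y - (z - y) * L s y| <= e / (`|t| + 1) * `|z - y|.
  move=> st; rewrite -(sint_derive y z (cL s) (dJ s)) mulrC -sint_cst -sintB; last 2 first.
  - exact: continuous_loc_integrable.
  - exact: loc_integrable_cst.
  apply: sint_bound => [|x /andP[x1 x2]].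
    by apply: loc_integrableB; [exact: continuous_loc_integrable|exact: loc_integrable_cst].
  apply/ltW/hd => //; first by rewrite subrr normr0.
  apply: le_lt_trans zy; move: x1 x2; case: (leP y z) => yz x1 x2.
    by rewrite !ger0_norm ?subr_ge0// lerD2r.
  by rewrite !ler0_norm ?subr_le0// ?(ltW yz)// lerN2 lerD2r.
apply: le_trans (@sint_le_bound _ _ 0 t (e / (`|t| + 1) * `|z - y|) _ _ _) _.
- move=> s; apply: cvgB; first by apply: cvgB; exact: (@strip_uc_continuous_time _ _ _ uJ).
  by apply: cvgM; [exact: cvg_cst|exact: (@strip_uc_continuous_time _ _ _ uL)].
- by rewrite normr0.
- by move=> s st; exact: h.
rewrite subr0 mulrAC ler_wpM2r// mulrAC ler_pdivrMr ?ltr_wpDl//.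
by rewrite ler_pM2l// lerDl.
Qed.

End StripMore.

Section Characteristics.
Variables (R : realType) (c : R) (eta : R -> R).
Hypotheses (c_gt0 : 0 < c) (wave : single_lobe c eta).
Implicit Types (t s u y a b : R) (v w : R -> R) (H : R -> R -> R).
Local Notation p := (stiff c eta).
Local Notation T := (2 * pi).
Local Notation om := (crate c eta).
Local Notation X := (coord c eta).
Local Notation x := (dcoord c eta).
Local Notation U := (icoord c eta).
Local Notation B := (nonloc c eta).
Local Notation dB := (dnonloc c eta).
Let T0 : 0 < T :> R := twopi_gt0 R.
Let cint f : continuous f -> loc_integrable f := @continuous_loc_integrable R f.

Lemma strip_uc_dnonloc H : strip_uc H -> strip_uc (fun t => dB (H t)).
Proof.
move=> uH.
have uw : strip_uc (fun _ : R => weight eta).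
  have sw : smooth_per (weight eta).
    have := smooth_perD (smooth_per_cst 1) (smooth_perM (smooth_per_cst (-2)) (smooth_e2 wave)).
    by congr smooth_per; apply/funext => u; rewrite /weight mulNr.
  exact: per_H1_uc sw.1 (smooth_per_derive1 sw).1 (smooth_per_H1loc sw).
have := strip_ucZ (2 * c)^-1 (strip_ucD (strip_ucM uw uH)
  (strip_ucZ (- T^-1) (strip_uc_sint (continuous_weight wave) uH))).
congr strip_uc; apply/funext => t; apply/funext => u.
by rewrite /dnonloc /wmean; congr (_ * (_ + _)); rewrite mulNr mulrC.
Qed.

(** Linearity in v and [nonloc_bound] give continuity in t, and the bound on the
    derivative of B v gives continuity in u. *)
Lemma strip_uc_nonloc H : strip_uc H -> (forall t, per (H t)) ->
  strip_uc (fun t => B (H t)).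
Proof.
move=> uH pH; have [M M0 hM] := nonloc_bound c_gt0 wave.
have cH t : continuous (H t) := @strip_uc_continuous _ _ t uH.
have absint v S : continuous v -> (forall u, `|v u| <= S) -> sint (fun u => `|v u|) 0 T <= S * T.
  move=> cv vS; have -> : S * T = sint (fun=> S) 0 T by rewrite sint_cst subr0.
  apply: sint_le => //.
  - exact/loc_integrable_norm/cint.
  - exact: loc_integrable_cst.
  - exact: ltW.
split=> [tau|tau e e0].
  have [S hS] := uH.1 tau; exists (M * (S * T)) => t u tt.
  apply: le_trans (hM _ (pH t) (cH t) u).2 _; rewrite ler_pM2l//.
  by apply: absint => // y; exact: hS.
have [S hS] := uH.1 tau; have [d1 d10 hd1] := uH.2 tau _ (divr_gt0 e0 (mulr_gt0 (mulr_gt0 M0 T0) (ltr0n _ 2))).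
pose D := M * (`|S| + `|S| * T) + 1.
have D0 : 0 < D by rewrite ltr_wpDl// mulr_ge0 ?(ltW M0)// addr_ge0// mulr_ge0// ltW.
exists (Num.min d1 (e / (2 * D))); first by rewrite lt_min d10 divr_gt0// mulr_gt0.
move=> t s a b tt ss; rewrite !lt_min => /andP[t1 _] /andP[_ x2].
have -> : B (H t) a - B (H s) b = (B (H t) a - B (H s) a) + (B (H s) a - B (H s) b) by ring.
have cD : continuous (fun u => H t u - H s u) by move=> u; apply: cvgB; exact: cH.
have h1 : `|B (H t) a - B (H s) a| <= e / 2.
  have := nonlocD wave cD (cH s).
  rewrite (_ : (fun u => _ + _) = H t); last by apply/funext => u; rewrite subrK.
  move=> ->; rewrite addrK.
  have pD : per (fun u => H t u - H s u) by move=> u; rewrite !pH.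
  apply: le_trans (hM _ pD cD a).2 _.
  have := @absint _ (e / (M * T * 2)) cD _; move=> h.
  apply: (@le_trans _ _ (M * (e / (M * T * 2) * T))).
    by rewrite ler_pM2l//; apply: h => u; apply/ltW/hd1; rewrite ?subrr ?normr0.
  rewrite mulrA mulrAC mulrCA mulrC; move: (M * T) (mulr_gt0 M0 T0) => q q0.
  by rewrite le_eqVlt; apply/orP; left; apply/eqP; field; rewrite gt_eqF.
have h2 : `|B (H s) a - B (H s) b| <= D * `|a - b|.
  rewrite -(sint_derive b a (continuous_dnonloc (c := c) wave (cH s)) (d_nonloc (c := c) wave (cH s))).
  apply: sint_bound => [|u _]; first exact: cint (continuous_dnonloc (c := c) wave (cH s)).
  apply: le_trans (hM _ (pH s) (cH s) u).1 _; rewrite /D ler_wpDr//.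
  rewrite ler_pM2l// lerD//; first by rewrite (le_trans (hS _ _ ss))// ler_norm.
  by apply: absint => // y; rewrite (le_trans (hS _ _ ss))// ler_norm.
apply: le_lt_trans (ler_normD _ _) _.
have : D * `|a - b| < e / 2.
  by rewrite mulrC -ltr_pdivlMr// -mulrA -invfM.
lra.
Qed.

(** At time t the coordinate y corresponds to the point u with y = X u + om t. *)
Definition char_nonloc t v y := B (fun u => v (X u + om * t)) (U (y - om * t)).

Definition char_dnonloc t v y :=
  dB (fun u => v (X u + om * t)) (U (y - om * t)) * dicoord c eta (y - om * t).

Lemma continuous_along v b : continuous v -> continuous (fun u => v (X u + b)).
Proof.
move=> cv u; apply: (@continuous_comp _ _ _ (fun u => X u + b) v); last exact: cv.
by apply: cvgD; [exact: (is_derive_continuous (d_coord c_gt0 wave))|exact: cvg_cst].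
Qed.

Lemma coord_shift_lipschitz : exists2 L : R, 0 < L & forall t s a b,
  `|(X a + om * t) - (X b + om * s)| <= L * (`|t - s| + `|a - b|) /\
  `|U (a - om * t) - U (b - om * s)| <= L * (`|t - s| + `|a - b|).
Proof.
have [L L0 hL] := coord_lipschitz c_gt0 wave; have o0 := crate_gt0 c_gt0 wave.
exists (L + om + L * om) => [|t s a b]; first by rewrite !addr_gt0// mulr_gt0.
have [h1 _] := hL a b; have [_ h2] := hL (a - om * t) (b - om * s).
have oo : `|om * t - om * s| = om * `|t - s| by rewrite -mulrBr normrM gtr0_norm.
have Lo := mulr_gt0 L0 o0.
have k1 : 0 <= om * `|a - b| by rewrite mulr_ge0// ltW.
have k2 : 0 <= om * `|t - s| by rewrite mulr_ge0// ltW.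
have k3 : 0 <= L * `|t - s| by rewrite mulr_ge0// ltW.
have k4 : 0 <= L * om * `|t - s| by rewrite mulr_ge0// ltW.
have k5 : 0 <= L * om * `|a - b| by rewrite mulr_ge0// ltW.
have k6 : 0 <= L * `|a - b| by rewrite mulr_ge0// ltW.
split.
  have -> : X a + om * t - (X b + om * s) = (X a - X b) + (om * t - om * s) by ring.
  by apply: (le_trans (ler_normD _ _)); rewrite oo; lra.
have h3 : `|a - om * t - (b - om * s)| <= `|a - b| + om * `|t - s|.
  have -> : a - om * t - (b - om * s) = (a - b) - (om * t - om * s) by ring.
  by apply: (le_trans (ler_normB _ _)); rewrite oo.
have := ler_wpM2l (ltW L0) h3; move: h2 k1 k2 k3 k4 k5 k6; clear; lra.
Qed.

Lemma strip_uc_along H : strip_uc H -> strip_uc (fun t u => H t (X u + om * t)).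
Proof.
move=> uH; have [L L0 hL] := coord_shift_lipschitz.
by apply: (strip_uc_comp (phi := fun t u => X u + om * t) uH L0) => t s a b; case: (hL t s a b).
Qed.

Lemma strip_uc_back H : strip_uc H -> strip_uc (fun t y => H t (U (y - om * t))).
Proof.
move=> uH; have [L L0 hL] := coord_shift_lipschitz.
by apply: (strip_uc_comp (phi := fun t y => U (y - om * t)) uH L0) => t s a b; case: (hL t s a b).
Qed.

Lemma strip_uc_char_nonloc H : strip_uc H -> (forall t, per (H t)) ->
  strip_uc (fun t => char_nonloc t (H t)) /\ forall t, per (char_nonloc t (H t)).
Proof.
move=> uH pH; have uh := strip_uc_along uH.
have ph t : per (fun u => H t (X u + om * t)) by exact: per_comp_coord.
split; first exact: strip_uc_back (strip_uc_nonloc uh ph).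
move=> t; apply: (@per_comp_icoord _ _ _ c_gt0 wave (B (fun u => H t (X u + om * t)))).
by apply: per_nonloc => //; exact: (@strip_uc_continuous _ _ t uh).
Qed.

Lemma strip_uc_char_dnonloc H : strip_uc H ->
  strip_uc (fun t => char_dnonloc t (H t)).
Proof.
move=> uH; have uh := strip_uc_along uH.
have up : strip_uc (fun _ : R => p).
  have sp := smooth_stiff wave.
  exact: per_H1_uc sp.1 (smooth_per_derive1 sp).1 (smooth_per_H1loc sp).
have := strip_uc_back (strip_ucM (strip_uc_dnonloc uh) (strip_ucZ (om * (2 * c))^-1 up)).
congr strip_uc; apply/funext => t; apply/funext => y.
by rewrite /char_dnonloc dicoordE// [_ / _]mulrC.
Qed.

Lemma d_char_nonloc t v y : continuous v ->
  is_derive y 1 (char_nonloc t v) (char_dnonloc t v y).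
Proof.
move=> cv.
have d1 : is_derive y 1 (fun y => U (y - om * t)) (dicoord c eta (y - om * t)).
  have := d_icoord c_gt0 wave (y - om * t) => d.
  have ds : is_derive y 1 (fun y : R => y - om * t) 1.
    by rewrite -[X in is_derive _ _ _ X]subr0; apply: is_deriveB.
  have := @is_derive1_comp R U (fun y => y - om * t) y _ _ d ds.
  by rewrite mulr1.
have d2 := d_nonloc (c := c) wave (continuous_along (b := om * t) cv) (U (y - om * t)).
exact: (@is_derive1_comp R (B (fun u => v (X u + om * t))) (fun y => U (y - om * t)) y _ _ d2 d1).
Qed.

Lemma per_char_dnonloc t v : per v -> continuous v -> per (char_dnonloc t v).
Proof.
move=> pv cv y; rewrite /char_dnonloc /dicoord.
have h : per (fun u => dB (fun u => v (X u + om * t)) u / x u).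
  move=> u; rewrite per_dcoord//; congr (_ / _).
  apply: per_dnonloc => //; exact: per_comp_coord.
exact: (per_comp_icoord c_gt0 wave (om * t) h).
Qed.

(** H is the solution of the integral equation along characteristics, and V its
    derivative in y. *)
Theorem characteristic_solution v0 g0 : per v0 -> per g0 -> H1loc v0 g0 ->
  exists H V : R -> R -> R, [/\ strip_uc H, forall t, per (H t),
    forall t, per (V t) /\ H1loc (H t) (V t),
    forall t y, H t y = v0 (U y) + sint (fun s => char_nonloc s (H s) y) 0 t &
    forall t y, V t y = g0 (U y) * dicoord c eta y +
                        sint (fun s => char_dnonloc s (H s) y) 0 t].
Proof.
move=> pv pg hv; have hU := H1loc_diffeo (icoord_diffeo c_gt0 wave) hv.
have pU : per (fun y => v0 (U y)) by move=> y; rewrite icoord_per// pv.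
have pgU : per (fun y => g0 (U y) * dicoord c eta y).
  by move=> y; rewrite /dicoord icoord_per// pg per_dcoord.
have uU := per_H1_uc pU pgU hU.
have [S S0 hS] := per_continuous_bounded pU (H1loc_continuous hU).
have [M M0 hM] := nonloc_bound c_gt0 wave.
have MT : 0 < M * T by rewrite mulr_gt0.
have ND t v w : continuous v -> continuous w ->
    char_nonloc t (fun x => v x + w x) = fun y => char_nonloc t v y + char_nonloc t w y.
  move=> cv cw; apply/funext => y; rewrite /char_nonloc.
  by rewrite (nonlocD wave (continuous_along cv) (continuous_along cw)).
have Nb t v Q : per v -> continuous v -> (forall x, `|v x| <= Q) ->
    forall y, `|char_nonloc t v y| <= M * T * Q.
  move=> pv' cv' vQ y; rewrite -mulrA [T * Q]mulrC.
  have pc := per_comp_coord c_gt0 wave (om * t) pv'.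
  have cc := continuous_along (b := om * t) cv'.
  apply: le_trans (hM _ pc cc _).2 _; rewrite ler_pM2l//.
  have -> : Q * T = sint (fun=> Q) 0 T by rewrite sint_cst subr0.
  apply: sint_le => //.
  - exact/loc_integrable_norm/cint.
  - exact: loc_integrable_cst.
  - exact: ltW.
have [H [uH pH eH]] := picard MT ND Nb strip_uc_char_nonloc uU pU hS.
pose V t y := g0 (U y) * dicoord c eta y + sint (fun s => char_dnonloc s (H s) y) 0 t.
have cH t : continuous (H t) := @strip_uc_continuous _ _ t uH.
exists H, V; split=> // t.
have uL := strip_uc_char_dnonloc uH; have [uJ pJ] := strip_uc_char_nonloc uH pH.
split.
  move=> y; rewrite /V pgU; congr (_ + _); apply: eq_sint => s; exact: per_char_dnonloc.
have -> : H t = fun y => v0 (U y) + sint (fun s => char_nonloc s (H s) y) 0 t.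
  by apply/funext => y; exact: eH.
apply: H1locD hU _; apply: C1_H1loc.
  exact: (@strip_uc_continuous _ _ t (strip_uc_int uL)).
by move=> y; apply: (strip_uc_int_derive t y uJ uL) => s z; exact: d_char_nonloc.
Qed.

End Characteristics.

(** * Differentiation in L^2 *)

Section L2Calculus.
Variable R : realType.
Implicit Types (t s u x y a b e d k l : R) (f g v w q : R -> R) (F G h : R -> R -> R).
Local Notation T := (2 * pi).
Let T0 : 0 < T :> R := twopi_gt0 R.
Let TN : T != 0 :> R. Proof. by rewrite gt_eqF. Qed.
Let cint f : continuous f -> loc_integrable f := @continuous_loc_integrable R f.

Lemma half_divK e k : 0 < k -> e / (2 * k) * k = e / 2.
Proof. by move=> k0; field; rewrite gt_eqF. Qed.

Definition vanish_L2 F : Prop := forall e, 0 < e -> exists2 d : R, 0 < d &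
  forall s, s != 0 -> `|s| < d -> sint (fun u => F s u ^+ 2) 0 T < e.

Lemma sint_sq_ge0 f : 0 <= sint (fun u => f u ^+ 2) 0 T.
Proof. by apply: sint_ge0 => [|u _]; [exact: ltW|exact: sqr_ge0]. Qed.

Lemma L2normE f : L2norm f = Num.sqrt (sint (fun u => f u ^+ 2) 0 T).
Proof. by rewrite /L2norm ip_sint; congr Num.sqrt; apply: eq_sint => u; rewrite expr2. Qed.

Lemma vanish_L2P F : L2norm (F s) @[s --> (0 : R)^'] --> (0 : R) <-> vanish_L2 F.
Proof.
split=> [/cvg_dnbhsP h e e0|h].
  have se : 0 < Num.sqrt e by rewrite sqrtr_gt0.
  have [d d0 hd] := h _ se; exists d => // s s0 sd.
  have := hd s s0; rewrite !subr0 => /(_ sd).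
  by rewrite L2normE ger0_norm ?sqrtr_ge0// ltr_sqrt.
apply/cvg_dnbhsP => e e0; have [d d0 hd] := h _ (exprn_gt0 2 e0).
exists d => // s s0; rewrite !subr0 => sd.
rewrite L2normE ger0_norm ?sqrtr_ge0//.
have -> : e = Num.sqrt (e ^+ 2) by rewrite sqrtr_sqr gtr0_norm.
by rewrite ltr_sqrt ?exprn_gt0// hd.
Qed.

Lemma vanish_L2_unif F : (forall s, continuous (F s)) ->
  (forall e, 0 < e -> exists2 d : R, 0 < d &
    forall s u, s != 0 -> `|s| < d -> `|F s u| <= e) -> vanish_L2 F.
Proof.
move=> cF hF e e0; pose m := Num.min 1 (e / (2 * T)).
have m0 : 0 < m by rewrite lt_min ltr01 divr_gt0// mulr_gt0.
have [d d0 hd] := hF m m0; exists d => // s s0 sd.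
have cF2 : continuous (fun u => F s u ^+ 2) by move=> u; apply: cvgM; exact: cF.
apply: (@le_lt_trans _ _ (sint (fun=> m) 0 T)).
  apply: sint_le; [exact: cint|exact: loc_integrable_cst|exact: ltW|].
  move=> u _; rewrite -(real_normK (num_real (F s u))) expr2.
  apply: (@le_trans _ _ (m * 1)); last by rewrite mulr1.
  by apply: ler_pM => //; [exact: hd|apply: le_trans (hd s u s0 sd) _; rewrite ge_min lexx].
rewrite sint_cst subr0; apply: (@le_lt_trans _ _ (e / (2 * T) * T)).
  by rewrite ler_pM2r// ge_min lexx orbT.
rewrite half_divK//; lra.
Qed.

Lemma vanish_L2D F G : (forall s, loc_sq_integrable (F s)) ->
  (forall s, loc_sq_integrable (G s)) -> vanish_L2 F -> vanish_L2 G ->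
  vanish_L2 (fun s u => F s u + G s u).
Proof.
move=> lF lG hF hG e e0; have e4 : 0 < e / 4 by rewrite divr_gt0.
have [d1 d10 h1] := hF _ e4; have [d2 d20 h2] := hG _ e4.
exists (Num.min d1 d2); first by rewrite lt_min d10.
move=> s s0; rewrite lt_min => /andP[s1 s2].
have {}h1 := h1 s s0 s1; have {}h2 := h2 s s0 s2.
have [_ l1] := lF s; have [_ l2] := lG s; have [_ l3] := loc_sqD (lF s) (lG s).
apply: (@le_lt_trans _ _ (2 * sint (fun u => F s u ^+ 2) 0 T + 2 * sint (fun u => G s u ^+ 2) 0 T)).
  rewrite -!sintZ// -sintD; [|exact: loc_integrableZ..].
  apply: sint_le => //; first by apply: loc_integrableD; exact: loc_integrableZ.
    exact: ltW.
  by move=> u _; have := sqr_ge0 (F s u - G s u); move: (F s u) (G s u) => *; lra.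
lra.
Qed.

Lemma vanish_L2M q F : continuous q -> (forall s, loc_sq_integrable (F s)) ->
  vanish_L2 F -> vanish_L2 (fun s u => q u * F s u).
Proof.
move=> cq lF hF e e0; have [Q Q0 hQ] := continuous_bounded_itv 0 T cq.
have [d d0 hd] := hF _ (divr_gt0 e0 (exprn_gt0 2 Q0)); exists d => // s s0 sd.
have [_ l1] := lF s; have [_ l2] := loc_sqMc cq (lF s).
apply: (@le_lt_trans _ _ (Q ^+ 2 * sint (fun u => F s u ^+ 2) 0 T)).
  rewrite -sintZ//; apply: sint_le => //; [exact: loc_integrableZ|exact: ltW|].
  move=> u uT; rewrite exprMn ler_wpM2r ?sqr_ge0//.
  rewrite -(real_normK (num_real (q u))); apply: lerXn2r; rewrite ?nnegrE//; [exact: ltW|exact: hQ].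
by rewrite mulrC -ltr_pdivlMr ?exprn_gt0// hd.
Qed.

Lemma vanish_L2_scale k F : k != 0 -> vanish_L2 F -> vanish_L2 (fun s => F (k * s)).
Proof.
move=> k0 hF e e0; have [d d0 hd] := hF e e0.
have k1 : 0 < `|k| by rewrite normr_gt0.
exists (d / `|k|); first by rewrite divr_gt0.
move=> s s0; rewrite ltr_pdivlMr// mulrC => sd.
by apply: hd; rewrite ?mulf_neq0// normrM.
Qed.

Lemma eq_vanish_L2 F G : (forall s u, s != 0 -> F s u = G s u) -> vanish_L2 F -> vanish_L2 G.
Proof.
move=> FG hF e e0; have [d d0 hd] := hF e e0; exists d => // s s0 sd.
by rewrite -(eq_sint (f := fun u => F s u ^+ 2)) ?hd// => u; rewrite FG.
Qed.

Lemma vanish_L2_pairing f F : loc_sq_integrable f -> (forall s, loc_sq_integrable (F s)) ->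
  vanish_L2 F -> forall e, 0 < e -> exists2 d : R, 0 < d &
  forall s, s != 0 -> `|s| < d -> `|sint (fun u => f u * F s u) 0 T| < e.
Proof.
move=> lf lF hF e e0; set A := sint (fun u => f u ^+ 2) 0 T.
have A0 : 0 <= A := sint_sq_ge0 f; have A1 : 0 < A + 1 by rewrite ltr_wpDl.
have [d d0 hd] := hF _ (divr_gt0 (exprn_gt0 2 e0) A1); exists d => // s s0 sd.
have := cauchy_schwarz lf (lF s) (ltW T0); rewrite -/A => h.
rewrite -(@ltr_pXn2r _ 2)// ?nnegrE ?normr_ge0 ?(ltW e0)// real_normK ?num_real//.
apply: (le_lt_trans h); have := hd s s0 sd; rewrite ltr_pdivlMr// mulrC; apply: le_lt_trans.
by rewrite ler_wpM2r ?sint_sq_ge0// lerDl.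
Qed.

Lemma is_derive_quotient f t l : (forall e, 0 < e -> exists2 d : R, 0 < d &
    forall s, s != 0 -> `|s| < d -> `|s^-1 * (f (t + s) - f t) - l| <= e) ->
  is_derive t 1 f l.
Proof.
move=> hf; apply: is_derive_ed => e e0; have [d d0 hd] := hf e e0; exists d => // y yd.
have [->|yt] := eqVneq y t; first by rewrite !subrr mulr0 subrr !normr0 mulr0.
have y0 : y - t != 0 by rewrite subr_eq0.
have := hd (y - t) y0 yd; rewrite (_ : t + (y - t) = y); last by rewrite addrC subrK.
move=> h; have -> : f y - f t - l * (y - t) = ((y - t)^-1 * (f y - f t) - l) * (y - t).
  by rewrite mulrBl mulrAC mulVf// mul1r.
by rewrite normrM ler_wpM2r.
Qed.

Definition L2_deriv h t w : Prop :=
  [/\ forall s, loc_sq_integrable (h s), loc_sq_integrable w &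
      vanish_L2 (fun s u => s^-1 * (h (t + s) u - h t u) - w u)].

Lemma L2_deriv_rem h t w s : L2_deriv h t w ->
  loc_sq_integrable (fun u => s^-1 * (h (t + s) u - h t u) - w u).
Proof. by move=> [lh lw _]; apply: loc_sqB => //; apply/loc_sqZ/loc_sqB. Qed.

Lemma L2_deriv_pairing q h t w : loc_sq_integrable q -> L2_deriv h t w ->
  is_derive t 1 (fun t => sint (fun u => q u * h t u) 0 T) (sint (fun u => q u * w u) 0 T).
Proof.
move=> lq D; have [lh lw hv] := D; apply: is_derive_quotient => e e0.
have [d d0 hd] := vanish_L2_pairing lq (fun s => L2_deriv_rem s D) hv e0.
exists d => // s s0 sd; have := ltW (hd s s0 sd); congr (`|_| <= _).
have l1 r := loc_sqM lq (lh r); have l2 := loc_sqM lq lw.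
rewrite -sintB// -sintZ; last exact: loc_integrableB.
rewrite -sintB//; last exact/loc_integrableZ/loc_integrableB.
by apply: eq_sint => u; ring.
Qed.

(** With r the remainder of the difference quotient of h, that of q h^2 is
    q (w + r) (2 h + s (w + r)). *)
Lemma L2_deriv_square q h t w : continuous q -> L2_deriv h t w ->
  is_derive t 1 (fun t => sint (fun u => q u * h t u ^+ 2) 0 T)
    (2 * sint (fun u => q u * h t u * w u) 0 T).
Proof.
move=> cq D; have [lh lw hv] := D; apply: is_derive_quotient => e e0.
have lqh := loc_sqMc cq (lh t); have e4 : 0 < e / 4 by rewrite divr_gt0.
have [d1 d10 h1] := vanish_L2_pairing lqh (fun s => L2_deriv_rem s D) hv e4.
have [d2 d20 h2] := hv _ ltr01.
have [Q Q0 hQ] := continuous_bounded_itv 0 T cq.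
set W := sint (fun u => w u ^+ 2) 0 T; have W0 : 0 <= W := sint_sq_ge0 w.
pose K := Q * (2 * W + 2); have K0 : 0 < K by rewrite mulr_gt0// ltr_wpDl// mulr_ge0.
exists (Num.min (Num.min d1 d2) (e / (2 * K))).
  by rewrite !lt_min d10 d20 divr_gt0// mulr_gt0.
move=> s s0; rewrite !lt_min => /andP[/andP[s1 s2] s3].
pose r u := s^-1 * (h (t + s) u - h t u) - w u.
have lr : loc_sq_integrable r := L2_deriv_rem s D.
have {}h1 : `|sint (fun u => q u * h t u * r u) 0 T| < e / 4 := h1 s s0 s1.
have {}h2 : sint (fun u => r u ^+ 2) 0 T < 1 := h2 s s0 s2.
have lwr := loc_sqD lw lr; have [_ lwr2] := lwr; have [_ lr2] := lr; have [_ lw2] := lw.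
have lqwr : loc_integrable (fun u => q u * (w u + r u) ^+ 2).
  exact: loc_integrableMc cq lwr2.
have lqhr := loc_sqM lqh lr; have lqhw := loc_sqM lqh lw.
have l1 b : loc_integrable (fun u => q u * h b u ^+ 2).
  by apply: loc_integrableMc => //; case: (lh b).
have -> : s^-1 * (sint (fun u => q u * h (t + s) u ^+ 2) 0 T - sint (fun u => q u * h t u ^+ 2) 0 T) -
    2 * sint (fun u => q u * h t u * w u) 0 T =
    2 * sint (fun u => q u * h t u * r u) 0 T + s * sint (fun u => q u * (w u + r u) ^+ 2) 0 T.
  rewrite -sintB// -!sintZ//; last exact: loc_integrableB.
  rewrite -sintB; [|exact/loc_integrableZ/loc_integrableB|exact: loc_integrableZ].
  rewrite -sintD; [|exact: loc_integrableZ..].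
  apply: eq_sint => u; rewrite /r subrKC.
  by move: (h (t + s) u) (h t u) (q u) (w u) => a b k m; field.
have h3 : `|sint (fun u => q u * (w u + r u) ^+ 2) 0 T| <= K.
  apply: le_trans (sint_abs lqwr (ltW T0)) _.
  apply: (@le_trans _ _ (Q * (2 * W + 2 * sint (fun u => r u ^+ 2) 0 T))).
    rewrite -!sintZ// -sintD; [|exact: loc_integrableZ..].
    rewrite -sintZ; last by apply: loc_integrableD; exact: loc_integrableZ.
    apply: sint_le; [exact: loc_integrable_norm| |exact: ltW|].
      by apply/loc_integrableZ/loc_integrableD; exact: loc_integrableZ.
    move=> u uT; rewrite normrM; apply: ler_pM => //; first exact: hQ.
    rewrite ger0_norm ?sqr_ge0//; have := sqr_ge0 (w u - r u).
    by move: (w u) (r u) => *; lra.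
  by rewrite ler_pM2l// lerD2l -[leRHS]mulr1 ler_pM2l//; exact: ltW.
apply: (le_trans (ler_normD _ _)); rewrite !normrM (ger0_norm (ler0n _ 2)).
have : `|s| * `|sint (fun u => q u * (w u + r u) ^+ 2) 0 T| <= e / (2 * K) * K.
  by apply: ler_pM => //; exact: ltW.
rewrite half_divK// => h4; apply: le_trans (lerD (ler_wpM2l (ler0n _ 2) (ltW h1)) h4) _; lra.
Qed.

End L2Calculus.

(** * The zero-mean antiderivative *)

Section Antiderivative.
Variables (R : realType) (c : R) (eta : R -> R).
Hypotheses (c_gt0 : 0 < c) (wave : single_lobe c eta).
Implicit Types (u a b : R) (v g f phi F : R -> R).
Local Notation p := (stiff c eta).
Local Notation e1 := (derive1 eta).
Local Notation e2 := (derive1n 2 eta).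
Local Notation T := (2 * pi).
Local Notation B := (nonloc c eta).
Local Notation dB := (dnonloc c eta).
Local Notation weight := (weight eta).
Let T0 : 0 < T :> R := twopi_gt0 R.
Let cp := continuous_stiff wave.
Let cint f : continuous f -> loc_integrable f := @continuous_loc_integrable R f.

(** The action of the distribution L v on test functions, after one integration by
    parts. *)
Lemma Lop_sint v g phi : per v -> per g -> H1loc v g -> smooth_per phi ->
  Lop c eta v phi = sint (fun u => p u * g u * derive1 phi u) 0 T -
                    sint (fun u => weight u * v u * phi u) 0 T.
Proof.
move=> pv pg hv sp; have sp1 := smooth_per_derive1 sp.
have cv := H1loc_continuous hv; have cphi := smooth_per_continuous sp.
have spp := smooth_perM (smooth_stiff wave) sp1.
have hw := per_sint_mul_derive1 pv hv spp.
have -> : Lop c eta v phi = - ip v (derive1 (fun u => p u * derive1 phi u)) - ip v phi +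
    ip v (fun u => 2 * e2 u * phi u) by rewrite /Lop /diff_distr opprK.
rewrite !ip_sint hw opprK.
rewrite (eq_sint (g := fun u => p u * g u * derive1 phi u)); last by move=> u; ring.
rewrite -addrA; congr (_ + _).
have l1 : loc_integrable (fun u => v u * phi u).
  by apply: cint => u; apply: cvgM; [exact: cv|exact: cphi].
have l2 : loc_integrable (fun u => v u * (2 * e2 u * phi u)).
  apply: cint => u; apply: cvgM; first exact: cv.
  apply: cvgM; last exact: cphi.
  by apply: cvgM; [exact: cvg_cst|exact: (continuous_e2 wave)].
rewrite addrC -sintB// -sintN; last first.
  apply: cint => u; apply: cvgM; last exact: cphi.
  exact: (continuous_weightM wave cv).
by apply: eq_sint => u; rewrite /weight; move: (e2 u) => e; ring.
Qed.

(** As L v = - (p v')' - (1 - 2 eta'') v, its zero-mean antiderivative is - p v'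
    minus an antiderivative of (1 - 2 eta'') v minus its mean, and the latter is
    2 c B v. *)
Definition flux v g u : R := - (p u * g u) - 2 * c * B v u.

Section Flux.
Variables v g : R -> R.
Hypotheses (pv : per v) (pg : per g) (hv : H1loc v g).
Let cv : continuous v := H1loc_continuous hv.
Let lg : loc_sq_integrable g := hv.1.

Lemma loc_sq_flux : loc_sq_integrable (flux v g).
Proof.
apply: loc_sqB; last exact/loc_sqZ/continuous_loc_sq/(continuous_nonloc wave cv).
have := loc_sqZ (-1) (loc_sqMc cp lg); congr loc_sq_integrable.
by apply/funext => u; rewrite mulN1r.
Qed.

Lemma per_flux : per (flux v g).
Proof. by move=> u; rewrite /flux (smooth_stiff wave).1 pg (per_nonloc (c := c) wave cv pv). Qed.

Lemma sint_flux : sint (flux v g) 0 T = 0.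
Proof.
have lpg := loc_sq_loc_integrable (loc_sqMc cp lg).
have lB := cint (continuous_nonloc (c := c) wave cv).
rewrite sintB; [|exact: loc_integrableN|exact: loc_integrableZ].
rewrite sintN// sintZ// (sint_nonloc wave cv).
have hp := smooth_per_H1loc (smooth_stiff wave).
have ep : v T * p T - v 0 * p 0 = 0.
  have := pv 0; have := (smooth_stiff wave).1 0; rewrite !add0r => -> ->; exact: subrr.
have -> : sint (fun u => p u * g u) 0 T = sint (fun u => 2 * e1 u * v u) 0 T.
  rewrite (eq_sint (g := fun u => g u * p u)); last by move=> u; rewrite mulrC.
  rewrite (H1loc_parts 0 T hv hp) ep sub0r -sintN; last first.
    by apply: loc_sqM => //; [exact: continuous_loc_sq|exact: hp.1].
  apply: eq_sint => u; have -> : derive1 p u = - 2 * e1 u.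
    by rewrite derive1E; have := d_stiff wave u => d; rewrite derive_val.
  by ring.
move: (sint _ 0 T) => q; field; exact: lt0r_neq0.
Qed.

Lemma flux_antiderivative : is_Pi0_antiderivative (Lop c eta v) (flux v g).
Proof.
split.
- by apply/L2perP; split; [exact: per_flux|exact: loc_sq_flux].
- by rewrite intT_sint sint_flux.
move=> phi sp; have sp1 := smooth_per_derive1 sp.
have cphi := smooth_per_continuous sp; have cphi1 := smooth_per_continuous sp1.
have s1 := smooth_per_cst (1 : R).
rewrite /Pi0 (Lop_sint pv pg hv sp) (Lop_sint pv pg hv s1) intT_sint.
rewrite (eq_sint (f := fun u => p u * g u * derive1 (fun=> 1 : R) u) (g := fun=> 0)); last first.
  by move=> u; rewrite derive1_cst mulr0.
rewrite sint_cst mul0r sub0r.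
rewrite (eq_sint (f := fun u => weight u * v u * 1) (g := fun u => weight u * v u)); last first.
  by move=> u; rewrite mulr1.
rewrite mulNr -/(wmean eta v) /diff_distr /regular_distr ip_sint.
have cB := continuous_nonloc (c := c) wave cv; have cdB := continuous_dnonloc (c := c) wave cv.
have lpg : loc_integrable (fun u => p u * g u * derive1 phi u).
  exact: loc_sqM (loc_sqMc cp lg) (continuous_loc_sq cphi1).
have lBp : loc_integrable (fun u => B v u * derive1 phi u).
  by apply: cint => u; apply: cvgM; [exact: cB|exact: cphi1].
rewrite (eq_sint (g := fun u => - (p u * g u * derive1 phi u) + (- (2 * c)) * (B v u * derive1 phi u))); last first.
  by move=> u; rewrite /flux; ring.
rewrite sintD; [|exact: loc_integrableN|exact: loc_integrableZ].
rewrite sintN// sintZ//.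
rewrite (per_sint_mul_derive1 (per_nonloc (c := c) wave cv pv) (H1loc_nonloc wave cv) sp).
have lw : loc_integrable (fun u => weight u * v u * phi u).
  apply: cint => u; apply: cvgM; last exact: cphi.
  exact: (continuous_weightM wave cv).
have -> : sint (fun u => dB v u * phi u) 0 T =
    (2 * c)^-1 * (sint (fun u => weight u * v u * phi u) 0 T - wmean eta v * sint phi 0 T).
  rewrite -sintZ; last exact: cint.
  rewrite -sintB//; last by apply: loc_integrableZ; exact: cint.
  rewrite -sintZ; last by apply: loc_integrableB => //; apply: loc_integrableZ; exact: cint.
  by apply: eq_sint => u; rewrite /dnonloc; ring.
move: (sint _ 0 T) (sint _ 0 T) (sint phi 0 T) (wmean _ _) => q r k m.
field; exact: lt0r_neq0.
Qed.

(** Both functions have zero mean and the same derivative as distributions. *)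
Lemma antiderivative_flux F a b : is_Pi0_antiderivative (Lop c eta v) F ->
  sint (fun u => F u - flux v g u) a b = 0.
Proof.
move=> [LF F0 eF]; have [LG G0 eG] := flux_antiderivative.
have [pF lF] := (L2perP F).1 LF; have [pG lG] := (L2perP _).1 LG.
have lD := loc_sqB lF lG.
have D0 : sint (fun u => F u - flux v g u) 0 T = 0.
  rewrite sintB; [|exact: loc_sq_loc_integrable..].
  by rewrite -!intT_sint F0 G0 subrr.
apply: (orthogonal_smooth_null _ lD) => [u|phi sp]; first by rewrite pF pG.
have cphi := smooth_per_continuous sp.
pose m := sint phi 0 T / T.
have sm : smooth_per (fun u => phi u + - m) := smooth_perD sp (smooth_per_cst (- m)).
have m0 : sint (fun u => phi u + - m) 0 T = 0.
  rewrite sintD; [|exact: cint|exact: loc_integrable_cst].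
  by rewrite sint_cst subr0 /m mulNr divfK ?subrr// gt_eqF.
have [sP dP] := smooth_per_primitive sm m0.
have := eF _ sP; rewrite -(eG _ sP) /diff_distr /regular_distr !ip_sint dP => e.
have lFp : loc_integrable (fun u => F u * (phi u + - m)).
  exact: loc_sqM lF (continuous_loc_sq (smooth_per_continuous sm)).
have lGp : loc_integrable (fun u => flux v g u * (phi u + - m)).
  exact: loc_sqM lG (continuous_loc_sq (smooth_per_continuous sm)).
rewrite (eq_sint (g := fun u => (F u * (phi u + - m) - flux v g u * (phi u + - m)) +
    m * (F u - flux v g u))); last by move=> u; ring.
have lD1 := loc_sq_loc_integrable lD.
rewrite sintD; [|exact: loc_integrableB|exact: loc_integrableZ].
rewrite sintZ// D0 mulr0 addr0 sintB//.
by apply/eqP; rewrite subr_eq0; apply/eqP/oppr_inj.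
Qed.

End Flux.

End Antiderivative.

(** * The solution in the original variable *)

Section StripPrimitive.
Variable R : realType.
Implicit Types (t s u x y b e d : R) (K : R -> R -> R).

(** The point of evaluation may move by b, because h t is read off along the moving
    coordinate. *)
Lemma strip_uc_int_quotient K t : strip_uc K -> forall e, 0 < e -> exists2 d : R, 0 < d &
  forall s y b, s != 0 -> `|s| < d -> `|b| < d ->
  `|s^-1 * (sint (fun r => K r (y + b)) 0 (t + s) - sint (fun r => K r (y + b)) 0 t) - K t y| <= e.
Proof.
move=> uK e e0; have [d d0 hd] := uK.2 (`|t| + 1) e e0.
exists (Num.min d 1); first by rewrite lt_min d0 /=.
move=> s y b s0; rewrite !lt_min => /andP[sd s1] /andP[bd _].
have cK z : continuous (fun r => K r z) := @strip_uc_continuous_time _ _ z uK.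
have lK z := continuous_loc_integrable (cK z).
rewrite sint_diff//.
have -> : s^-1 * sint (fun r => K r (y + b)) t (t + s) - K t y =
    s^-1 * sint (fun r => K r (y + b) - K t y) t (t + s).
  rewrite sintB//; last exact: loc_integrable_cst.
  rewrite sint_cst; have -> : t + s - t = s by ring.
  by rewrite mulrBr [K t y * s]mulrC mulKf.
rewrite normrM normfV ler_pdivrMl ?normr_gt0// mulrC.
have -> : `|s| = `|t + s - t| by congr `|_|; ring.
apply: sint_bound => [|r /andP[r1 r2]].
  by apply: loc_integrableB => //; exact: loc_integrable_cst.
have rt : `|r - t| <= `|s|.
  have st : - `|s| <= s <= `|s| by rewrite -ler_norml.
  move: st r1 r2 => /andP[st1 st2]; rewrite ge_min le_max ler_norml.
  by case/orP => ? /orP[] ?; apply/andP; split; lra.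
apply/ltW/hd; rewrite ?lerDl//.
- rewrite -(subrK t r) (le_trans (ler_normD _ _))// addrC lerD2l.
  by rewrite (le_trans rt)// ltW.
- exact: le_lt_trans rt sd.
- by rewrite (_ : y + b - y = b)//; ring.
Qed.

End StripPrimitive.

Section Along.
Variables (R : realType) (c : R) (eta : R -> R).
Hypotheses (c_gt0 : 0 < c) (wave : single_lobe c eta).
Implicit Types (t s u y a b : R) (f v w : R -> R) (F : R -> R -> R).
Local Notation T := (2 * pi).
Local Notation X := (coord c eta).
Local Notation x := (dcoord c eta).
Let T0 : 0 < T :> R := twopi_gt0 R.
Let dX := coord_diffeo c_gt0 wave.

Lemma H1loc_shift v g b : H1loc v g -> H1loc (fun u => v (u + b)) (fun u => g (u + b)).
Proof.
move=> hv; have := H1loc_diffeo (diffeo_shift b) hv.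
by congr (H1loc _ _); apply/funext => u; rewrite mulr1.
Qed.

Lemma H1loc_along v g b : H1loc v g ->
  H1loc (fun u => v (X u + b)) (fun u => g (X u + b) * x u).
Proof. by move=> hv; exact: (H1loc_diffeo dX (H1loc_shift b hv)). Qed.

Lemma loc_sq_along f b : loc_sq_integrable f -> loc_sq_integrable (fun u => f (X u + b)).
Proof. by move=> lf; exact: (loc_sq_diffeo dX (loc_sq_shift b lf)). Qed.

Lemma sint_along f b : per f -> loc_integrable f ->
  sint (fun u => f (X u + b) * x u) 0 T = sint f 0 T.
Proof.
move=> pf lf; rewrite (sint_substitution 0 T dX (loc_integrable_shift b lf)).
have -> : X T = T by rewrite -[T in X T]add0r coord_per// coord0 add0r.
by rewrite coord0 sint_shift// add0r addrC per_sint_period.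
Qed.

(** X' is bounded below. *)
Lemma along_le : exists2 K : R, 0 < K & forall f b, per f -> loc_sq_integrable f ->
  sint (fun u => f (X u + b) ^+ 2) 0 T <= K * sint (fun u => f u ^+ 2) 0 T.
Proof.
have [lo lo0 [hi _ hlo]] := dcoord_bounds c_gt0 wave.
exists lo^-1 => [|f b pf lf]; first by rewrite invr_gt0.
have pf2 : per (fun u => f u ^+ 2) by move=> u; rewrite pf.
have [_ lf2] := lf; rewrite -(sint_along b pf2 lf2).
have l1 := loc_integrable_diffeo dX (loc_integrable_shift b lf2).
rewrite -sintZ//; apply: sint_le; [by case: (loc_sq_along b lf)|exact: loc_integrableZ|exact: ltW|].
move=> u _; rewrite ler_pdivlMl// mulrC; apply: ler_wpM2l; first exact: sqr_ge0.
by case/andP: (hlo u).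
Qed.

Lemma vanish_L2_along F b : (forall s, per (F s)) -> (forall s, loc_sq_integrable (F s)) ->
  vanish_L2 F -> vanish_L2 (fun s u => F s (X u + b)).
Proof.
move=> pF lF hF e e0; have [K K0 hK] := along_le.
have [d d0 hd] := hF _ (divr_gt0 e0 K0); exists d => // s s0 sd.
apply: le_lt_trans (hK _ b (pF s) (lF s)) _.
by rewrite mulrC -ltr_pdivlMr// hd.
Qed.

End Along.

Section Candidate.
Variables (R : realType) (c : R) (eta : R -> R).
Hypotheses (c_gt0 : 0 < c) (wave : single_lobe c eta).
Implicit Types (t s u y a b e d : R) (v w : R -> R).
Local Notation p := (stiff c eta).
Local Notation T := (2 * pi).
Local Notation om := (crate c eta).
Local Notation X := (coord c eta).
Local Notation x := (dcoord c eta).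
Local Notation U := (icoord c eta).
Local Notation B := (nonloc c eta).
Let T0 : 0 < T :> R := twopi_gt0 R.
Let cint (f : R -> R) : continuous f -> loc_integrable f := @continuous_loc_integrable R f.

Variables (v0 g0 : R -> R) (H V : R -> R -> R).
Local Notation J := (fun s => char_nonloc c eta s (H s)).
Local Notation L := (fun s => char_dnonloc c eta s (H s)).
Hypotheses (uH : strip_uc H) (pH : forall t, per (H t)).
Hypothesis hV : forall t, per (V t) /\ H1loc (H t) (V t).
Hypothesis eH : forall t y, H t y = v0 (U y) + sint (fun s => J s y) 0 t.
Hypothesis eV : forall t y, V t y = g0 (U y) * dicoord c eta y + sint (fun s => L s y) 0 t.

Let uJ : strip_uc J := (strip_uc_char_nonloc c_gt0 wave uH pH).1.
Let uL : strip_uc L := strip_uc_char_dnonloc c_gt0 wave uH.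
Let cH t : continuous (H t) := @strip_uc_continuous _ _ t uH.

(** The solution in the variable u, followed by its derivatives in u and in t. *)
Definition sol t u : R := H t (X u + om * t).
Definition dsol t u : R := V t (X u + om * t) * x u.
Definition tsol t u : R := om * V t (X u + om * t) + B (sol t) u.

Lemma per_sol t : per (sol t).
Proof. by apply: (per_comp_coord c_gt0 wave). Qed.

Lemma per_dsol t : per (dsol t).
Proof.
move=> u; rewrite /dsol per_dcoord//.
by rewrite (per_comp_coord c_gt0 wave (om * t) (hV t).1).
Qed.

Lemma H1loc_sol t : H1loc (sol t) (dsol t).
Proof. exact: (H1loc_along c_gt0 wave (om * t) (hV t).2). Qed.

Lemma continuous_sol t : continuous (sol t).
Proof. exact: H1loc_continuous (H1loc_sol t). Qed.

Lemma per_tsol t : per (tsol t).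
Proof.
move=> u; rewrite /tsol (per_comp_coord c_gt0 wave (om * t) (hV t).1).
by rewrite (per_nonloc (c := c) wave (continuous_sol (t := t)) (@per_sol t)).
Qed.

Lemma loc_sq_tsol t : loc_sq_integrable (tsol t).
Proof.
apply: loc_sqD; first exact/loc_sqZ/(loc_sq_along c_gt0 wave)/(hV t).2.1.
exact/continuous_loc_sq/(continuous_nonloc wave)/(@continuous_sol t).
Qed.

Lemma char_nonloc_along t u : char_nonloc c eta t (H t) (X u + om * t) = B (sol t) u.
Proof. by rewrite /char_nonloc addrK icoordK. Qed.

Lemma incr_H t s y : H (t + s) y - H t y = sint (fun r => J r y) 0 (t + s) - sint (fun r => J r y) 0 t.
Proof. by rewrite !eH; ring. Qed.

Lemma incr_V t s y : V (t + s) y - V t y = sint (fun r => L r y) 0 (t + s) - sint (fun r => L r y) 0 t.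
Proof. by rewrite !eV; ring. Qed.

Lemma continuous_shift (f : R -> R) b : continuous f -> continuous (fun y => f (y + b)).
Proof.
move=> cf y; apply: (@continuous_comp _ _ _ (fun y => y + b) f); last exact: cf.
by apply: cvgD; [exact: cvg_id|exact: cvg_cst].
Qed.

Let om0 : 0 < om := crate_gt0 c_gt0 wave.

Lemma vanish_moving (K : R -> R -> R) t : strip_uc K -> vanish_L2 (fun s y =>
  s^-1 * (sint (fun r => K r (y + om * s)) 0 (t + s) - sint (fun r => K r (y + om * s)) 0 t) - K t y).
Proof.
move=> uK; apply: vanish_L2_unif => [s|e e0].
  have ci r : continuous (fun y => sint (fun r => K r (y + om * s)) 0 r).
    exact: (continuous_shift (b := om * s) (@strip_uc_continuous _ _ r (strip_uc_int uK))).
  move=> y; apply: cvgB; last exact: (@strip_uc_continuous _ _ t uK).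
  by apply: cvgM; [exact: cvg_cst|apply: cvgB; exact: ci].
have [d d0 hd] := strip_uc_int_quotient t uK e0.
exists (Num.min d (d / om)); first by rewrite lt_min d0 divr_gt0.
move=> s y s0; rewrite lt_min ltr_pdivlMr// => /andP[sd so]; apply: hd => //.
by rewrite normrM gtr0_norm// mulrC.
Qed.

(** In the coordinate y the increment of the solution is the sum of an increment
    in time at a moving point, which is a time integral of a continuous function,
    and of the increment of H t under the translation by om s. *)
Lemma vanish_sol_quotient t :
  vanish_L2 (fun s u => s^-1 * (sol (t + s) u - sol t u) - tsol t u).
Proof.
have [pV hH] := hV t; have [lV _] := hH.
pose F1 s y := s^-1 * (H (t + s) (y + om * s) - H t (y + om * s)) - J t y.
pose F2 s y := om * (diffquot (H t) (om * s) y - V t y).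
have [_ pJ] := strip_uc_char_nonloc c_gt0 wave uH pH.
have cF1 s : continuous (F1 s).
  move=> y; apply: cvgB; last exact: (@strip_uc_continuous _ _ t uJ).
  by apply: cvgM; [exact: cvg_cst|apply: cvgB; exact: continuous_shift].
have lF1 s : loc_sq_integrable (F1 s) := continuous_loc_sq (cF1 s).
have lF2 s : loc_sq_integrable (F2 s).
  by apply/loc_sqZ/loc_sqB => //; exact: loc_sq_diffquot.
have pF1 s : per (F1 s) by move=> y; rewrite /F1 addrAC !pH pJ.
have pF2 s : per (F2 s) by move=> y; rewrite /F2 /diffquot pV addrAC !pH.
have h1 : vanish_L2 F1.
  apply: eq_vanish_L2 (vanish_moving t uJ) => s y _; by rewrite /F1 incr_H.
have h2 : vanish_L2 F2.
  apply: vanish_L2M => [u|s|]; first exact: cvg_cst.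
    by apply: loc_sqB => //; exact: loc_sq_diffquot.
  apply: (vanish_L2_scale (F := fun s y => diffquot (H t) s y - V t y)); first by rewrite gt_eqF.
  by move=> e e0; exact: per_diffquot_cvg.
have := vanish_L2_along c_gt0 wave (om * t) (fun s => _) (fun s => loc_sqD (lF1 s) (lF2 s))
  (vanish_L2D lF1 lF2 h1 h2).
move=> /(_ (fun s y => _)) h; apply: eq_vanish_L2 (h _); last first.
  by move=> s y; rewrite pF1 pF2.
move=> s u s0; rewrite /F1 /F2 /diffquot /tsol /sol char_nonloc_along.
have -> : X u + om * t + om * s = X u + om * (t + s) by ring.
rewrite -/(sol t); move: (H _ _) (H _ _) (H _ _) (V _ _) (B _ _) => a1 a2 a3 a4 a5.
by field; rewrite s0 gt_eqF.
Qed.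

Lemma is_time_derivative_sol t : is_time_derivative sol t (tsol t).
Proof.
split; first by apply/L2perP; split; [exact: per_tsol|exact: loc_sq_tsol].
exact/vanish_L2P/vanish_sol_quotient.
Qed.

Lemma L2_deriv_V t : L2_deriv V t (L t).
Proof.
split=> [s||]; first exact: (hV s).2.1.
  exact/continuous_loc_sq/(@strip_uc_continuous _ _ t uL).
apply: (eq_vanish_L2 (F := fun s y => s^-1 * (sint (fun r => L r y) 0 (t + s) - sint (fun r => L r y) 0 t) - L t y)).
  by move=> s y _; rewrite incr_V.
apply: vanish_L2_unif => [s|e e0].
  move=> y; apply: cvgB; last exact: (@strip_uc_continuous _ _ t uL).
  apply: cvgM; first exact: cvg_cst.
  by apply: cvgB; exact: (@strip_uc_continuous _ _ _ (strip_uc_int uL)).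
have [d d0 hd] := strip_uc_int_quotient t uL e0; exists d => // s y s0 sd.
by have := hd s y 0 s0 sd; rewrite addr0 normr0; exact.
Qed.

Lemma vanish_sol_diff t : vanish_L2 (fun s u => sol (t + s) u - sol t u).
Proof.
have us := strip_uc_along c_gt0 wave uH.
apply: vanish_L2_unif => [s u|e e0].
  by apply: cvgB; exact: continuous_sol.
have [d d0 hd] := us.2 (`|t| + 1) e e0; exists (Num.min d 1); first by rewrite lt_min d0 /=.
move=> s u s0; rewrite lt_min => /andP[sd s1]; apply/ltW/hd; rewrite ?subrr ?normr0//.
- by rewrite (le_trans (ler_normD _ _))// lerD2l ltW.
- by rewrite lerDl.
- by rewrite (_ : t + s - t = s)//; ring.
Qed.

(** The increment of V in time is a time integral of a continuous function; the
    rest is a translation of V t by om s. *)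
Lemma vanish_dsol_diff t : vanish_L2 (fun s u => dsol (t + s) u - dsol t u).
Proof.
have [pV [lV _]] := hV t.
pose F1 s y := V (t + s) (y + om * s) - V t (y + om * s).
pose F2 s y := V t (y + om * s) - V t y.
have lF1 s : loc_sq_integrable (F1 s).
  by apply: loc_sqB; apply: loc_sq_shift => //; exact: (hV (t + s)).2.1.
have lF2 s : loc_sq_integrable (F2 s) by apply: loc_sqB => //; exact: loc_sq_shift.
have pF1 s : per (F1 s) by move=> y; rewrite /F1 addrAC (hV (t + s)).1 pV.
have pF2 s : per (F2 s) by move=> y; rewrite /F2 addrAC !pV.
have uI := strip_uc_int uL.
have h1 : vanish_L2 F1.
  apply: (eq_vanish_L2 (F := fun s y => sint (fun r => L r (y + om * s)) 0 (t + s) - sint (fun r => L r (y + om * s)) 0 t)).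
    by move=> s y _; rewrite /F1 incr_V.
  apply: vanish_L2_unif => [s y|e e0].
    by apply: cvgB; apply: (continuous_shift (f := fun z => sint (fun r => L r z) 0 _));
      exact: (@strip_uc_continuous _ _ _ uI).
  have [d d0 hd] := uI.2 (`|t| + 1) e e0; exists (Num.min d 1); first by rewrite lt_min d0 /=.
  move=> s y s0; rewrite lt_min => /andP[sd s1]; apply/ltW/hd; rewrite ?subrr ?normr0//.
  - by rewrite (le_trans (ler_normD _ _))// lerD2l ltW.
  - by rewrite lerDl.
  - by rewrite (_ : t + s - t = s)//; ring.
have h2 : vanish_L2 F2.
  apply: (vanish_L2_scale (F := fun s y => V t (y + s) - V t y)); first by rewrite gt_eqF.
  move=> e e0; have [d d0 hd] := per_shift_cvg pV lV e0.
  by exists d => // s _ sd; exact: hd.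
have pF s : per (fun y => F1 s y + F2 s y) by move=> y; rewrite pF1 pF2.
have lF s := loc_sqD (lF1 s) (lF2 s).
have h := vanish_L2_along c_gt0 wave (om * t) pF lF (vanish_L2D lF1 lF2 h1 h2).
have := vanish_L2M (continuous_dcoord c_gt0 wave) (fun s => loc_sq_along c_gt0 wave (om * t) (lF s)) h.
apply: eq_vanish_L2 => s u _; rewrite /F1 /F2 /dsol.
have -> : X u + om * t + om * s = X u + om * (t + s) by ring.
by ring.
Qed.

Lemma C0_H1_sol : C0_H1 sol.
Proof.
split=> t.
  by apply/H1perP; split; [exact: per_sol|exists (dsol t); split; [exact: per_dsol|exact: H1loc_sol]].
apply/cvg_nbhsP => e e0.
have e2 : 0 < e ^+ 2 / 2 by rewrite divr_gt0// exprn_gt0.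
have [d1 d10 h1] := vanish_sol_diff t e2; have [d2 d20 h2] := vanish_dsol_diff t e2.
exists (Num.min d1 d2); first by rewrite lt_min d10.
move=> s; rewrite lt_min subr0 => /andP[s1 s2].
have hd := H1locB (H1loc_sol s) (H1loc_sol t).
have pd : per (fun u => sol s u - sol t u) by move=> u; rewrite !per_sol.
have pdd : per (fun u => dsol s u - dsol t u) by move=> u; rewrite !per_dsol.
rewrite ger0_norm ?H1norm_ge0// -(@ltr_pXn2r _ 2)// ?nnegrE ?H1norm_ge0 ?(ltW e0)//.
rewrite (H1norm_sqr pd pdd hd) !ip_sint.
have [->|st] := eqVneq s t.
  rewrite !(eq_sint (g := fun=> 0)) ?sint_cst ?mul0r ?addr0 ?exprn_gt0// => u;
  by rewrite subrr mulr0.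
have ts : t + (s - t) = s by ring.
have s0 : s - t != 0 by rewrite subr_eq0.
have := h1 _ s0 s1; have := h2 _ s0 s2; rewrite ts => k2 k1.
rewrite (eq_sint (g := fun u => (sol s u - sol t u) ^+ 2)) => [|u]; last by rewrite expr2.
rewrite (eq_sint (f := fun u => (dsol s u - dsol t u) * (dsol s u - dsol t u))
  (g := fun u => (dsol s u - dsol t u) ^+ 2)) => [|u]; last by rewrite expr2.
by rewrite (splitr (e ^+ 2)) ltrD.
Qed.

Lemma tsol_flux t u : 2 * c * tsol t u = - flux c eta (sol t) (dsol t) u.
Proof.
rewrite /flux /tsol /dsol; have := dcoord_stiff c_gt0 wave u.
move: (V _ _) (B _ _) => a b h.
have -> : p u * (a * x u) = a * (p u * x u) by ring.
by rewrite h; ring.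
Qed.

Lemma linearized_equation_sol : linearized_equation c eta sol.
Proof.
move=> t; exists (tsol t), (flux c eta (sol t) (dsol t)); split.
- exact: is_time_derivative_sol.
- exact: (flux_antiderivative c_gt0 wave (@per_sol t) (@per_dsol t) (H1loc_sol t)).
- exact: tsol_flux.
Qed.

End Candidate.

(** * Constraints, energy estimate and uniqueness *)

Section DerivativeSign.
Variable R : realType.
Implicit Types (f df : R -> R) (a b K : R).

Lemma continuous_const a : continuous (fun _ : R => a).
Proof. by move=> u; exact: cvg_cst. Qed.

Lemma is_derive0_cst f a b : (forall t : R, is_derive t 1 f 0) -> f a = f b.
Proof.
move=> df; apply/esym/eqP; rewrite -subr_eq0.
by rewrite -(sint_derive a b (f := fun=> 0) (@continuous_const 0) df) sint_cst mul0r.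
Qed.

Lemma is_derive_ge0_le f df a b : (forall t : R, is_derive t 1 f (df t)) ->
  (forall t, 0 <= df t) -> a <= b -> f a <= f b.
Proof.
move=> dF d0; rewrite le_eqVlt => /predU1P[->//|ab].
have [t _ e] := MVT ab (fun x _ => dF x) (continuous_subspaceT (is_derive_continuous dF)).
by rewrite -subr_ge0 e mulr_ge0// subr_ge0 ltW.
Qed.

(** exp (- K t) f t is nonincreasing and exp (K t) f t is nondecreasing. *)
Lemma gronwall_zero f df K : (forall t : R, is_derive t 1 f (df t)) ->
  (forall t, 0 <= f t) -> (forall t, `|df t| <= K * f t) -> f 0 = 0 -> forall t, f t = 0.
Proof.
move=> dF f0 dfK f00 t.
have dw (k s : R) : is_derive s 1 (fun s => expR (k * s) * f s) (expR (k * s) * (k * f s + df s)).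
  have := dF s => d; have de : is_derive s 1 (fun s => expR (k * s)) (k * expR (k * s)).
    by apply: is_derive_eq; rewrite /GRing.scale/= mulr1 mulrC.
  by apply: is_derive_eq; rewrite /GRing.scale/=; ring.
apply/eqP; rewrite eq_le f0 andbT; have [t0|/ltW t0] := leP 0 t.
  have dw' (s : R) : is_derive s 1 (fun s => - (expR (- K * s) * f s)) (- (expR (- K * s) * (- K * f s + df s))).
    exact: is_deriveN.
  have := is_derive_ge0_le dw' _ t0; rewrite f00 mulr0 oppr0 oppr_ge0 => h.
  rewrite -(pmulr_rle0 _ (expR_gt0 (- K * t))); apply: h => s.
  rewrite -mulrN mulr_ge0 ?expR_ge0//; have := dfK s; rewrite ler_norml => /andP[]; lra.
have := is_derive_ge0_le (dw K) _ t0; rewrite f00 mulr0 => h.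
rewrite -(pmulr_rle0 _ (expR_gt0 (K * t))); apply: h => s.
rewrite mulr_ge0 ?expR_ge0//; have := dfK s; rewrite ler_norml => /andP[]; lra.
Qed.

End DerivativeSign.

Section Evolution.
Variables (R : realType) (c : R) (eta : R -> R).
Hypotheses (c_gt0 : 0 < c) (wave : single_lobe c eta).
Implicit Types (t s u y a b : R) (v g w q F : R -> R) (h : R -> R -> R).
Local Notation p := (stiff c eta).
Local Notation e1 := (derive1 eta).
Local Notation e2 := (derive1n 2 eta).
Local Notation T := (2 * pi).
Local Notation B := (nonloc c eta).
Local Notation dB := (dnonloc c eta).
Local Notation weight := (weight eta).
Let T0 : 0 < T :> R := twopi_gt0 R.
Let ceta := continuous_eta wave.
Let ce1 := continuous_e1 wave.
Let ce2 := continuous_e2 wave.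
Let cp := continuous_stiff wave.
Let cint (f : R -> R) : continuous f -> loc_integrable f := @continuous_loc_integrable R f.

Lemma per_parts v g w k : per v -> per w -> H1loc v g -> H1loc w k ->
  sint (fun u => v u * k u) 0 T = - sint (fun u => g u * w u) 0 T.
Proof.
move=> pv pw hv hw; rewrite (H1loc_parts 0 T hv hw).
have := pv 0; have := pw 0; rewrite !add0r => -> ->; by rewrite subrr sub0r opprK.
Qed.

(** The antiderivative in the equation is determined almost everywhere, which is
    enough to replace it by [flux] under the integral. *)
Lemma time_derivative_pairing q v g w F : continuous q ->
  per v -> per g -> H1loc v g -> loc_sq_integrable w ->
  is_Pi0_antiderivative (Lop c eta v) F -> (forall u, 2 * c * w u = - F u) ->
  sint (fun u => q u * w u) 0 T =
  (2 * c)^-1 * sint (fun u => q u * (p u * g u)) 0 T + sint (fun u => q u * B v u) 0 T.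
Proof.
move=> cq pv pg hv lw hF wF; have cv := H1loc_continuous hv.
have cB := continuous_nonloc (c := c) wave cv.
have [LF _ _] := hF; have [_ lF] := (L2perP F).1 LF.
have lG : loc_sq_integrable (flux c eta v g) := loc_sq_flux wave hv.
have lD := loc_sq_loc_integrable (loc_sqB lF lG).
have N0 := zero_sintM 0 T lD (fun a b => antiderivative_flux c_gt0 wave pv pg hv a b hF)
  (continuous_measurable_fun cq).
have c0 : 2 * c != 0 by rewrite gt_eqF// mulr_gt0.
have lpg := loc_sqM (continuous_loc_sq cq) (loc_sqMc cp hv.1).
have lqB : loc_integrable (fun u => q u * B v u).
  by apply: cint => u; apply: cvgM; [exact: cq|exact: cB].
have lDq : loc_integrable (fun u => (F u - flux c eta v g u) * q u).
  exact: loc_sqM (loc_sqB lF lG) (continuous_loc_sq cq).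
rewrite (eq_sint (g := fun u => ((2 * c)^-1 * (q u * (p u * g u)) + q u * B v u) -
    (2 * c)^-1 * ((F u - flux c eta v g u) * q u))); last first.
  move=> u; apply: (mulfI c0); rewrite mulrCA wF /flux.
  by move: (F u) (B v u) (p u) (g u) => x1 x2 x3 x4; field; exact: lt0r_neq0.
rewrite sintB; [|by apply: loc_integrableD => //; exact: loc_integrableZ|exact: loc_integrableZ].
rewrite sintZ// N0 mulr0 subr0 sintD//; last exact: loc_integrableZ.
by rewrite sintZ.
Qed.

Section Pairings.
Variables v g w F : R -> R.
Hypotheses (pv : per v) (pg : per g) (hv : H1loc v g) (lw : loc_sq_integrable w).
Hypothesis hF : is_Pi0_antiderivative (Lop c eta v) F.
Hypothesis wF : forall u, 2 * c * w u = - F u.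
Let cv : continuous v := H1loc_continuous hv.
Let pB : per (B v) := per_nonloc (c := c) wave cv pv.
Let hB : H1loc (B v) (dB v) := H1loc_nonloc wave cv.
Let c0 : 2 * c != 0. Proof. by rewrite gt_eqF// mulr_gt0. Qed.

Lemma sint_time_derivative : sint w 0 T = 0.
Proof.
have [LF F0 _] := hF; have [_ lF] := (L2perP F).1 LF.
apply: (mulfI c0); rewrite mulr0 -sintZ; last exact: loc_sq_loc_integrable.
rewrite (eq_sint (g := fun u => - F u))//.
by rewrite sintN; [rewrite -intT_sint F0 oppr0|exact: loc_sq_loc_integrable].
Qed.

Lemma sint_weightM_dnonloc q : continuous q ->
  sint (fun u => q u * dB v u) 0 T =
  (2 * c)^-1 * (sint (fun u => q u * (weight u * v u)) 0 T - wmean eta v * sint q 0 T).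
Proof.
move=> cq; have l1 : loc_integrable (fun u => q u * (weight u * v u)).
  by apply: cint => u; apply: cvgM; [exact: cq|exact: (continuous_weightM wave cv)].
have lq := cint cq.
rewrite -(sintZ (wmean _ _))// -sintB//; last exact: loc_integrableZ.
rewrite -sintZ; last by apply: loc_integrableB => //; exact: loc_integrableZ.
by apply: eq_sint => u; rewrite /dnonloc; ring.
Qed.

(** With (p eta'')' = - eta' (1 - 2 eta''), which is L eta' = 0, the transport and
    the nonlocal contributions cancel. *)
Lemma e2_time_derivative : sint (fun u => e2 u * w u) 0 T = 0.
Proof.
rewrite (time_derivative_pairing ce2 pv pg hv lw hF wF).
have he1 : H1loc e1 e2 := smooth_per_H1loc (smooth_e1 wave).
rewrite (eq_sint (f := fun u => e2 u * B v u) (g := fun u => B v u * e2 u)); last first.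
  by move=> u; rewrite mulrC.
rewrite (per_parts pB (smooth_e1 wave).1 hB he1).
rewrite (eq_sint (f := fun u => dB v u * e1 u) (g := fun u => e1 u * dB v u)); last first.
  by move=> u; rewrite mulrC.
rewrite (sint_weightM_dnonloc ce1).
have hk : H1loc (fun u => p u * e2 u) (fun u => - (e1 u * weight u)).
  have h := H1locB (H1locM he1 he1) (smooth_per_H1loc (wave_smooth wave)).
  have -> : (fun u => p u * e2 u) = (fun u => e1 u * e1 u - eta u).
    by apply/funext => u; rewrite (wave_eq wave) expr2.
  move: h; congr (H1loc _ _); apply/funext => u; rewrite /weight.
  by move: (e2 u) (e1 u) => x1 x2; ring.
have pk : per (fun u => p u * e2 u).
  by move=> u; rewrite (smooth_stiff wave).1 (smooth_e2 wave).1.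
rewrite (eq_sint (f := fun u => e2 u * (p u * g u)) (g := fun u => p u * e2 u * g u)); last first.
  by move=> u; ring.
rewrite (per_parts pk pv hk hv) -sintN; last first.
  exact: loc_sqM hk.1 (continuous_loc_sq cv).
rewrite (eq_sint (f := fun u => - (- (e1 u * weight u) * v u)) (g := fun u => e1 u * (weight u * v u))); last first.
  by move=> u; ring.
have -> : sint e1 0 T = 0 := per_sint_derive (wave_smooth wave).1 ce1 (d_eta wave).
by rewrite mulr0 subr0 subrr.
Qed.

(** The right-hand side is <L eta, v> / (2 c).  The mean in the nonlocal term would
    contribute through int eta, and it vanishes by assumption. *)
Lemma e1_time_derivative : wmean eta v = 0 ->
  sint (fun u => e1 u * w u) 0 T =
  (2 * c)^-1 * sint (fun u => (e1 u ^+ 2 + 2 * eta u * e2 u) * v u) 0 T.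
Proof.
move=> m0; rewrite (time_derivative_pairing ce1 pv pg hv lw hF wF).
have he := smooth_per_H1loc (wave_smooth wave).
have he1 : H1loc e1 e2 := smooth_per_H1loc (smooth_e1 wave).
rewrite (eq_sint (f := fun u => e1 u * B v u) (g := fun u => B v u * e1 u)); last first.
  by move=> u; rewrite mulrC.
rewrite (per_parts pB (wave_smooth wave).1 hB he).
rewrite (eq_sint (f := fun u => dB v u * eta u) (g := fun u => eta u * dB v u)); last first.
  by move=> u; rewrite mulrC.
rewrite (sint_weightM_dnonloc ceta) m0 mul0r subr0.
have hp : H1loc p (fun u => - 2 * e1 u).
  apply: C1_H1loc (d_stiff wave) => u; apply: cvgM; [exact: cvg_cst|exact: ce1].
have hk : H1loc (fun u => p u * e1 u) (fun u => - (e1 u ^+ 2 + eta u)).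
  have := H1locM hp he1; congr (H1loc _ _); apply/funext => u.
  by rewrite (wave_eq wave); ring.
have pk : per (fun u => p u * e1 u).
  by move=> u; rewrite (smooth_stiff wave).1 (smooth_e1 wave).1.
rewrite (eq_sint (f := fun u => e1 u * (p u * g u)) (g := fun u => p u * e1 u * g u)); last first.
  by move=> u; ring.
rewrite (per_parts pk pv hk hv).
have l1 : loc_integrable (fun u => - (e1 u ^+ 2 + eta u) * v u).
  exact: loc_sqM hk.1 (continuous_loc_sq cv).
have l2 : loc_integrable (fun u => eta u * (weight u * v u)).
  by apply: cint => u; apply: cvgM; [exact: ceta|exact: (continuous_weightM wave cv)].
rewrite -mulrN -mulrDr -!sintN//; congr (_ * _); rewrite -sintD; last 2 first.
- exact: loc_integrableN.
- exact: loc_integrableN.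
by apply: eq_sint => u; rewrite /weight; move: (e2 u) => x1; ring.
Qed.

(** p v v' = (p v^2)' / 2 - p' v^2 / 2 with p' = - 2 eta'; no derivative of v is
    lost, which is what makes the energy estimate in L^2 possible. *)
Lemma sint_stiff_transport : sint (fun u => v u * (p u * g u)) 0 T =
  sint (fun u => e1 u * v u ^+ 2) 0 T.
Proof.
have hp : H1loc p (fun u => - 2 * e1 u).
  apply: C1_H1loc (d_stiff wave) => u; apply: cvgM; [exact: cvg_cst|exact: ce1].
have hpv := H1locM hp hv.
have ppv : per (fun u => p u * v u) by move=> u; rewrite (smooth_stiff wave).1 pv.
have := per_parts ppv pv hpv hv.
have l1 : loc_integrable (fun u => v u * (p u * g u)).
  exact: loc_sqM (continuous_loc_sq cv) (loc_sqMc cp hv.1).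
have l2 : loc_integrable (fun u => e1 u * v u ^+ 2).
  by apply: cint => u; apply: cvgM; [exact: ce1|apply: cvgM; exact: cv].
rewrite (eq_sint (g := fun u => v u * (p u * g u))); last by move=> u; ring.
rewrite (eq_sint (f := fun u => (- 2 * e1 u * v u + p u * g u) * v u)
  (g := fun u => - 2 * (e1 u * v u ^+ 2) + v u * (p u * g u))); last by move=> u; ring.
rewrite sintD//; last exact: loc_integrableZ.
rewrite sintZ//; lra.
Qed.

End Pairings.

Lemma H1per_data v : H1per v -> exists g, [/\ per v, per g & H1loc v g].
Proof. by move=> /H1perP[pv [g [pg hv]]]; exists g. Qed.

Lemma time_derivative_L2 h t w : C0_H1 h -> is_time_derivative h t w -> L2_deriv h t w.
Proof.
move=> [hH _] [Lw hw]; split.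
- by move=> s; have [g [_ _ hv]] := H1per_data (hH s); exact/continuous_loc_sq/(H1loc_continuous hv).
- exact: ((L2perP w).1 Lw).2.
- exact/vanish_L2P.
Qed.

Lemma conserved_pairing q h : continuous q -> C0_H1 h -> linearized_equation c eta h ->
  (forall t v g w F, per v -> per g -> H1loc v g -> loc_sq_integrable w ->
    is_Pi0_antiderivative (Lop c eta v) F -> (forall u, 2 * c * w u = - F u) ->
    sint (fun u => q u * w u) 0 T = 0) ->
  forall t, sint (fun u => q u * h t u) 0 T = sint (fun u => q u * h 0 u) 0 T.
Proof.
move=> cq Ch Eh q0 t; apply: (is_derive0_cst (f := fun t => sint (fun u => q u * h t u) 0 T)).
move=> s; have [w [F [hw hF wF]]] := Eh s.
have [g [pv pg hv]] := H1per_data (Ch.1 s).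
have D := time_derivative_L2 Ch hw; have [_ lw _] := D.
have := L2_deriv_pairing (continuous_loc_sq cq) D.
by rewrite (q0 s _ _ _ _ pv pg hv lw hF wF).
Qed.

Lemma conserved_mean h t : C0_H1 h -> linearized_equation c eta h ->
  sint (h t) 0 T = sint (h 0) 0 T.
Proof.
move=> Ch Eh; have c1 : continuous (fun _ : R => 1 : R) by move=> u; exact: cvg_cst.
have E s : sint (h s) 0 T = sint (fun u => 1 * h s u) 0 T.
  by apply: eq_sint => u; rewrite mul1r.
rewrite !E; apply: (conserved_pairing c1 Ch Eh) => r v g w F pv pg hv lw hF wF.
rewrite (eq_sint (g := w)); first exact: sint_time_derivative lw hF wF.
by move=> u; rewrite mul1r.
Qed.

Lemma conserved_e2 h t : C0_H1 h -> linearized_equation c eta h ->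
  sint (fun u => e2 u * h t u) 0 T = sint (fun u => e2 u * h 0 u) 0 T.
Proof.
move=> Ch Eh; apply: conserved_pairing => //.
by move=> r v g w F pv pg hv lw hF wF; exact: e2_time_derivative pv pg hv lw hF wF.
Qed.

(** The square d of the L^2 norm of a difference of solutions satisfies
    |d'| <= K d. *)
Theorem linearized_unique h1 h2 : C0_H1 h1 -> C0_H1 h2 ->
  linearized_equation c eta h1 -> linearized_equation c eta h2 ->
  h1 0 = h2 0 -> h1 = h2.
Proof.
move=> C1 C2 E1 E2 h0.
pose d t u := h1 t u - h2 t u.
pose N t := sint (fun u => d t u ^+ 2) 0 T.
have [M M0 hM] := nonloc_bound c_gt0 wave.
have [E E0 hE] := per_continuous_bounded (smooth_e1 wave).1 ce1.
pose K := E / c + 2 * M * T.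
have dN t : exists2 l, is_derive t 1 N l & `|l| <= K * N t.
  have [w1 [F1 [hw1 hF1 wF1]]] := E1 t; have [w2 [F2 [hw2 hF2 wF2]]] := E2 t.
  have D1 := time_derivative_L2 C1 hw1; have D2 := time_derivative_L2 C2 hw2.
  have [l1 lw1 v1] := D1; have [l2 lw2 v2] := D2.
  have [g1 [pv1 pg1 hv1]] := H1per_data (C1.1 t); have [g2 [pv2 pg2 hv2]] := H1per_data (C2.1 t).
  pose w u := w1 u - w2 u; pose g u := g1 u - g2 u.
  have D : L2_deriv d t w.
    split=> [s||]; [exact: loc_sqB|exact: loc_sqB|].
    have := vanish_L2D (fun s => L2_deriv_rem s D1) (fun s => loc_sqZ (-1) (L2_deriv_rem s D2)) v1.
    move=> /(_ (vanish_L2M (q := fun=> -1) (@continuous_const R (-1)) (fun s => L2_deriv_rem s D2) v2)).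
    by apply: eq_vanish_L2 => s u _; rewrite /d /w; ring.
  have hd : H1loc (d t) g := H1locB hv1 hv2.
  have pd : per (d t) by move=> u; rewrite /d pv1 pv2.
  have pg : per g by move=> u; rewrite /g pg1 pg2.
  have cd := H1loc_continuous hd; have cd2 := H1loc_continuous hv2.
  have cB := continuous_nonloc (c := c) wave cd.
  have lpg := loc_sqM (continuous_loc_sq cd) (loc_sqMc cp hd.1).
  have ldB : loc_integrable (fun u => d t u * B (d t) u).
    by apply: cint => u; apply: cvgM; [exact: cd|exact: cB].
  have ld2 : loc_integrable (fun u => d t u ^+ 2).
    by apply: cint => u; apply: cvgM; exact: cd.
  have dw : sint (fun u => d t u * w u) 0 T =
      (2 * c)^-1 * sint (fun u => e1 u * d t u ^+ 2) 0 T + sint (fun u => d t u * B (d t) u) 0 T.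
    have P1 := time_derivative_pairing cd pv1 pg1 hv1 lw1 hF1 wF1.
    have P2 := time_derivative_pairing cd pv2 pg2 hv2 lw2 hF2 wF2.
    rewrite -(sint_stiff_transport pd hd).
    have nB : B (h1 t) = fun u => B (d t) u + B (h2 t) u.
      rewrite -(nonlocD wave cd cd2); congr (nonloc _ _ _).
      by apply/funext => u; rewrite /d subrK.
    have lq q : loc_sq_integrable q -> loc_integrable (fun u => d t u * q u).
      by move=> lq; exact: loc_sqM (continuous_loc_sq cd) lq.
    have k1 := lq _ (loc_sqMc cp hv1.1); have k2 := lq _ (loc_sqMc cp hv2.1).
    have k3 := lq _ (continuous_loc_sq (continuous_nonloc (c := c) wave (H1loc_continuous hv1))).
    have k4 := lq _ (continuous_loc_sq (continuous_nonloc (c := c) wave cd2)).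
    have m1 : sint (fun u => d t u * w u) 0 T =
        sint (fun u => d t u * w1 u) 0 T - sint (fun u => d t u * w2 u) 0 T.
      rewrite -sintB; [|exact: lq..].
      by apply: eq_sint => u; rewrite /w; ring.
    have m2 : sint (fun u => d t u * (p u * g u)) 0 T =
        sint (fun u => d t u * (p u * g1 u)) 0 T - sint (fun u => d t u * (p u * g2 u)) 0 T.
      rewrite -sintB//; apply: eq_sint => u; rewrite /g; ring.
    have m3 : sint (fun u => d t u * B (d t) u) 0 T =
        sint (fun u => d t u * B (h1 t) u) 0 T - sint (fun u => d t u * B (h2 t) u) 0 T.
      rewrite -sintB//; apply: eq_sint => u; rewrite nB; ring.
    rewrite m1 P1 P2 m2 m3; ring.
  exists (2 * sint (fun u => d t u * w u) 0 T).
    have c1 : continuous (fun _ : R => 1 : R) by move=> u; exact: cvg_cst.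
    have := L2_deriv_square c1 D.
    rewrite (eq_sint (f := fun u => 1 * d t u * w u) (g := fun u => d t u * w u)); last first.
      by move=> u; rewrite mul1r.
    have -> // : (fun s => sint (fun u => 1 * d s u ^+ 2) 0 T) = N.
    by apply/funext => s; apply: eq_sint => u; exact: mul1r.
  rewrite dw.
  have b1 : `|sint (fun u => e1 u * d t u ^+ 2) 0 T| <= E * N t.
    have l3 : loc_integrable (fun u => e1 u * d t u ^+ 2) := loc_integrableMc ce1 ld2.
    apply: le_trans (sint_abs l3 (ltW T0)) _; rewrite /N -sintZ//.
    apply: sint_le; [exact: loc_integrable_norm|exact: loc_integrableZ|exact: ltW|].
    by move=> u _; rewrite normrM (ger0_norm (sqr_ge0 _)) ler_wpM2r ?sqr_ge0.
  have b2 : `|sint (fun u => d t u * B (d t) u) 0 T| <= M * T * N t.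
    have la := loc_integrable_norm (cint cd).
    set S := sint (fun u => `|d t u|) 0 T.
    have S0 : 0 <= S by apply: sint_ge0 => //; exact: ltW.
    apply: le_trans (sint_abs ldB (ltW T0)) _.
    apply: (@le_trans _ _ (M * S * S)).
      rewrite {2}/S -sintZ//; apply: sint_le; [exact: loc_integrable_norm|exact: loc_integrableZ|exact: ltW|].
      by move=> u _; rewrite normrM mulrC ler_wpM2r//; case: (hM _ pd cd u).
    rewrite -(mulrA M S) -(mulrA M T) ler_pM2l// (mulrC T).
    have := cauchy_schwarz (f := fun u => `|d t u|) (g := fun=> 1) (a := 0) (b := T).
    have cn : continuous (fun u => `|d t u|) by move=> u; apply: cvg_norm; exact: cd.
    move=> /(_ (continuous_loc_sq cn) (continuous_loc_sq (@continuous_const R 1)) (ltW T0)).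
    rewrite (eq_sint (f := fun u => `|d t u| * 1) (g := fun u => `|d t u|)); last by move=> u; rewrite mulr1.
    rewrite (eq_sint (f := fun u => `|d t u| ^+ 2) (g := fun u => d t u ^+ 2)); last first.
      by move=> u; rewrite real_normK// num_real.
    by rewrite sint_cst expr1n mul1r subr0 -/S expr2.
  move: (sint (fun u => e1 u * d t u ^+ 2) 0 T) (sint (fun u => d t u * B (d t) u) 0 T) b1 b2 => A D' b1 b2.
  have -> : 2 * ((2 * c)^-1 * A + D') = A / c + 2 * D' by field; exact: lt0r_neq0.
  apply: le_trans (ler_normD _ _) _; rewrite !normrM normfV (gtr0_norm c_gt0) (ger0_norm (ler0n _ 2)).
  have -> : K * N t = E * N t / c + 2 * (M * T * N t) by rewrite /K; ring.
  by apply: lerD; [rewrite ler_pM2r ?invr_gt0|rewrite ler_pM2l].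
have N0 t : N t = 0.
  have /choice [l hl] s : exists l, is_derive s 1 N l /\ `|l| <= K * N s.
    by have [l] := dN s; exists l.
  have NN s : 0 <= N s := sint_sq_ge0 (d s).
  apply: (gronwall_zero (fun s => (hl s).1) NN (fun s => (hl s).2)).
  rewrite /N (eq_sint (g := fun=> 0)) ?sint_cst ?mul0r// => u.
  by rewrite /d h0 subrr expr0n.
apply/funext => t; apply/funext => u; apply/eqP; rewrite -subr_eq0; apply/eqP.
have [g1 [pv1 pg1 hv1]] := H1per_data (C1.1 t); have [g2 [pv2 pg2 hv2]] := H1per_data (C2.1 t).
have hd := H1locB hv1 hv2; have cd := H1loc_continuous hd.
apply: (@per_orthogonal_smooth R (d t)) => // [y|phi sp]; first by rewrite /d pv1 pv2.
have := cauchy_schwarz (continuous_loc_sq cd) (continuous_loc_sq (smooth_per_continuous sp)) (ltW T0).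
rewrite -/(N t) N0 mul0r => h; apply/eqP.
by rewrite -sqrf_eq0 eq_le h sqr_ge0.
Qed.

End Evolution.

(** * The translation mode *)

Section TranslationMode.
Variables (R : realType) (c : R) (eta : R -> R).
Hypotheses (c_gt0 : 0 < c) (wave : single_lobe c eta).
Implicit Types (u a b k : R) (v g : R -> R).
Local Notation p := (stiff c eta).
Local Notation e1 := (derive1 eta).
Local Notation e2 := (derive1n 2 eta).
Local Notation T := (2 * pi).
Local Notation fd := (form_density c eta).
Let T0 : 0 < T :> R := twopi_gt0 R.
Let ceta := continuous_eta wave.
Let ce1 := continuous_e1 wave.
Let ce2 := continuous_e2 wave.
Let cp := continuous_stiff wave.
Let cint (f : R -> R) : continuous f -> loc_integrable f := @continuous_loc_integrable R f.
Let he1 : H1loc e1 e2 := smooth_per_H1loc (smooth_e1 wave).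

Lemma sint_e1 : sint e1 0 T = 0.
Proof. exact: per_sint_derive (wave_smooth wave).1 ce1 (d_eta wave). Qed.

Lemma sint_e2_e1 : sint (fun u => e2 u * e1 u) 0 T = 0.
Proof.
have p1 := (smooth_e1 wave).1.
have := per_parts p1 p1 he1 he1.
rewrite (eq_sint (g := fun u => e2 u * e1 u)) => [|u]; last by rewrite mulrC.
move=> h; lra.
Qed.

(** L eta, by the profile equation. *)
Definition drift_density u : R := e1 u ^+ 2 + 2 * eta u * e2 u.

Lemma continuous_drift_density : continuous drift_density.
Proof.
move=> u; apply: cvgD; first by apply: cvgM; exact: ce1.
by apply: cvgM; [apply: cvgM; [exact: cvg_cst|exact: ceta]|exact: ce2].
Qed.

(** (eta'^2 + 2 eta eta'') eta' is the derivative of eta eta'^2. *)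
Lemma sint_drift_density_e1 : sint (fun u => drift_density u * e1 u) 0 T = 0.
Proof.
have sm := smooth_perM (wave_smooth wave) (smooth_perM (smooth_e1 wave) (smooth_e1 wave)).
apply: (per_sint_derive (f := fun u => eta u * (e1 u * e1 u))) => [|u|u]; first exact: sm.1.
  by apply: cvgM; [exact: continuous_drift_density|exact: ce1].
have d0 := d_eta wave u; have d1 := d_e1 wave u.
apply: is_derive_eq; rewrite /GRing.scale /= /drift_density.
rewrite -[derive1 (derive1 eta) u]/(e2 u); move: (e2 u) => x; ring.
Qed.

(** In the form L eta' = 0. *)
Lemma H1loc_stiff_e2 : H1loc (fun u => p u * e2 u) (fun u => (2 * e2 u - 1) * e1 u).
Proof.
have h := H1locB (H1locM he1 he1) (smooth_per_H1loc (wave_smooth wave)).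
have -> : (fun u => p u * e2 u) = (fun u => e1 u * e1 u - eta u).
  by apply/funext => u; rewrite (wave_eq wave) expr2.
move: h; congr (H1loc _ _); apply/funext => u.
by move: (e2 u) (e1 u) => x1 x2; ring.
Qed.

(** The cross term is int v (L eta') = 0, and so is the form at eta' itself. *)
Lemma form_translation_invariant v g k : per v -> H1loc v g ->
  sint (fd (fun u => v u - k * e1 u) (fun u => g u - k * e2 u)) 0 T = sint (fd v g) 0 T.
Proof.
move=> pv hv; have hn := H1locZ (- k) he1.
have pn : per (fun u => - k * e1 u) by move=> u; rewrite (smooth_e1 wave).1.
have pm : per (fun u => - k * e2 u) by move=> u; rewrite (smooth_e2 wave).1.
have hl : H1loc (fun u => p u * (- k * e2 u)) (fun u => (2 * e2 u - 1) * (- k * e1 u)).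
  have := H1locZ (- k) H1loc_stiff_e2; congr (H1loc _ _); apply/funext => u; last by ring.
  by move: (e2 u) => x; ring.
have cross w l : per w -> H1loc w l ->
    sint (fun u => p u * l u * (- k * e2 u) + (2 * e2 u - 1) * w u * (- k * e1 u)) 0 T = 0.
  move=> pw hw; rewrite (form_cross wave pw hw pm hn hl).
  rewrite (eq_sint (g := fun=> 0)) ?sint_cst ?mul0r// => u; by rewrite subrr mulr0.
have := form_expand wave 0 T hv hn.
rewrite (cross _ _ pv hv) mulr0 addr0.
have -> : sint (fd (fun u => - k * e1 u) (fun u => - k * e2 u)) 0 T = 0.
  rewrite -[RHS](cross _ _ pn hn); apply: eq_sint => u; rewrite /form_density; ring.
rewrite addr0 => <-; apply: eq_sint => u; rewrite /form_density.
by move: (e2 u) => x; ring.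
Qed.

Lemma form_le : exists2 K : R, 0 < K & forall v g, per v -> per g -> H1loc v g ->
  sint (fd v g) 0 T <= K * H1norm v ^+ 2.
Proof.
have [P P0 hP] := continuous_bounded_itv 0 T cp.
have [Q Q0 hQ] := continuous_bounded_itv 0 T (continuous_potential wave).
exists (P + Q) => [|v g pv pg hv]; first by rewrite addr_gt0.
have cv := H1loc_continuous hv; have [_ lg] := hv.1; have [_ lv] := continuous_loc_sq cv.
rewrite (H1norm_sqr pv pg hv) !ip_sint.
rewrite (eq_sint (f := fun u => v u * v u) (g := fun u => v u ^+ 2)); last by move=> u; rewrite expr2.
rewrite (eq_sint (f := fun u => g u * g u) (g := fun u => g u ^+ 2)); last by move=> u; rewrite expr2.
rewrite -sintD// -sintZ; last exact: loc_integrableD.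
apply: sint_le; [exact: loc_form_density|by apply: loc_integrableZ; exact: loc_integrableD|exact: ltW|].
move=> u uT; rewrite /form_density.
have h1 : p u * g u ^+ 2 <= P * g u ^+ 2.
  by rewrite ler_wpM2r ?sqr_ge0// (le_trans (ler_norm _) (hP u uT)).
have h2 : (2 * e2 u - 1) * v u ^+ 2 <= Q * v u ^+ 2.
  by rewrite ler_wpM2r ?sqr_ge0// (le_trans (ler_norm _) (hQ u uT)).
have h3 : 0 <= P * v u ^+ 2 by rewrite mulr_ge0 ?sqr_ge0// ltW.
have h4 : 0 <= Q * g u ^+ 2 by rewrite mulr_ge0 ?sqr_ge0// ltW.
have -> : (P + Q) * (v u ^+ 2 + g u ^+ 2) = (P * g u ^+ 2 + Q * v u ^+ 2) + (P * v u ^+ 2 + Q * g u ^+ 2) by ring.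
by rewrite ler_wpDr ?addr_ge0// lerD.
Qed.

Lemma le_sqrt_mul (q n m : R) : 0 <= q -> 0 <= m -> n ^+ 2 <= q * m ^+ 2 ->
  n <= Num.sqrt q * m.
Proof.
move=> q0 m0 h; have [n0|/ltW n0] := leP n 0; first by rewrite (le_trans n0)// mulr_ge0// sqrtr_ge0.
by rewrite -(@ler_pXn2r _ 2)// ?nnegrE ?mulr_ge0 ?sqrtr_ge0// exprMn sqr_sqrtr.
Qed.

(** To be applied with w the initial perturbation and v the perturbation at time t:
    equality of their forms and coercivity bound v - k eta' by w. *)
Lemma orthogonal_part_bound : exists2 C : R, 0 < C & forall v g w f k,
  per v -> per g -> H1loc v g -> per w -> per f -> H1loc w f ->
  sint v 0 T = 0 -> sint (fun u => e2 u * v u) 0 T = 0 ->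
  sint (fun u => e1 u * (v u - k * e1 u)) 0 T = 0 ->
  sint (fd v g) 0 T = sint (fd w f) 0 T ->
  H1norm (fun u => v u - k * e1 u) <= C * H1norm w.
Proof.
have [K K0 hK] := form_le; have [C C0 hC] := coercive c_gt0 wave.
have CK : 0 < C * K by rewrite mulr_gt0.
exists (Num.sqrt (C * K)) => [|v g w f k pv pg hv pw pf hw v1 v2 v3 E]; first by rewrite sqrtr_gt0.
have hy := H1locB hv (H1locZ k he1).
have py : per (fun u => v u - k * e1 u) by move=> u; rewrite pv (smooth_e1 wave).1.
have pdy : per (fun u => g u - k * e2 u) by move=> u; rewrite pg (smooth_e2 wave).1.
have cv := H1loc_continuous hv.
have l1 : loc_integrable (fun u => e2 u * v u) by apply: cint => u; apply: cvgM; [exact: ce2|exact: cv].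
have l2 : loc_integrable (fun u => e2 u * e1 u) by apply: cint => u; apply: cvgM; [exact: ce2|exact: ce1].
have y1 : sint (fun u => v u - k * e1 u) 0 T = 0.
  rewrite sintB; [|exact: cint|exact/loc_integrableZ/cint].
  by rewrite sintZ ?sint_e1 ?mulr0 ?subr0//; exact: cint.
have y2 : sint (fun u => e2 u * (v u - k * e1 u)) 0 T = 0.
  rewrite (eq_sint (g := fun u => e2 u * v u - k * (e2 u * e1 u))) => [|u]; last by move: (e2 u) => x; ring.
  by rewrite sintB//; [rewrite sintZ// v2 sint_e2_e1 mulr0 subrr|exact: loc_integrableZ].
have := hC _ _ py hy y1 y2 v3; rewrite form_translation_invariant// E => h.
apply: le_sqrt_mul; [exact: ltW|exact: H1norm_ge0|].
apply: le_trans (_ : C * sint (fd w f) 0 T <= _); last by rewrite -mulrA ler_pM2l// hK.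
apply: le_trans h; have -> := H1norm_sqr py pdy hy; rewrite !ip_sint.
rewrite (eq_sint (f := fun u => (v u - k * e1 u) * _) (g := fun u => (v u - k * e1 u) ^+ 2)); last by move=> u; rewrite expr2.
rewrite (eq_sint (f := fun u => (g u - k * e2 u) * _) (g := fun u => (g u - k * e2 u) ^+ 2)); last by move=> u; rewrite expr2.
by [].
Qed.

End TranslationMode.

(** * Conservation of the quadratic form *)

Section Conservation.
Variables (R : realType) (c : R) (eta : R -> R).
Hypotheses (c_gt0 : 0 < c) (wave : single_lobe c eta).
Implicit Types (t s u y a b e d : R) (v w : R -> R).
Local Notation p := (stiff c eta).
Local Notation e1 := (derive1 eta).
Local Notation e2 := (derive1n 2 eta).
Local Notation T := (2 * pi).
Local Notation om := (crate c eta).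
Local Notation X := (coord c eta).
Local Notation x := (dcoord c eta).
Local Notation U := (icoord c eta).
Local Notation B := (nonloc c eta).
Local Notation dB := (dnonloc c eta).
Local Notation fd := (form_density c eta).
Let T0 : 0 < T :> R := twopi_gt0 R.
Let cint (f : R -> R) : continuous f -> loc_integrable f := @continuous_loc_integrable R f.

Variables (v0 g0 : R -> R) (H V : R -> R -> R).
Local Notation J := (fun s => char_nonloc c eta s (H s)).
Local Notation L := (fun s => char_dnonloc c eta s (H s)).
Hypotheses (uH : strip_uc H) (pH : forall t, per (H t)).
Hypothesis hV : forall t, per (V t) /\ H1loc (H t) (V t).
Hypothesis eH : forall t y, H t y = v0 (U y) + sint (fun s => J s y) 0 t.
Hypothesis eV : forall t y, V t y = g0 (U y) * dicoord c eta y + sint (fun s => L s y) 0 t.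
Local Notation sol := (sol c eta H).
Local Notation dsol := (dsol c eta V).
Local Notation tsol := (tsol c eta H V).
Let csol t : continuous (sol t) := continuous_sol c_gt0 wave hV (t := t).
Let psol t : per (sol t) := per_sol c_gt0 wave pH t.

(** In the coordinate y the leading term int p h_u^2 becomes a multiple of
    int V^2, because p X' is constant. *)
Lemma form_sol t : sint (fd (sol t) (dsol t)) 0 T =
  om * (2 * c) * sint (fun y => 1 * V t y ^+ 2) 0 T +
  sint (fun u => (2 * e2 u - 1) * sol t u ^+ 2) 0 T.
Proof.
have [pV [lV _]] := hV t; have [_ lV2] := lV.
have pV2 : per (fun y => 1 * V t y ^+ 2) by move=> y; rewrite pV.
have l1 := loc_integrableZ 1 lV2.
have l2 := loc_integrable_diffeo (coord_diffeo c_gt0 wave) (loc_integrable_shift (om * t) l1).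
rewrite -(sint_along c_gt0 wave (om * t) pV2 l1) -sintZ// -sintD; last 2 first.
- exact: loc_integrableZ.
- apply: loc_integrableMc; first exact: (continuous_potential wave).
  by apply: cint => u; apply: cvgM; exact: csol.
apply: eq_sint => u; rewrite /form_density /dsol; congr (_ + _).
by rewrite -(dcoord_stiff c_gt0 wave u); ring.
Qed.

Lemma L2_deriv_sol t : L2_deriv sol t (tsol t).
Proof.
split; first by move=> s; exact: continuous_loc_sq.
  exact: (loc_sq_tsol c_gt0 wave hV).
exact: (vanish_sol_quotient c_gt0 wave uH pH hV eH).
Qed.

(** Substitute om V = h_t - B h; the contribution of B h is int (B h) (B h)', which
    vanishes by periodicity. *)
Lemma sint_V_dchar t : wmean eta (sol t) = 0 ->
  om * (2 * c) * sint (fun y => 1 * V t y * L t y) 0 T =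
  sint (fun u => weight eta u * sol t u * tsol t u) 0 T.
Proof.
move=> m0; have [pV [lV _]] := hV t.
have cL := @strip_uc_continuous _ _ t (strip_uc_char_dnonloc c_gt0 wave uH).
have cH := @strip_uc_continuous _ _ t uH.
have pL : per (L t) := per_char_dnonloc c_gt0 wave t (pH t) cH.
have l1 : loc_integrable (fun y => 1 * V t y * L t y).
  exact: loc_sqM (loc_sqZ 1 lV) (continuous_loc_sq cL).
have pVL : per (fun y => 1 * V t y * L t y) by move=> y; rewrite pV pL.
have cB := continuous_nonloc (c := c) wave (csol (t := t)).
have cdB := continuous_dnonloc (c := c) wave (csol (t := t)).
have lw := loc_sq_tsol c_gt0 wave hV t.
have l2 : loc_integrable (fun u => tsol t u * dB (sol t) u) := loc_sqM lw (continuous_loc_sq cdB).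
have l3 : loc_integrable (fun u => B (sol t) u * dB (sol t) u).
  exact: loc_sqM (continuous_loc_sq cB) (continuous_loc_sq cdB).
have BdB : sint (fun u => B (sol t) u * dB (sol t) u) 0 T = 0.
  have pB := per_nonloc (c := c) wave (csol (t := t)) (@psol t).
  have hB := H1loc_nonloc (c := c) wave (csol (t := t)).
  have := per_parts pB pB hB hB.
  rewrite (eq_sint (f := fun u => dB (sol t) u * B (sol t) u)
    (g := fun u => B (sol t) u * dB (sol t) u)) => [h|u]; [lra|by rewrite mulrC].
have c2 : 2 * c != 0 by rewrite gt_eqF// mulr_gt0.
transitivity (2 * c * (sint (fun u => tsol t u * dB (sol t) u) 0 T -
   sint (fun u => B (sol t) u * dB (sol t) u) 0 T)).
  rewrite mulrAC [LHS]mulrC; congr (_ * _).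
  rewrite -(sint_along c_gt0 wave (om * t) pVL l1) -sintB//.
  rewrite -sintZ; last first.
    exact: loc_integrable_diffeo (coord_diffeo c_gt0 wave) (loc_integrable_shift (om * t) l1).
  apply: eq_sint => u; rewrite /char_dnonloc addrK /dicoord icoordK// /tsol -/(sol t).
  have := dcoord_gt0 c_gt0 wave u; move: (x u) (V _ _) (dB _ _) (B _ _) => q a b d q0.
  by field; rewrite gt_eqF.
rewrite BdB subr0 -sintZ//; apply: eq_sint => u.
by rewrite /dnonloc m0 subr0; move: (tsol t u) => a; field; exact: lt0r_neq0.
Qed.

(** H^1 solutions are not regular enough to differentiate int p h_u^2 directly, but
    V is differentiable in time.  By [sint_V_dchar] its contribution is
    2 int (1 - 2 eta'') h h_t, which cancels the derivative of the lower order term. *)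
Lemma form_conserved : (forall t, wmean eta (sol t) = 0) -> forall t,
  sint (fd (sol t) (dsol t)) 0 T = sint (fd (sol 0) (dsol 0)) 0 T.
Proof.
move=> m0 t; rewrite !form_sol.
apply: (is_derive0_cst (f := fun t => om * (2 * c) * sint (fun y => 1 * V t y ^+ 2) 0 T +
  sint (fun u => (2 * e2 u - 1) * sol t u ^+ 2) 0 T)) => s.
have d1 := L2_deriv_square (@continuous_const R 1) (L2_deriv_V c_gt0 wave uH hV eV s).
have d2 := L2_deriv_square (continuous_potential wave) (L2_deriv_sol s).
have d3 := is_deriveZ (om * (2 * c)) d1.
have := is_deriveD d3 d2.
suff -> : om * (2 * c) *: (2 * sint (fun u => 1 * V s u * L s u) 0 T) +
   2 * sint (fun u => (2 * e2 u - 1) * sol s u * tsol s u) 0 T = 0 by [].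
rewrite /GRing.scale /= mulrCA -mulrDr (sint_V_dchar (m0 s)).
have lw := loc_sq_tsol c_gt0 wave hV s.
have l1 : loc_integrable (fun u => weight eta u * sol s u * tsol s u).
  exact: loc_sqM (continuous_loc_sq (continuous_weightM wave (csol (t := s)))) lw.
have l2 : loc_integrable (fun u => (2 * e2 u - 1) * sol s u * tsol s u).
  exact: loc_sqM (loc_sqMc (continuous_potential wave) (continuous_loc_sq (csol (t := s)))) lw.
rewrite -sintD// (eq_sint (g := fun=> 0)) ?sint_cst ?mul0r ?mulr0// => u.
by rewrite /weight -[derive1 (derive1 eta) u]/(e2 u); move: (e2 u) => a; ring.
Qed.

End Conservation.

(** * Modulation *)

Section Modulation.
Variables (R : realType) (c : R) (eta : R -> R).
Hypotheses (c_gt0 : 0 < c) (wave : single_lobe c eta).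
Implicit Types (t s u k : R) (v g w : R -> R) (h : R -> R -> R) (a : R -> R).
Local Notation e1 := (derive1 eta).
Local Notation e2 := (derive1n 2 eta).
Local Notation T := (2 * pi).
Local Notation fd := (form_density c eta).
Local Notation drift := (drift_density eta).
Local Notation E1 := (sint (fun u => e1 u ^+ 2) 0 T).
Let T0 : 0 < T :> R := twopi_gt0 R.
Let ce1 := continuous_e1 wave.
Let ce2 := continuous_e2 wave.
Let cint (f : R -> R) : continuous f -> loc_integrable f := @continuous_loc_integrable R f.
Let E1_gt0 : 0 < E1 := sint_e1sq_gt0 c_gt0 wave.

Lemma pairing_e1_sub v k : continuous v ->
  sint (fun u => e1 u * (v u - k * e1 u)) 0 T = sint (fun u => e1 u * v u) 0 T - k * E1.
Proof.
move=> cv; rewrite -sintZ; last by apply: cint => u; apply: cvgM; exact: ce1.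
rewrite -sintB; last 2 first.
- by apply: cint => u; apply: cvgM; [exact: ce1|exact: cv].
- by apply/loc_integrableZ/cint => u; apply: cvgM; exact: ce1.
by apply: eq_sint => u; ring.
Qed.

(** The coefficient of the L^2 projection of h t onto eta'. *)
Definition modulation h t : R := sint (fun u => e1 u * h t u) 0 T / E1.

Lemma modulation_unique h a t : (forall t, continuous (h t)) ->
  ip e1 (fun u => h t u - a t * e1 u) = 0 -> a t = modulation h t.
Proof.
move=> ch; rewrite ip_sint pairing_e1_sub// => /eqP; rewrite subr_eq0 => /eqP e.
by rewrite /modulation e mulfK// gt_eqF.
Qed.

Lemma modulation_orthogonal h t : continuous (h t) ->
  sint (fun u => e1 u * (h t u - modulation h t * e1 u)) 0 T = 0.
Proof. by move=> ch; rewrite pairing_e1_sub// /modulation divfK ?subrr// gt_eqF. Qed.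

Definition dmodulation h t : R :=
  (2 * c)^-1 * sint (fun u => drift u * h t u) 0 T / E1.

Lemma d_modulation h t : C0_H1 h -> linearized_equation c eta h ->
  wmean eta (h t) = 0 -> is_derive t 1 (modulation h) (dmodulation h t).
Proof.
move=> Ch Eh m0; have [w [F [hw hF wF]]] := Eh t.
have [g [pv pg hv]] := H1per_data (Ch.1 t).
have D := time_derivative_L2 Ch hw; have [_ lw _] := D.
have d := L2_deriv_pairing (continuous_loc_sq ce1) D.
rewrite (e1_time_derivative c_gt0 wave pv pg hv lw hF wF m0) in d.
have := is_deriveZ E1^-1 d; rewrite /dmodulation [_ / E1]mulrC.
have E : E1^-1 \*: (fun t => sint (fun u => e1 u * h t u) 0 T) = modulation h.
  apply/funext => s; rewrite /modulation.
  exact: (mulrC E1^-1).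
by rewrite E.
Qed.

(** As <L eta, eta'> = 0, any multiple of eta' can be subtracted from h t. *)
Lemma dmodulation_bound : exists2 C : R, 0 < C & forall h t g k, per (h t) -> per g ->
  H1loc (h t) g -> `|dmodulation h t| <= C * H1norm (fun u => h t u - k * e1 u).
Proof.
have cd := continuous_drift_density wave.
set Q := sint (fun u => drift u ^+ 2) 0 T.
have Q0 : 0 <= Q := sint_sq_ge0 drift.
have cE : 0 < (2 * c)^-1 / E1 by rewrite divr_gt0// invr_gt0 mulr_gt0.
exists ((2 * c)^-1 / E1 * Num.sqrt (Q + 1)) => [|h t g k pv pg hv].
  by rewrite mulr_gt0// sqrtr_gt0 ltr_wpDl.
have he1 := smooth_per_H1loc (smooth_e1 wave).
have hy := H1locB hv (H1locZ k he1).
have py : per (fun u => h t u - k * e1 u) by move=> u; rewrite pv (smooth_e1 wave).1.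
have pdy : per (fun u => g u - k * derive1 e1 u).
  by move=> u; rewrite pg (smooth_per_derive1 (smooth_e1 wave)).1.
have cy := H1loc_continuous hy; have cv := H1loc_continuous hv.
have -> : dmodulation h t = (2 * c)^-1 / E1 * sint (fun u => drift u * (h t u - k * e1 u)) 0 T.
  rewrite (eq_sint (f := fun u => drift u * (h t u - k * e1 u)) (g := fun u => drift u * h t u - k * (drift u * e1 u))); last by move=> u; ring.
  have l1 : loc_integrable (fun u => drift u * e1 u) by apply: cint => u; apply: cvgM; [exact: cd|exact: ce1].
  rewrite sintB; last 2 first.
  - by apply: cint => u; apply: cvgM; [exact: cd|exact: cv].
  - exact: loc_integrableZ.
  by rewrite sintZ// (sint_drift_density_e1 wave) mulr0 subr0 /dmodulation mulrAC.
rewrite normrM (gtr0_norm cE) -[leRHS]mulrA ler_pM2l//.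
apply: le_sqrt_mul; [by rewrite addr_ge0|exact: H1norm_ge0|].
rewrite real_normK ?num_real//.
apply: le_trans (cauchy_schwarz (continuous_loc_sq cd) (continuous_loc_sq cy) (ltW T0)) _.
have -> := H1norm_sqr py pdy hy.
rewrite [ip _ _]ip_sint -/Q.
rewrite (eq_sint (f := fun u => (h t u - k * e1 u) * _) (g := fun u => (h t u - k * e1 u) ^+ 2)); last by move=> u; rewrite expr2.
set S := sint _ 0 T; have S0 : 0 <= S := sint_sq_ge0 _.
have := ip_ge0 (fun u => g u - k * derive1 e1 u); move: (ip _ _) => G G0.
have -> : (Q + 1) * (S + G) = Q * S + (Q * G + S + G) by ring.
by rewrite lerDl !addr_ge0// mulr_ge0.
Qed.

End Modulation.

(** * The theorem *)

Section Solution.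
Variables (R : realType) (c : R) (eta : R -> R).
Hypotheses (c_gt0 : 0 < c) (wave : single_lobe c eta).
Local Notation e1 := (derive1 eta).
Local Notation e2 := (derive1n 2 eta).
Local Notation T := (2 * pi).
Local Notation fd := (form_density c eta).
Let T0 : 0 < T :> R := twopi_gt0 R.
Let cint (f : R -> R) : continuous f -> loc_integrable f := @continuous_loc_integrable R f.

Lemma wmean_zero (v : R -> R) : continuous v -> sint v 0 T = 0 ->
  sint (fun u => e2 u * v u) 0 T = 0 -> wmean eta v = 0.
Proof.
move=> cv v1 v2; rewrite /wmean.
have l2 : loc_integrable (fun u => e2 u * v u).
  by apply: cint => u; apply: cvgM; [exact: (continuous_e2 wave)|exact: cv].
rewrite (eq_sint (g := fun u => v u - 2 * (e2 u * v u))).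
  rewrite sintB; [|exact: cint|exact: loc_integrableZ].
  by rewrite sintZ// v1 v2 mulr0 subr0 mul0r.
by move=> u; rewrite /weight; move: (e2 u) => x; ring.
Qed.

Theorem linearized_exists (h0 : R -> R) : H1per h0 -> sint h0 0 T = 0 ->
  sint (fun u => e2 u * h0 u) 0 T = 0 -> exists h g : R -> R -> R,
  [/\ linearized_solution c eta h0 h, strip_uc h,
      forall t, [/\ per (h t), per (g t) & H1loc (h t) (g t)],
      forall t, sint (h t) 0 T = 0 /\ sint (fun u => e2 u * h t u) 0 T = 0 &
      forall t, sint (fd (h t) (g t)) 0 T = sint (fd (h 0) (g 0)) 0 T].
Proof.
move=> /H1per_data[g0 [pv pg hv]] m1 m2.
have [H [V [uH pH hV eH eV]]] := characteristic_solution c_gt0 wave pv pg hv.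
pose h := sol c eta H; pose g := dsol c eta V.
have Ch : C0_H1 h := C0_H1_sol c_gt0 wave uH pH hV eV.
have Eh : linearized_equation c eta h := linearized_equation_sol c_gt0 wave uH pH hV eH.
have hh0 : h 0 = h0.
  apply/funext => u; rewrite /h /sol mulr0 addr0 eH sintxx addr0.
  by rewrite icoordK.
have k1 t : sint (h t) 0 T = 0 by rewrite (conserved_mean c_gt0 t Ch Eh) hh0.
have k2 t : sint (fun u => e2 u * h t u) 0 T = 0.
  by rewrite (conserved_e2 c_gt0 wave t Ch Eh) hh0.
have hd t : [/\ per (h t), per (g t) & H1loc (h t) (g t)].
  by split; [exact: per_sol|exact: per_dsol|exact: H1loc_sol].
have ch t : continuous (h t) by have [_ _ ht] := hd t; exact: H1loc_continuous ht.
have wm t : wmean eta (h t) = 0 by apply: wmean_zero.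
exists h, g; split=> //.
- split=> // t; rewrite ip_sint -[LHS](divfK (_ : T != 0)) ?gt_eqF//.
  by rewrite -/(wmean eta (h t)) wm mul0r.
- exact: strip_uc_along.
- exact: (form_conserved c_gt0 wave uH pH hV eH eV wm).
Qed.

End Solution.

Theorem theorem2 (R : realType) (c : R) (eta : R -> R)
  (c_gt1 : 1 < c) (c_lt : c < c_star R) (eta_wave : single_lobe c eta) :
  exists C : R, 0 < C /\
    forall h0 : R -> R,
      H1per h0 ->
      ip (fun=> 1) h0 = 0 ->
      ip (derive1n 2 eta) h0 = 0 ->
      exists h : R -> R -> R,
        unique (linearized_solution c eta h0) h /\
        exists! a : R -> R,
          [/\ is_modulation eta h a,
              forall t, H1norm (fun u => h t u - a t * derive1 eta u)
                        <= C * H1norm h0 &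
              forall t, `|derive1 a t| <= C * H1norm h0].
Proof.
have c_gt0 : 0 < c := lt_trans ltr01 c_gt1.
have wave := eta_wave.
have [C1 C1_gt0 hC1] := orthogonal_part_bound c_gt0 wave.
have [C2 C2_gt0 hC2] := dmodulation_bound c_gt0 wave.
exists (C1 + C2 * C1); split; first by rewrite addr_gt0// mulr_gt0.
move=> h0 Hh0; rewrite !ip_sint => m1 m2.
have {}m1 : sint h0 0 (2 * pi) = 0.
  by rewrite -[RHS]m1; apply: eq_sint => u; rewrite mul1r.
have [h [g [hsol uh hd k fc]]] := linearized_exists c_gt0 wave Hh0 m1 m2.
have [Ch Eh _ hh0] := hsol.
have ch t : continuous (h t) by have [_ _ ht] := hd t; exact: H1loc_continuous ht.
have wm t : wmean eta (h t) = 0 by have [k1 k2] := k t; apply: (wmean_zero wave).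
pose a := modulation eta h.
have da (t : R) : is_derive t 1 a (dmodulation c eta h t) := d_modulation c_gt0 wave Ch Eh (wm t).
have daE : derive1 a = dmodulation c eta h.
  by apply/funext => t; rewrite derive1E; have d := da t; rewrite derive_val.
have yb t : H1norm (fun u => h t u - a t * derive1 eta u) <= C1 * H1norm h0.
  have [pv pg hv] := hd t; have [pv0 pg0 hv0] := hd 0; have [k1 k2] := k t.
  rewrite -hh0; apply: (hC1 _ _ _ _ _ pv pg hv pv0 pg0 hv0) => //.
  exact: (modulation_orthogonal c_gt0 wave (ch t)).
have N0 := H1norm_ge0 h0.
exists h; split.
  split=> // h' [Ch' Eh' _ hh0'].
  by apply: (linearized_unique c_gt0 wave Ch Ch' Eh Eh'); rewrite hh0 hh0'.
exists a; split.
  split.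
  - split.
      split; first by move=> t; have [] := da t.
      rewrite daE; have uq := strip_uc_sint (continuous_drift_density wave) uh.
      have cq := @strip_uc_continuous_time _ _ 0 uq.
      move=> t; apply: cvgM; last exact: cvg_cst.
      by apply: cvgM; [exact: cvg_cst|exact: cq].
    by move=> t; rewrite ip_sint; exact: (modulation_orthogonal c_gt0 wave (ch t)).
  - move=> t; apply: le_trans (yb t) _; rewrite ler_wpM2r// lerDl.
    by apply: mulr_ge0; exact: ltW.
  - move=> t; rewrite daE; have [pv pg hv] := hd t.
    apply: le_trans (hC2 h t _ (a t) pv pg hv) _.
    apply: (@le_trans _ _ (C2 * (C1 * H1norm h0))); first by rewrite ler_pM2l.
    by rewrite mulrA ler_wpM2r// lerDr ltW.
move=> a' [[_ oa'] _ _]; apply/funext => t.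
by rewrite (modulation_unique c_gt0 wave ch (oa' t)).
Qed.
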